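(* Let $G$ be the Chevalley supergroup functor and $\mathbf G$ the Chevalley supergroup attached to $\mathfrak g$, $V$ (and an admissible lattice $M$ of $V$) over $k$. The group product yields isomorphisms of (set-valued) functors $$G_0\times G_1^{-,<}\times G_1^{+,<}\ \xrightarrow{\ \cong\ }\ G\ ,\qquad \mathbf G_0\times\mathbf G_1^{-,<}\times\mathbf G_1^{+,<}\ \xrightarrow{\ \cong\ }\ \mathbf G$$ as well as those obtained by permuting the $(-)$-factor and the $(+)$-factor and/or moving the $(0)$-factor to the right. Moreover, all these induce similar functor isomorphisms with the left-hand side obtained by permuting the factors above, such as $G_1^{+,<}\times G_0\times G_1^{-,<}\cong G$, $\ \mathbf G_1^{-,<}\times\mathbf G_0\times\mathbf G_1^{+,<}\cong\mathbf G$, etc.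
   Context: $\mathbb K$ is an algebraically closed field of characteristic $0$. A finite dimensional non-Abelian Lie superalgebra $\mathfrak g=\mathfrak g_0\oplus\mathfrak g_1$ over $\mathbb K$ is classical if it has no nontrivial homogeneous ideals and $\mathfrak g_1$ is completely reducible as a $\mathfrak g_0$-module; by Kac these are the simple Lie algebras and $A(m,n),B(m,n),C(n),D(m,n),F(4),G(3),D(2,1;a),P(n),Q(n)$ (Kac's notation), where $P(n)=\big\{\begin{pmatrix}A&B\\C&-A^t\end{pmatrix}: A\in\mathfrak{sl}(n+1),\,B^t=B,\,C^t=-C\big\}$. Standing assumption: $\mathfrak g$ is classical, not of type $A(1,1)$, $P(3)$, $Q(n)$, nor $D(2,1;a)$ with $a\notin\mathbb Z$. Roots. $\mathfrak h$ is a fixed Cartan subalgebra of $\mathfrak g_0$; $\mathfrak g_\alpha=\{x\in\mathfrak g: [h,x]=\alpha(h)x\ \forall h\in\mathfrak h\}$; $\Delta_0=\{\alpha\ne0:\mathfrak g_\alpha\cap\mathfrak g_0\neq0\}$, $\Delta_1=\{\alpha:\mathfrak g_\alpha\cap\mathfrak g_1\ne0\}$, $\Delta=\Delta_0\cup\Delta_1$; $\ell=\dim\mathfrak h$. On $\mathfrak h$ and $\mathfrak h^*$ one has a nondegenerate symmetric form $(\ ,\ )$: the restriction of an even nondegenerate invariant form on $\mathfrak g$ if $\mathfrak g$ is not of type $P(n)$, and the one coming from $\mathfrak g_0\cong\mathfrak{sl}(n+1)$ for $P(n)$. Fix a distinguished simple root system $\Pi$ (all its elements even except one, if $\mathfrak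 g_1\neq0$; every root is a sum of elements of $\Pi$, ''positive'', or the opposite of such a sum, ''negative''); $\Delta^\pm$ are the positive/negative roots, $\Delta_i^\pm=\Delta^\pm\cap\Delta_i$. Coroots. If $\mathfrak g$ is not of type $P(n)$, $H_\alpha\in\mathfrak h$ is proportional to the element dual to $\alpha$ under the form, normalized by $\alpha(H_\alpha)=2$ if $(\alpha,\alpha)\ne0$, and, if $(\alpha,\alpha)=0$, so that the numbers $\beta(H_\alpha)$ $(\beta\in\Delta)$ generate $\mathbb Z$ (unique up to an immaterial sign, with $H_{-\alpha}=-H_\alpha$). For $P(n)$, with $\varepsilon_i$ the diagonal coordinates, the even roots are $\alpha_{i,j}=\varepsilon_i-\varepsilon_j$ with usual coroots, the odd ones are $\pm\beta_{i,j}$, $\beta_{i,j}=\beta_{j,i}=\varepsilon_i+\varepsilon_j$ $(i<j)$, and $\gamma_i=2\varepsilon_i$; the positive odd roots are the $\beta_{i,j}$ and $\gamma_i$; $H_{\pm\beta_{i,j}}:=\pm H_{\alpha_{i,j}}$ $(i<j)$; sums and strings of roots of $P(n)$ are computed formally in the free $\mathbb Z$-module on $\varepsilon_1,\dots,\varepsilon_{n+1}$. The $\alpha$-string through $\beta$ is $\{\beta-r\alpha,\dots,\beta+q\alpha\}$ with $r,q\geq0$ largest such that $\beta+j\alpha\in\Delta\cup\{0\}$ for $-r\le j\le q$. A Chevalley basis of $\mathfrak g$ is a homogeneous $\mathbb K$-basis $\{H_1,\dots,H_\ell\}\sqcup\{X_\alpha\}_{\alpha\in\Delta}$ such that: (a)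 $\{H_i\}$ is a $\mathbb K$-basis of $\mathfrak h$, and $\mathfrak h_{\mathbb Z}:=\mathrm{Span}_{\mathbb Z}(H_1,\dots,H_\ell)=\mathrm{Span}_{\mathbb Z}\{H_\alpha:\alpha\in\Delta\cap(-\Delta)\}$; (b) $[H_i,H_j]=0$, $[H_i,X_\alpha]=\alpha(H_i)X_\alpha$; (c) $[X_\alpha,X_{-\alpha}]=\sigma_\alpha H_\alpha$ for $\alpha\in\Delta\cap(-\Delta)$, with $\sigma_\alpha=-1$ if $\alpha\in\Delta_1^-$ and $\sigma_\alpha=1$ otherwise; (d) $[X_\alpha,X_\beta]=c_{\alpha,\beta}X_{\alpha+\beta}$ for $\alpha\ne-\beta$, where: if $\alpha+\beta\notin\Delta$, then $c_{\alpha,\beta}=0$, $X_{\alpha+\beta}:=0$; if $\alpha+\beta\in\Delta$ and $(\alpha,\alpha)\ne0$ or $(\beta,\beta)\neq0$, then $c_{\alpha,\beta}=\pm(r+1)$ with $r$ from the $\alpha$-string through $\beta$, except that $c_{\alpha,\beta}=\pm(r+2)$ if $\mathfrak g=P(n)$, $\alpha=\beta_{j,i}$, $\beta=\alpha_{i,j}$; if $\alpha+\beta\in\Delta$ and $(\alpha,\alpha)=0=(\beta,\beta)$, then $c_{\alpha,\beta}=\pm\beta(H_\alpha)$. Fix a Chevalley basis. $K_{\mathbb Z}(\mathfrak g)$ is the unital $\mathbb Z$-subsuperalgebra of $U(\mathfrak g)$ generated by all $X_\alpha^{(n)}:=X_\alpha^n/n!$ $(\alpha\in\Delta_0)$, $X_\gamma$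 $(\gamma\in\Delta_1)$, $\binom{H_i}{n}$, $n\in\mathbb N$. Module. $V$ is a faithful finite dimensional rational $\mathfrak g$-module, i.e. $V=\bigoplus_\mu V_\mu$ (weight spaces for $\mathfrak h$) and $\mu(H_i)\in\mathbb Z$ for all $i$ and all weights $\mu$ of $V$; $M$ is an admissible lattice of $V$, i.e. a $K_{\mathbb Z}(\mathfrak g)$-stable $\mathbb Z$-span of a $\mathbb K$-basis of $V$. Supergroups. $k$ is a commutative unital ring in which $2$ and $3$ are nonzero and not zero divisors; all $k$-modules are assumed without $2$- and $3$-torsion. $(\mathrm{salg})$ is the category of commutative $k$-superalgebras $A=A_0\oplus A_1$ ($xy=(-1)^{p(x)p(y)}yx$ on homogeneous elements) with parity preserving unital morphisms. Put $V_k=k\otimes_{\mathbb Z}M$, $V_k(A)=A\otimes_kV_k$, and let $\mathrm{GL}(V_k(A))$ be its group of parity preserving $A$-linear automorphisms. In it define: $x_\alpha(t)=\exp(tX_\alpha)=\sum_nt^nX_\alpha^{(n)}$ for $\alpha\in\Delta_0$, $t\in A_0$; $x_\gamma(\vartheta)=1+\vartheta X_\gamma$ for $\gamma\in\Delta_1$, $\vartheta\in A_1$; if $\gamma\in\Delta_1$ and $2\gamma\in\Delta$, also $x_\gamma(t,\vartheta)=(1+\vartheta X_\gamma)\exp(tX_\gamma^2)$ (where $X_\gamma^2=\frac12[X_\gamma,X_\gamma]=\pm2X_{2\gamma}$); $h_i(t)$ for $t\in U(A_0)$ (units), acting on $V_\mu$-components as $t^{\mu(H_i)}$. Let $x_\delta(A)$,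 $h_i(A)$ be the sets of all such elements (for $2\gamma\in\Delta$, $x_\gamma(A)$ is the set of all $x_\gamma(t,\vartheta)$). Put $G_0(A)=\langle h_i(A),x_\alpha(A): 1\le i\le\ell,\alpha\in\Delta_0\rangle$ and $G(A)=\langle G_0(A),x_\beta(A):\beta\in\Delta_1\rangle$; $G:(\mathrm{salg})\to(\mathrm{groups})$ is the Chevalley supergroup functor. For fixed total orders on $\Delta_1^+$ and $\Delta_1^-$, with $N_\pm=|\Delta_1^\pm|$ and $\gamma_1\prec\cdots\prec\gamma_{N_\pm}$ the elements of $\Delta_1^\pm$, put $G_1^{\pm,<}(A)=\{\prod_{i=1}^{N_\pm}x_{\gamma_i}(\vartheta_i):\vartheta_1,\dots,\vartheta_{N_\pm}\in A_1\}$ (product in the given order). Boldface $\mathbf G,\mathbf G_0,\mathbf G_1^{\pm,<}$ denote sheafifications of $G,G_0,G_1^{\pm,<}$ for the Zariski topology (coverings of $A$: families $A\to A[f_i^{-1}]$ with $f_i\in A_0$ generating the unit ideal); $\mathbf G$ is the Chevalley supergroup. *)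

(* Defs.v *)
From HB Require Import structures.
From mathcomp Require Import all_boot all_order all_algebra.
From mathcomp Require Import boolp classical_sets.
Set Implicit Arguments.
Unset Strict Implicit.
Unset Printing Implicit Defensive.
Import GRing.Theory.
Local Open Scope classical_set_scope.
Local Open Scope ring_scope.

(* Parities are booleans: [false] is even, [true] is odd.                     *)

Definition zspan (W : zmodType) (S : set W) : set W :=
  [set x | exists s : seq (W * int),
     (forall p, p \in s -> S p.1) /\ x = \sum_(p <- s) p.1 *~ p.2].

Definition no23torsion (W : zmodType) : Prop :=
  forall w : W, (w *+ 2 = 0 -> w = 0) /\ (w *+ 3 = 0 -> w = 0).

Definition enumerates (T : eqType) (s : seq T) (S : set T) : Prop :=
  uniq s /\ forall c, c \in s <-> S c.

Definition psign (R : pzRingType) (a b : bool) : R := (-1) ^+ (a && b).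

(** * Lie superalgebras and their modules *)

Record lieSuperalg (K : fieldType) := LieSuperalg {
  lie_space :> vectType K;
  lie_part : bool -> {vspace lie_space};
  br : lie_space -> lie_space -> lie_space;
  lie_sum : (lie_part false + lie_part true)%VS = fullv;
  lie_direct : (lie_part false :&: lie_part true)%VS = 0%VS;
  br_linl : forall y, linear (br^~ y);
  br_linr : forall x, linear (br x);
  br_part : forall a b x y, x \in lie_part a -> y \in lie_part b ->
    br x y \in lie_part (a (+) b);
  br_anti : forall a b x y, x \in lie_part a -> y \in lie_part b ->
    br x y = - (psign K a b *: br y x);
  br_jacobi : forall a b x y z, x \in lie_part a -> y \in lie_part b ->
    br x (br y z) = br (br x y) z + psign K a b *: br y (br x z) }.
Arguments lie_part {K} l _.
Arguments br {K l} _ _.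

Record superModule (K : fieldType) (g : lieSuperalg K) := SuperModule {
  mod_space :> vectType K;
  mod_part : bool -> {vspace mod_space};
  act : g -> mod_space -> mod_space;
  mod_sum : (mod_part false + mod_part true)%VS = fullv;
  mod_direct : (mod_part false :&: mod_part true)%VS = 0%VS;
  act_linl : forall v, linear (act^~ v);
  act_linr : forall x, linear (act x);
  act_part : forall a b x v, x \in lie_part g a -> v \in mod_part b ->
    act x v \in mod_part (a (+) b);
  act_br : forall a b x y v, x \in lie_part g a -> y \in lie_part g b ->
    act (br x y) v = act x (act y v) - psign K a b *: act y (act x v) }.
Arguments mod_part {K g} s _.
Arguments act {K g} s _ _.

Section Classical.
Variables (K : fieldType) (g : lieSuperalg K).

Definition homogeneous_ideal (I : {vspace g}) : Prop :=
  (I <= (I :&: lie_part g false) + (I :&: lie_part g true))%VS /\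
  forall x y, y \in I -> br x y \in I.

Definition even_submodule (W : {vspace g}) : Prop :=
  (W <= lie_part g true)%VS /\
  forall x y, x \in lie_part g false -> y \in W -> br x y \in W.

Definition classical : Prop :=
  [/\ exists x y : g, br x y != 0,
      forall I, homogeneous_ideal I -> I = 0%VS \/ I = fullv
    & forall W, even_submodule W -> exists W', even_submodule W' /\
        (W + W')%VS = lie_part g true /\ (W :&: W')%VS = 0%VS].

Definition cartan_subalgebra (h : {vspace g}) : Prop :=
  [/\ (h <= lie_part g false)%VS,
      forall x y, x \in h -> y \in h -> br x y \in h,
      exists n, forall (s : seq g) x, size s = n -> {subset s <= h} ->
        x \in h -> foldr br x s = 0
    & forall x, x \in lie_part g false ->
        (forall y, y \in h -> br x y \in h) -> x \in h].

(** ** The types occurring in the standing assumptions *)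

(* [g] is the quotient of the matrix Lie superalgebra [S false (+) S true],
   with the supercommutator as bracket, by its central ideal [Z], via [pi].   *)
Definition matrix_model m (S : bool -> set 'M[K]_m) (Z : set 'M[K]_m)
    (pi : 'M[K]_m -> g) : Prop :=
  [/\ linear pi,
      forall a y, y \in lie_part g a <-> exists2 M, S a M & pi M = y,
      forall a b M N, S a M -> S b N ->
        pi (M *m N - psign K a b *: (N *m M)) = br (pi M) (pi N)
    & forall a M, S a M -> (pi M = 0 <-> Z M)].

Definition scalars m : set 'M[K]_m := [set M | exists c, M = c%:M].

Definition sl22_part (a : bool) : set 'M[K]_(2 + 2) :=
  if a then [set M | exists B C, M = block_mx 0 B C 0]
  else [set M | exists A D, \tr A = \tr D /\ M = block_mx A 0 0 D].

Definition P_part n (a : bool) : set 'M[K]_(n.+1 + n.+1) :=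
  if a then [set M | exists B C, [/\ B^T = B, C^T = - C
                                   & M = block_mx 0 B C 0]]
  else [set M | exists A, \tr A = 0 /\ M = block_mx A 0 0 (- A^T)].

Definition Q_part n (a : bool) : set 'M[K]_(n.+1 + n.+1) :=
  if a then [set M | exists B, \tr B = 0 /\ M = block_mx 0 B B 0]
  else [set M | exists A, M = block_mx A 0 0 A].

Definition type_A11 : Prop :=
  exists pi, matrix_model sl22_part (@scalars _) pi.
Definition type_P n : Prop :=
  exists pi, matrix_model (@P_part n) [set 0] pi.
Definition type_Q n : Prop :=
  exists pi, matrix_model (@Q_part n) (@scalars _) pi.

(* For a simple [g] this says that [g] is the contragredient Lie superalgebra
   with Cartan matrix [C] and odd simple root vectors [e i], [tau i = true].  *)
Definition contragredient r (C : 'M[K]_r) (tau : 'I_r -> bool) : Prop :=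
  exists (e f : 'I_r -> g) (t : r.-tuple g),
  [/\ (forall i, [/\ e i \in lie_part g (tau i), f i \in lie_part g (tau i)
                   & tnth t i \in lie_part g false]),
      free t,
      (forall i j, br (tnth t i) (tnth t j) = 0) /\
      (forall i j, br (e i) (f j) = if i == j then tnth t i else 0),
      (forall i j, br (tnth t i) (e j) = C i j *: e j /\
                   br (tnth t i) (f j) = - (C i j *: f j))
    & forall W : {vspace g}, (forall i, e i \in W /\ f i \in W) ->
        (forall x y, x \in W -> y \in W -> br x y \in W) -> W = fullv].

(* Rows (0, 1, a), (-1, 2, 0), (-1, 0, 2). *)
Definition D21_cartan (a : K) : 'M[K]_3 :=
  \matrix_(i < 3, j < 3)
    nth 0 (nth [::] [:: [:: 0; 1; a]; [:: -1; 2; 0]; [:: -1; 0; 2]] i) j.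

Definition type_D21 (a : K) : Prop :=
  [/\ a != 0, a != -1
    & contragredient (D21_cartan a) (fun i : 'I_3 => i == 0)].

(* Distinct parameters may give isomorphic algebras, e.g. D(2,1;2) and
   D(2,1;1/2): the type D(2,1;a) is kept when some parameter is an integer.   *)
Definition standing_type : Prop :=
  [/\ ~ type_A11, ~ type_P 3,
      forall n, (1 < n)%N -> ~ type_Q n
    & forall a, type_D21 a -> exists z : int, type_D21 z%:~R].

Definition even_invariant_form (B : g -> g -> K) : Prop :=
  [/\ (forall x (a : K) y z, B x (a *: y + z) = a * B x y + B x z) /\
      (forall z (a : K) x y, B (a *: x + y) z = a * B x z + B y z),
      (forall a b x y, x \in lie_part g a -> y \in lie_part g b ->
         B x y = psign K a b * B y x) /\
      (forall x y, x \in lie_part g false -> y \in lie_part g true ->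
         B x y = 0),
      (forall x y z, B (br x y) z = B x (br y z))
    & forall x, (forall y, B x y = 0) -> x = 0].

End Classical.
Arguments P_part K n a : clear implicits.

(** * Roots *)

Section Roots.
Variables (K : fieldType) (g : lieSuperalg K) (h : {vspace g}).

Notation hdual := 'Hom(subvs_of h, K^o).

(* Value of a linear form on [h] at [x : g], meaningful for [x \in h]. *)
Definition pairing (mu : hdual) (x : g) : K := mu (vsproj h x).

Definition dual_vector (F : g -> g -> K) (mu : hdual) : g :=
  xget 0 [set x | x \in h /\ forall y, y \in h -> F x y = pairing mu y].

(* The form induced on the dual of [h] by the restriction of [F] to [h]. *)
Definition dual_form (F : g -> g -> K) (mu nu : hdual) : K :=
  pairing mu (dual_vector F nu).

(* Roots live in a lattice [rd_lat], where their sums and strings are formed,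
   and [rd_ev] sends them to linear forms on [h]. Outside of type P(n) the
   lattice is the dual of [h] itself; in type P(n) it is the free Z-module on
   the [epsilon_i]. [rd_exc a b] marks the pairs for which the structure
   constant of a Chevalley basis is r + 2 rather than r + 1.                  *)
Record rootDatum := RootDatum {
  rd_lat : zmodType;
  rd_ev : rd_lat -> hdual;
  rd_part : bool -> set rd_lat;
  rd_form : g -> g -> K;
  rd_coroot : rd_lat -> g;
  rd_simple : set rd_lat;
  rd_exc : rd_lat -> rd_lat -> Prop }.

Arguments rd_part : clear implicits.
Arguments rd_simple : clear implicits.

Definition root_part (a : bool) : set hdual :=
  [set mu | (~~ a ==> (mu != 0)) /\
     exists2 x, x \in lie_part g a & x != 0 /\
       forall y, y \in h -> br y x = pairing mu y *: x].

Section RootDatumTheory.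
Variable R : rootDatum.
Notation L := (rd_lat R).

Definition Delta : set L := [set c | rd_part R false c \/ rd_part R true c].
Definition rpair (c : L) (x : g) : K := pairing (rd_ev c) x.
Definition rnorm (c : L) : K :=
  dual_form (rd_form R) (rd_ev c) (rd_ev c).

(* Sums of simple roots, formed by adding one simple root at a time while
   staying inside the roots, with parities adding up. Plain sums in the dual
   of [h] would not do: for A(n,n) the simple roots satisfy a linear relation
   with positive coefficients there, so that every root is a plain sum of
   simple ones; for A(2,2) a sum of two odd roots may even be an odd root.    *)
Inductive positive : L -> Prop :=
| positive_simple a : rd_simple R a -> positive a
| positive_add p q c a : positive c -> rd_simple R a ->
    rd_part R p c -> rd_part R q a -> rd_part R (p (+) q) (c + a) ->
    positive (c + a).

Definition negative (c : L) : Prop := positive (- c).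

Definition distinguished : Prop :=
  [/\ rd_simple R `<=` Delta,
      forall c, Delta c -> positive c \/ negative c,
      forall c, ~ (positive c /\ negative c),
      forall c c', positive c -> positive c' -> ~ rd_simple R (c + c')
    & lie_part g true <> 0%VS ->
        exists! a, rd_simple R a /\ rd_part R true a].

Definition odd_signed (s : bool) : set L :=
  [set c | rd_part R true c /\ if s then positive c else negative c].

(* [r] is the largest integer with b, b - a, ..., b - r a in roots or 0. *)
Definition string_depth (a b : L) (r : nat) : Prop :=
  (forall j, (j <= r)%N -> Delta (b - a *+ j) \/ b - a *+ j = 0) /\
  ~ (Delta (b - a *+ r.+1) \/ b - a *+ r.+1 = 0).

(* Coroots outside of type P(n); [s] lists the roots. *)
Definition standard_coroots (s : seq L) : Prop :=
  forall c, Delta c ->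
  [/\ exists t : K, rd_coroot c = t *: dual_vector (rd_form R) (rd_ev c),
      rd_coroot (- c) = - rd_coroot c,
      rnorm c != 0 -> rpair c (rd_coroot c) = 2
    & rnorm c = 0 ->
        (forall c', Delta c' -> exists z : int, rpair c' (rd_coroot c) = z%:~R)
        /\ exists m : L -> int,
             \sum_(c' <- s) rpair c' (rd_coroot c) *~ m c' = 1].

End RootDatumTheory.
Arguments Delta : clear implicits.
Arguments distinguished : clear implicits.
Arguments odd_signed : clear implicits.

(** ** Type P(n) *)

Section TypeP.
Variable n : nat.

Definition eps (i : 'I_n.+1) : 'rV[int]_n.+1 := delta_mx 0 i.

Definition P_roots (a : bool) : set 'rV[int]_n.+1 :=
  if a then
    [set c | (exists i j, i != j /\
                (c = eps i + eps j \/ c = - (eps i + eps j))) \/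
             exists i, c = eps i *+ 2]
  else [set c | exists i j, i != j /\ c = eps i - eps j].

Definition P_odd_positive : set 'rV[int]_n.+1 :=
  [set c | (exists i j, i != j /\ c = eps i + eps j) \/
           exists i, c = eps i *+ 2].

Definition P_exc (a b : 'rV[int]_n.+1) : Prop :=
  exists i j, [/\ i != j, a = eps i + eps j & b = eps i - eps j].

(* The element of P(n) with upper left block [diag_mx d]. *)
Definition P_diag (d : 'rV[K]_n.+1) : 'M[K]_(n.+1 + n.+1) :=
  block_mx (diag_mx d) 0 0 (- diag_mx d).

Definition P_alpha_coroot (i j : 'I_n.+1) : 'M[K]_(n.+1 + n.+1) :=
  P_diag (delta_mx 0 i - delta_mx 0 j).

End TypeP.

Inductive standard_rootDatum : rootDatum -> Prop :=
| standard_not_P (B : g -> g -> K) (Hc : hdual -> g) (Pi : set hdual)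
    (s : seq hdual) :
    let R := @RootDatum ('Hom(subvs_of h, K^o) : zmodType) id root_part B Hc Pi
                        (fun _ _ => False) in
    ~ (exists2 n, (1 < n)%N & type_P g n) ->
    even_invariant_form B ->
    enumerates s (Delta R) ->
    standard_coroots (R := R) s ->
    standard_rootDatum R
| standard_P (n : nat) (pi : 'M[K]_(n.+1 + n.+1) -> g)
    (ev : 'rV[int]_n.+1 -> hdual) (F : g -> g -> K)
    (Hc : 'rV[int]_n.+1 -> g) (Pi : set 'rV[int]_n.+1) :
    let R := @RootDatum ('rV[int]_n.+1 : zmodType) ev (@P_roots n) F Hc Pi
                        (@P_exc n) in
    (1 < n)%N ->
    matrix_model (P_part K n) [set 0] pi ->
    (* [h] is the diagonal subalgebra, [ev c] the form with coordinates [c],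
       and the form on [h] is the trace form of sl(n+1).                      *)
    (forall x, x \in h <->
       exists2 d : 'rV_n.+1, \sum_i d 0 i = 0 & x = pi (P_diag d)) ->
    (forall (c : 'rV_n.+1) (d : 'rV_n.+1), \sum_i d 0 i = 0 ->
       pairing (ev c) (pi (P_diag d)) = \sum_i d 0 i *~ c 0 i) ->
    (forall d d' : 'rV_n.+1, \sum_i d 0 i = 0 -> \sum_i d' 0 i = 0 ->
       F (pi (P_diag d)) (pi (P_diag d')) = \sum_i d 0 i * d' 0 i) ->
    (forall i j, i != j -> Hc (eps i - eps j) = pi (P_alpha_coroot i j)) ->
    (forall i j : 'I_n.+1, (i < j)%N ->
       Hc (eps i + eps j) = pi (P_alpha_coroot i j) /\
       Hc (- (eps i + eps j)) = - pi (P_alpha_coroot i j)) ->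
    (forall c, odd_signed R true c <-> P_odd_positive c) ->
    standard_rootDatum R.

(** * Chevalley bases *)

Definition chevalley_sign (R : rootDatum) (c : rd_lat R) : K :=
  if `[< rd_part R true c /\ negative c >] then -1 else 1.

Definition pm (x : K) : set K := [set y | y = x \/ y = - x].

Definition chevalley_basis (R : rootDatum) l (H : l.-tuple g)
    (X : rd_lat R -> g) : Prop :=
  [/\ exists s : seq (rd_lat R),
        [/\ enumerates s (Delta R), basis_of fullv (H ++ map X s)
          & forall a c, rd_part R a c -> X c \in lie_part g a],
      basis_of h H /\
      zspan [set` H] =
        zspan [set x | exists c, [/\ Delta R c, Delta R (- c)
                                   & x = rd_coroot c]],
      (forall i j, br (tnth H i) (tnth H j) = 0) /\
      (forall i c, Delta R c ->
         br (tnth H i) (X c) = rpair c (tnth H i) *: X c),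
      forall c, Delta R c -> Delta R (- c) ->
        br (X c) (X (- c)) = chevalley_sign c *: rd_coroot c
    & forall a b, Delta R a -> Delta R b -> a <> - b ->
        (~ Delta R (a + b) -> br (X a) (X b) = 0) /\
        (Delta R (a + b) -> exists2 t : K, br (X a) (X b) = t *: X (a + b) &
          (rnorm a != 0 \/ rnorm b != 0 ->
             exists2 r, string_depth a b r &
               (~ rd_exc a b -> pm r.+1%:R t) /\
               (rd_exc a b -> pm r.+2%:R t)) /\
          (rnorm a = 0 -> rnorm b = 0 -> pm (rpair b (rd_coroot a)) t))].

End Roots.
Arguments rd_part {K g h} _ _ _.
Arguments rd_simple {K g h} _ _.
Arguments Delta {K g h} _ _.
Arguments distinguished {K g h} _.
Arguments odd_signed {K g h} _ _ _.

(** * Rational modules and admissible lattices *)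

Section Modules.
Variables (K : fieldType) (g : lieSuperalg K) (h : {vspace g}).
Variables (V : superModule g).

Definition faithful : Prop := forall x, (forall v, act V x v = 0) -> x = 0.

Definition weight_vector (mu : 'Hom(subvs_of h, K^o)) (v : V) : Prop :=
  forall x, x \in h -> act V x v = pairing mu x *: v.

Definition rational l (H : l.-tuple g) : Prop :=
  (forall v : V, exists s : seq V,
     (forall w, w \in s -> exists mu, weight_vector mu w) /\
     v = \sum_(w <- s) w) /\
  (forall mu v, v != 0 -> weight_vector mu v ->
     forall i, exists z : int, pairing mu (tnth H i) = z%:~R).

Definition divided_power (f : V -> V) (n : nat) (v : V) : V :=
  (n`!%:R)^-1 *: iter n f v.

Fixpoint falling_power (f : V -> V) (n : nat) (v : V) : V :=
  if n is m.+1 then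
    let w := falling_power f m v in f w - m%:R *: w
  else v.

Definition binomial_power (f : V -> V) (n : nat) (v : V) : V :=
  (n`!%:R)^-1 *: falling_power f n v.

Definition lattice d (b : d.-tuple V) : set V := zspan [set` b].

(* The Z-span of [b] is an admissible lattice, compatible with the parity of
   [V]; stability under the Kostant form is stability under its generators.   *)
Definition admissible_lattice (R : rootDatum h) l (H : l.-tuple g)
    (X : rd_lat R -> g) d (b : d.-tuple V) : Prop :=
  [/\ basis_of fullv b,
      forall v, v \in b -> v \in mod_part V false \/ v \in mod_part V true
    & forall v, lattice b v ->
      [/\ forall c n, rd_part R false c ->
            lattice b (divided_power (act V (X c)) n v),
          forall c, rd_part R true c -> lattice b (act V (X c) v)
        & forall i n, lattice b (binomial_power (act V (tnth H i)) n v)]].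

(* The integer equal to [x], when there is one. *)
Definition integer_of (x : K) : int := xget 0 [set z : int | z%:~R = x].

Definition lattice_coord d (b : d.-tuple V) (v : V) : 'rV[int]_d :=
  \row_i integer_of (coord b i v).

(* Row [j] holds the coordinates of the image of the [j]-th basis vector. *)
Definition lattice_mx d (b : d.-tuple V) (f : V -> V) : 'M[int]_d :=
  \matrix_(j, i) integer_of (coord b i (f (tnth b j))).

End Modules.
Arguments lattice_coord {K g V d} b v.
Arguments lattice_mx {K g V d} b f.

(** * Commutative superalgebras, presheaves and Zariski sheaves *)

(* The carrier may be the zero ring, as localizations require. The base ring
   acts through [sa_unit], which is central as its image is even.             *)
Record salg (k : comNzRingType) := Salg {
  sa_ring :> pzRingType;
  sa_part : bool -> set sa_ring;
  sa_unit : {rmorphism k -> sa_ring};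
  sa_unit_even : forall c, sa_part false (sa_unit c);
  sa_sub : forall a x y, sa_part a x -> sa_part a y -> sa_part a (x - y);
  sa_mul : forall a b x y, sa_part a x -> sa_part b y ->
    sa_part (a (+) b) (x * y);
  sa_sum : forall x, exists x0 x1,
    [/\ sa_part false x0, sa_part true x1 & x = x0 + x1];
  sa_direct : forall x, sa_part false x -> sa_part true x -> x = 0;
  sa_comm : forall a b x y, sa_part a x -> sa_part b y ->
    x * y = psign sa_ring a b * (y * x);
  sa_torsion : no23torsion sa_ring }.
Arguments sa_part {k} s _.

Record salg_mor (k : comNzRingType) (A B : salg k) := SalgMor {
  sm_fun :> {rmorphism A -> B};
  sm_unit : forall c, sm_fun (sa_unit A c) = sa_unit B c;
  sm_part : forall a x, sa_part A a x -> sa_part B a (sm_fun x) }.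

Section Presheaves.
Variable k : comNzRingType.

Record presheaf := Presheaf {
  ps_obj :> salg k -> Type;
  ps_map : forall A B : salg k, salg_mor A B -> ps_obj A -> ps_obj B;
  ps_id : forall A (i : salg_mor A A) x, i =1 id -> ps_map i x = x;
  ps_comp : forall A B C (f : salg_mor A B) (f' : salg_mor B C)
      (f'' : salg_mor A C) x,
    f'' =1 f' \o f -> ps_map f'' x = ps_map f' (ps_map f x) }.

Record nat_trans (F F' : presheaf) := NatTrans {
  nt_fun :> forall A, F A -> F' A;
  nt_nat : forall A B (f : salg_mor A B) x,
    nt_fun (ps_map f x) = ps_map f (nt_fun x) }.

Definition nat_iso (F F' : presheaf) (u : nat_trans F F') : Prop :=
  exists u' : nat_trans F' F,
    forall A, cancel (u A) (u' A) /\ cancel (u' A) (u A).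

Definition is_localization (A B : salg k) (x : A) (f : salg_mor A B) : Prop :=
  [/\ exists y, y * f x = 1 /\ f x * y = 1,
      forall b, exists a n, b * f x ^+ n = f a
    & forall a, f a = 0 -> exists n, a * x ^+ n = 0].

Record zariski_cover (A : salg k) := ZariskiCover {
  zc_size : nat;
  zc_elt : 'I_zc_size -> A;
  zc_obj : 'I_zc_size -> salg k;
  zc_mor : forall i, salg_mor A (zc_obj i);
  zc_even : forall i, sa_part A false (zc_elt i);
  zc_loc : forall i, is_localization (zc_elt i) (zc_mor i);
  zc_unit : exists c : 'I_zc_size -> A,
    (forall i, sa_part A false (c i)) /\ \sum_i c i * zc_elt i = 1 }.

Arguments zc_obj {A} z i.
Arguments zc_mor {A} z i.

Definition matching (F : presheaf) A (U : zariski_cover A)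
    (s : forall i, F (zc_obj U i)) : Prop :=
  forall i j (C : salg k) (f : salg_mor (zc_obj U i) C)
      (f' : salg_mor (zc_obj U j) C),
    f \o zc_mor U i =1 f' \o zc_mor U j -> ps_map f (s i) = ps_map f' (s j).

Definition is_sheaf (F : presheaf) : Prop :=
  forall A (U : zariski_cover A) s, matching (F := F) (U := U) s ->
    exists! x : F A, forall i, ps_map (zc_mor U i) x = s i.

Definition is_sheafification (F F' : presheaf) (u : nat_trans F F') : Prop :=
  is_sheaf F' /\
  forall (S : presheaf) (w : nat_trans F S), is_sheaf S ->
    exists w' : nat_trans F' S,
      (forall A x, w' A (u A x) = w A x) /\
      forall w'' : nat_trans F' S, (forall A x, w'' A (u A x) = w A x) ->
        forall A y, w'' A y = w' A y.

Section Products.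

Definition prod2_map (X Y : presheaf) A B (f : salg_mor A B)
  (p : X A * Y A) : X B * Y B := (ps_map f p.1, ps_map f p.2).

Fact prod2_id (X Y : presheaf) A (i : salg_mor A A) (p : X A * Y A) :
  i =1 id -> prod2_map i p = p.
Proof. by case: p => x y e; rewrite /prod2_map /= !ps_id. Qed.

Fact prod2_comp (X Y : presheaf) A B C (f : salg_mor A B) (f' : salg_mor B C)
    (f'' : salg_mor A C) (p : X A * Y A) :
  f'' =1 f' \o f -> prod2_map f'' p = prod2_map f' (prod2_map f p).
Proof. by move=> e; rewrite /prod2_map /= -!(ps_comp _ e). Qed.

Definition prod2 (X Y : presheaf) : presheaf :=
  @Presheaf (fun A => X A * Y A)%type (@prod2_map X Y) (@prod2_id X Y)
            (@prod2_comp X Y).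

Definition prod3 (X Y Z : presheaf) : presheaf := prod2 (prod2 X Y) Z.

(* (x, y, z) |-> j x * j' y * j'' z *)
Definition triple_product (G X Y Z : presheaf) (mul : nat_trans (prod2 G G) G)
    (j : nat_trans X G) (j' : nat_trans Y G) (j'' : nat_trans Z G) :
  nat_trans (prod3 X Y Z) G.
Proof.
exists (fun A (p : prod3 X Y Z A) =>
          mul A (mul A (j A p.1.1, j' A p.1.2), j'' A p.2)).
move=> A B f [[x y] z] /=; rewrite -nt_nat /=; congr (mul B _).
by rewrite /prod2_map /= -nt_nat /= /prod2_map /= !nt_nat.
Defined.

Definition swap12 (X Y Z : presheaf) : nat_trans (prod3 X Y Z) (prod3 Y X Z).
Proof. by exists (fun A (p : prod3 X Y Z A) => ((p.1.2, p.1.1), p.2)). Defined.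

Definition swap23 (X Y Z : presheaf) : nat_trans (prod3 X Y Z) (prod3 X Z Y).
Proof. by exists (fun A (p : prod3 X Y Z A) => ((p.1.1, p.2), p.1.2)). Defined.

Definition nat_comp (X Y Z : presheaf) (v : nat_trans Y Z)
    (u : nat_trans X Y) : nat_trans X Z.
Proof.
by exists (fun A x => v A (u A x)) => A B f x; rewrite !nt_nat.
Defined.

(* [m] is an isomorphism, and so are the morphisms it induces on the products
   of the same three factors taken in any other order.                        *)
Definition iso_in_all_orders (X Y Z W : presheaf)
    (m : nat_trans (prod3 X Y Z) W) : Prop :=
  [/\ nat_iso m,
      nat_iso (nat_comp m (swap12 Y X Z)) /\
      nat_iso (nat_comp m (swap23 X Z Y)),
      nat_iso (nat_comp m (nat_comp (swap12 Y X Z) (swap23 Y Z X))),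
      nat_iso (nat_comp m (nat_comp (swap23 X Z Y) (swap12 Z X Y)))
    & nat_iso (nat_comp m (nat_comp (swap12 Y X Z)
                             (nat_comp (swap23 Y Z X) (swap12 Z Y X))))].

(* The group product of [G] induces isomorphisms onto [G] from the products
   of [X0], [Xm], [Xp] with [X0] placed first or last. With [X0] in the middle
   the isomorphism is the induced one, not the product in that order: already
   for osp(1|2) the latter is not injective, as x_-(theta) w x_+(eta) equals
   w x_+(+-theta) x_+(eta) when w represents the Weyl reflection.             *)
Definition product_decompositions (G X0 Xm Xp : presheaf)
    (mul : nat_trans (prod2 G G) G) (j0 : nat_trans X0 G)
    (jm : nat_trans Xm G) (jp : nat_trans Xp G) : Prop :=
  [/\ iso_in_all_orders (triple_product mul j0 jm jp),
      iso_in_all_orders (triple_product mul j0 jp jm),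
      iso_in_all_orders (triple_product mul jm jp j0)
    & iso_in_all_orders (triple_product mul jp jm j0)].

Definition nat_prod2 (X X' Y Y' : presheaf) (u : nat_trans X X')
    (v : nat_trans Y Y') : nat_trans (prod2 X Y) (prod2 X' Y').
Proof.
exists (fun A (p : prod2 X Y A) => (u A p.1, v A p.2)).
by move=> A B f [x y]; rewrite /= /prod2_map /= !nt_nat.
Defined.

(* [f'] extends [f] along [u] and [v]: f' o u = v o f. *)
Definition extends_along (X X' Y Y' : presheaf) (u : nat_trans X X')
    (v : nat_trans Y Y') (f : nat_trans X Y) (f' : nat_trans X' Y') : Prop :=
  forall A x, f' A (u A x) = v A (f A x).

End Products.

End Presheaves.

(** * The Chevalley supergroup functor *)

Section MatrixGroups.
Variables (A : pzRingType) (d : nat).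

(* An A-linear endomorphism of the free left A-module with basis b_1, ..., b_d
   is given by the matrix acting on row vectors from the right; hence
   composition reverses the matrix product.                                   *)
Definition compmx (F F' : 'M[A]_d) : 'M[A]_d := F' *m F.

Inductive generated (S : set 'M[A]_d) : 'M[A]_d -> Prop :=
| generated_gen F : S F -> generated S F
| generated_one : generated S 1%:M
| generated_mul F F' : generated S F -> generated S F' ->
    generated S (compmx F F')
| generated_inv F F' : generated S F -> compmx F F' = 1%:M ->
    compmx F' F = 1%:M -> generated S F'.

Definition basechange_mx m n (M : 'M[int]_(m, n)) : 'M[A]_(m, n) :=
  map_mx (fun z : int => z%:~R) M.

(* [t ^ z] for a unit [t] with inverse [t']. *)
Definition unit_power (t t' : A) (z : int) : A :=
  match z with Posz n => t ^+ n | Negz n => t' ^+ n.+1 end.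

End MatrixGroups.

Section MatrixMorphisms.
Variables (A B : pzRingType) (f : {rmorphism A -> B}) (d : nat).

Fact map_compmx (F F' : 'M[A]_d) :
  map_mx f (compmx F F') = compmx (map_mx f F) (map_mx f F').
Proof. exact: map_mxM. Qed.

Fact map_basechange m n (M : 'M[int]_(m, n)) :
  map_mx f (basechange_mx A M) = basechange_mx B M.
Proof. by apply/matrixP=> i j; rewrite !mxE rmorph_int. Qed.

Fact map_unit_power (t t' : A) z :
  f (unit_power t t' z) = unit_power (f t) (f t') z.
Proof. by case: z => n /=; rewrite rmorphXn. Qed.

Fact map_generated (S : set 'M[A]_d) (S' : set 'M[B]_d) :
  (forall F, S F -> S' (map_mx f F)) ->
  forall F, generated S F -> generated S' (map_mx f F).
Proof.
move=> SS' F; elim=> {F} [F /SS'|| F F' _ IH _ IH'| F F' _ IH e e'].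
- exact: generated_gen.
- by rewrite map_mx1; apply: generated_one.
- by rewrite map_compmx; apply: generated_mul.
- apply: generated_inv IH _ _; rewrite -map_compmx ?e ?e' map_mx1 //.
Qed.

End MatrixMorphisms.

Section ChevalleyFunctor.
Variables (k : comNzRingType) (K : fieldType) (g : lieSuperalg K).
Variables (h : {vspace g}) (R : rootDatum h) (l : nat) (H : l.-tuple g).
Variables (X : rd_lat R -> g) (V : superModule g) (d : nat) (b : d.-tuple V).

Section Points.
Variable A : pzRingType.

(* exp(t f); the operators [f] used below are nilpotent on [V], so that their
   [d]-th power is zero.                                                      *)
Definition exp_mx (f : V -> V) (t : A) : 'M[A]_d :=
  \sum_(n < d) t ^+ n *: basechange_mx A (lattice_mx b (divided_power f n)).

Definition x_even (c : rd_lat R) (t : A) : 'M[A]_d := exp_mx (act V (X c)) t.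

(* 1 + theta X_c. As theta X_c (a (x) m) = (-1)^|a| (theta a) (x) X_c m
   = (a theta) (x) X_c m, no sign enters the matrix.                          *)
Definition x_odd (c : rd_lat R) (theta : A) : 'M[A]_d :=
  1%:M + theta *: basechange_mx A (lattice_mx b (act V (X c))).

Definition x_odd2 (c : rd_lat R) (t theta : A) : 'M[A]_d :=
  compmx (x_odd c theta) (exp_mx (fun v => act V (X c) (act V (X c) v)) t).

(* [F] is h_i(t): multiplication by t^{mu(H_i)} on the weight spaces. *)
Definition is_h (i : 'I_l) (t t' : A) (F : 'M[A]_d) : Prop :=
  forall mu v (z : int), lattice b v -> weight_vector (h := h) mu v ->
    pairing mu (tnth H i) = z%:~R ->
    basechange_mx A (lattice_coord b v) *m F =
    unit_power t t' z *: basechange_mx A (lattice_coord b v).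

Definition odd_product (s : seq (rd_lat R)) (theta : rd_lat R -> A) :
  'M[A]_d := foldr (fun c F => compmx (x_odd c (theta c)) F) 1%:M s.

End Points.

Section Subsets.
Variable A : salg k.

Inductive G0_gen : set 'M[A]_d :=
| G0_gen_h i t t' F : sa_part A false t -> sa_part A false t' ->
    t * t' = 1 -> is_h i t t' F -> G0_gen F
| G0_gen_x c t : rd_part R false c -> sa_part A false t ->
    G0_gen (x_even c t).

Definition G0_set : set 'M[A]_d := generated G0_gen.

(* If 2c is a root, x_c(theta) = x_c(0, theta) is redundant but harmless. *)
Inductive G_gen : set 'M[A]_d :=
| G_gen_0 F : G0_set F -> G_gen F
| G_gen_1 c theta : rd_part R true c -> sa_part A true theta ->
    G_gen (x_odd c theta)
| G_gen_2 c t theta : rd_part R true c -> Delta R (c *+ 2) ->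
    sa_part A false t -> sa_part A true theta -> G_gen (x_odd2 c t theta).

Definition G_set : set 'M[A]_d := generated G_gen.

Definition G1_set (s : seq (rd_lat R)) : set 'M[A]_d :=
  [set F | exists2 theta, (forall c, sa_part A true (theta c))
                        & F = odd_product s theta].

End Subsets.

Section Functoriality.
Variables (A B : salg k) (f : salg_mor A B).

Fact map_exp_mx (u : V -> V) t :
  map_mx f (exp_mx (A := A) u t) = exp_mx (A := B) u (f t).
Proof.
rewrite /exp_mx raddf_sum /=; apply: eq_bigr => n _.
by rewrite map_mxZ map_basechange rmorphXn.
Qed.

Fact map_x_odd c t : map_mx f (x_odd (A := A) c t) = x_odd (A := B) c (f t).
Proof. by rewrite /x_odd map_mxD map_mx1 map_mxZ map_basechange. Qed.

Fact map_odd_product s (theta : rd_lat R -> A) :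
  map_mx f (odd_product (A := A) s theta) = odd_product (A := B) s (f \o theta).
Proof.
elim: s => [|c s IH] /=; first exact: map_mx1.
by rewrite map_compmx IH map_x_odd.
Qed.

Fact map_is_h i t t' (F : 'M[A]_d) :
  is_h i t t' F -> is_h (A := B) i (f t) (f t') (map_mx f F).
Proof.
move=> HF mu v z bv wv e; rewrite -(map_basechange f) -map_mxM (HF mu v z) //.
by rewrite map_mxZ map_unit_power.
Qed.

Fact G0_map F : G0_set (A := A) F -> G0_set (A := B) (map_mx f F).
Proof.
apply: map_generated => {}F [i t t' {}F t0 t'0 tt' Fh|c t c0 t0].
- apply: (G0_gen_h (sm_part f t0) (sm_part f t'0) _ (map_is_h Fh)).
  by rewrite -rmorphM tt' rmorph1.
- by rewrite map_exp_mx; apply: G0_gen_x => //; apply: sm_part.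
Qed.

Fact G_map F : G_set (A := A) F -> G_set (A := B) (map_mx f F).
Proof.
apply: map_generated => {}F [{}F F0|c t c1 t1|c t u c1 c2 t0 u1].
- exact/G_gen_0/G0_map.
- by rewrite map_x_odd; apply: G_gen_1 => //; apply: sm_part.
- rewrite /x_odd2 map_compmx map_x_odd map_exp_mx.
  by apply: G_gen_2 => //; apply: sm_part.
Qed.

Fact G1_map s F : G1_set (A := A) s F -> G1_set (A := B) s (map_mx f F).
Proof.
move=> [theta t1 ->]; exists (f \o theta); last exact: map_odd_product.
by move=> c; apply: sm_part.
Qed.

End Functoriality.

(* The subfunctor of A |-> 'M[A]_d given by [S]. *)
Section Subfunctor.
Variable S : forall A : salg k, set 'M[A]_d.
Hypothesis S_map : forall (A B : salg k) (f : salg_mor A B) F,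
  S F -> S (map_mx f F).

Definition sub_map A B (f : salg_mor A B) (x : {F | S (A := A) F}) :
  {F | S (A := B) F} := exist _ (map_mx f (sval x)) (S_map f (svalP x)).

Fact sub_id A (i : salg_mor A A) x : i =1 id -> sub_map i x = x.
Proof.
by case: x => F SF e; apply: eq_exist; rewrite /= (map_mx_id e).
Qed.

Fact sub_comp A B C (f : salg_mor A B) (f' : salg_mor B C)
    (f'' : salg_mor A C) x :
  f'' =1 f' \o f -> sub_map f'' x = sub_map f' (sub_map f x).
Proof.
case: x => F SF e; apply: eq_exist; rewrite /=.
by apply/matrixP=> i j; rewrite !mxE e.
Qed.

Definition subfunctor : presheaf k :=
  @Presheaf k (fun A => {F | S (A := A) F}) sub_map sub_id sub_comp.

End Subfunctor.

Definition G0_functor : presheaf k := subfunctor G0_map.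
Definition G_functor : presheaf k := subfunctor G_map.
Definition G1_functor (s : seq (rd_lat R)) : presheaf k :=
  subfunctor (fun A B f F => @G1_map A B f s F).

Definition G_mul : nat_trans (prod2 G_functor G_functor) G_functor.
Proof.
exists (fun A (p : prod2 G_functor G_functor A) =>
  exist (G_set (A := A)) (compmx (sval p.1) (sval p.2))
        (generated_mul (svalP p.1) (svalP p.2))).
by move=> A B f [x y]; apply: eq_exist; rewrite /= map_compmx.
Defined.

Definition G0_incl : nat_trans G0_functor G_functor.
Proof.
exists (fun A (x : G0_functor A) =>
  exist (G_set (A := A)) (sval x) (generated_gen (G_gen_0 (svalP x)))).
by move=> A B f x; apply: eq_exist.
Defined.

Fact odd_product_in_G (A : salg k) (s : seq (rd_lat R)) theta :
  (forall c, c \in s -> rd_part R true c) ->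
  (forall c, sa_part A true (theta c)) ->
  G_set (A := A) (odd_product (A := A) s theta).
Proof.
elim: s => [|c s IH] sR t1 /=; first exact: generated_one.
apply: generated_mul.
  by apply: generated_gen; apply: G_gen_1 => //; apply: sR; apply: mem_head.
by apply: IH => // c' c's; apply: sR; rewrite in_cons c's orbT.
Qed.

Section Inclusion.
Variables (a : bool) (s : seq (rd_lat R)).
Hypothesis s_enum : enumerates s (odd_signed R a).

Fact G1_sub A F : G1_set (A := A) s F -> G_set (A := A) F.
Proof.
move=> [theta t1 ->]; apply: odd_product_in_G => // c cs.
by have [_ /(_ c) [/(_ cs) []]] := s_enum.
Qed.

Definition G1_incl : nat_trans (G1_functor s) G_functor.
Proof.
exists (fun A (x : G1_functor s A) =>
  exist (G_set (A := A)) (sval x) (G1_sub (svalP x))).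
by move=> A B f x; apply: eq_exist.
Defined.

End Inclusion.
End ChevalleyFunctor.

(* Main.v *)
Require Import Defs.
From HB Require Import structures.
From mathcomp Require Import all_boot all_order all_algebra.
From mathcomp Require Import zify ring ssrAC.
From mathcomp Require Import boolp classical_sets.
Set Implicit Arguments.
Unset Strict Implicit.
Unset Printing Implicit Defensive.
Import GRing.Theory.
Local Open Scope ring_scope.

(* Given finitely many odd parameters, let J be the ideal they generate; it is
   nilpotent.  A commutator of root factors 1 + theta X_c whose parameters lie
   in J^p and J^q is a product of factors with parameters in J^(p+q), so, by
   downward induction on the level, every element of G(A) is a product of odd
   root factors in any prescribed order, times an element of G_0(A).
   For uniqueness, suppose P(theta) F = P(theta') F' with F, F' in G_0(A).
   If theta = theta' modulo J^q then the even matrix P(theta')^-1 P(theta) is,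
   modulo J^(q+1), 1 + sum_c (theta_c - theta'_c) X_c, whose odd part must
   vanish.  The X_c are independent over A modulo any subgroup without
   2-torsion in the quotient: the projectors on the weight spaces preserve the
   lattice, and X_c with X_{-c} gives H_c, whose values generate Z or 2Z.
   Hence theta = theta' modulo J^(q+1).  Taking inverses exchanges the two
   sides of G_0, and other orders of the factors on the left are permutations
   of a set-theoretic product.
   Natural transformations into a sheaf form a sheaf, because covers pull back
   along any morphism; currying then shows that a product of sheafifications
   is a sheafification of the product.                                        *)

(** * Commutative superalgebras *)

(** The commutator of X_c and X_{-c} leaves the root vectors, so the factors handled are 1 + ze z
    with z anywhere in the Z-span of the Chevalley basis. When ze is even with square zero and z is
    even, such a factor lies in G_0: 1 + ze X_a is x_a(ze) and 1 + ze H_i is h_i(1 + ze). This is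
    how even commutators are absorbed. Bringing elements of G_0 to one side requires that they
    normalize the products of odd factors; for x_a(t) this rests on exp(- t ad X_a) X_c, which is
    integral because the constants +-(r + 1) along a string multiply to a binomial times a
    factorial. For independence, the integral projectors are products of binomials in the H_i. They
    see roots only through their restriction to h, and in P(3) the distinct roots eps_1 + eps_2 and
    -(eps_3 + eps_4) agree there. The root 2 eps_i of P(n) has no opposite and is first carried to
    eps_i + eps_j by an even root vector. Matrices act on rows, so [compmx] reverses [*m], and
    products and brackets of operators appear with their factors exchanged. *)

Section Superalgebra.
Variables (k : comNzRingType) (A : salg k).
Implicit Types (a : bool) (x y : A).

Lemma part0 a : sa_part A a 0.
Proof.
have [x0 [x1 [p0 p1 _]]] := sa_sum (s := A) 0.
by case: a; [rewrite -(subrr x1)|rewrite -(subrr x0)]; apply: sa_sub.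
Qed.

Lemma partN a x : sa_part A a x -> sa_part A a (- x).
Proof. by move=> px; rewrite -[- x]add0r; apply: sa_sub => //; apply: part0. Qed.

Lemma partD a x y : sa_part A a x -> sa_part A a y -> sa_part A a (x + y).
Proof. by move=> px py; rewrite -[y]opprK; apply: sa_sub => //; apply: partN. Qed.

Lemma part_sum a I (r : seq I) (P : pred I) (F : I -> A) :
  (forall i, P i -> sa_part A a (F i)) -> sa_part A a (\sum_(i <- r | P i) F i).
Proof. by move=> pF; apply: big_ind => //; [apply: part0|apply: partD]. Qed.

Lemma part_mulrn a x n : sa_part A a x -> sa_part A a (x *+ n).
Proof.
by move=> px; elim: n => [|n IH]; rewrite ?mulr0n ?mulrS;
  [apply: part0|apply: partD].
Qed.

Lemma part_mulrz a x (z : int) : sa_part A a x -> sa_part A a (x *~ z).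
Proof.
by move=> px; case: z => n; rewrite ?NegzE ?mulrNz -?pmulrn;
  [|apply: partN]; apply: part_mulrn.
Qed.

Lemma part1 : sa_part A false 1.
Proof. by rewrite -(rmorph1 (sa_unit A)); apply: sa_unit_even. Qed.

Lemma part_int (z : int) : sa_part A false z%:~R.
Proof. exact/part_mulrz/part1. Qed.

Lemma partM a a' x y :
  sa_part A a x -> sa_part A a' y -> sa_part A (a (+) a') (x * y).
Proof. exact: sa_mul. Qed.

Lemma part_evenX x n : sa_part A false x -> sa_part A false (x ^+ n).
Proof.
by move=> px; elim: n => [|n IH]; rewrite ?expr0 ?exprS;
  [apply: part1|apply: (partM px IH)].
Qed.

Lemma even_central x y : sa_part A false x -> x * y = y * x.
Proof.
move=> px; have [y0 [y1 [p0 p1 ->]]] := sa_sum y.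
rewrite mulrDr mulrDl (sa_comm px p0) (sa_comm px p1).
by rewrite /psign !expr0 !mul1r.
Qed.

Lemma odd_anticomm x y :
  sa_part A true x -> sa_part A true y -> x * y = - (y * x).
Proof. by move=> px py; rewrite (sa_comm px py) /psign expr1 mulN1r. Qed.

Lemma odd_sqr0 x : sa_part A true x -> x * x = 0.
Proof.
move=> px; apply: (proj1 (sa_torsion (x * x))).
by rewrite mulr2n {1}(odd_anticomm px px) addNr.
Qed.

Lemma part_uniq x0 x1 y0 y1 :
  sa_part A false x0 -> sa_part A true x1 ->
  sa_part A false y0 -> sa_part A true y1 ->
  x0 + x1 = y0 + y1 -> x0 = y0 /\ x1 = y1.
Proof.
move=> px0 px1 py0 py1 e; have e' : x0 - y0 = y1 - x1.
  by apply/eqP; rewrite subr_eq addrAC [y1 + y0]addrC -e addrK.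
have z : x0 - y0 = 0.
  by apply: sa_direct; [apply: sa_sub|rewrite e'; apply: sa_sub].
split; first by apply/eqP; rewrite -subr_eq0 z.
by apply/esym/eqP; rewrite -subr_eq0 -e' z.
Qed.

Lemma odd_swap x y0 y1 : sa_part A true x -> sa_part A false y0 ->
  sa_part A true y1 -> x * (y0 + y1) = (y0 - y1) * x.
Proof.
move=> px p0 p1.
by rewrite mulrDr mulrBl (odd_anticomm px p1) -(even_central x p0).
Qed.

(** Odd elements square to zero and anticommute, so the [q]-th power of the ideal they generate is
    spanned over [A] by square-free products of [q] of them. Distinguishing whether the head [th]
    occurs gives the recursion, and nilpotency can be read off the length of [L]. *)
Fixpoint odd_power (L : seq A) (q : nat) : set A :=
  if q is q'.+1 then
    if L is th :: L' then
      [set x | exists y z, [/\ odd_power L' q y, odd_power L' q' z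
                             & x = y + z * th]]
    else [set 0]
  else setT.

Lemma odd_power_all L x : odd_power L 0 x.
Proof. by case: L. Qed.

Lemma odd_power_sub L q x y :
  odd_power L q x -> odd_power L q y -> odd_power L q (x - y).
Proof.
elim: L q x y => [|th L IH] [|q] x y //=; first by move=> -> ->; rewrite subr0.
move=> [x1 [x2 [h1 h2 ->]]] [y1 [y2 [h3 h4 ->]]].
exists (x1 - y1), (x2 - y2); split; [exact: IH|exact: IH|].
by rewrite mulrBl opprD addrACA.
Qed.

Lemma odd_power0 L q : odd_power L q 0.
Proof.
elim: L q => [|th L IH] [|q] //=.
by exists 0, 0; split; rewrite ?mul0r ?addr0 //; apply: (IH q.+1).
Qed.

Lemma odd_powerN L q x : odd_power L q x -> odd_power L q (- x).
Proof. by rewrite -{2}[x]subr0 opprB => h; apply: odd_power_sub; first exact: odd_power0. Qed.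

Lemma odd_powerD L q x y :
  odd_power L q x -> odd_power L q y -> odd_power L q (x + y).
Proof. by move=> hx hy; rewrite -[y]opprK; apply/odd_power_sub/odd_powerN. Qed.

Lemma odd_powerW L q x : odd_power L q.+1 x -> odd_power L q x.
Proof.
elim: L q x => [|th L IH] [|q] x //=.
move=> [y [z [hy hz ->]]]; exists y, z; split=> //; [exact: (IH q.+1)|exact: IH].
Qed.

Lemma odd_power_homog L q x : {in L, forall th, sa_part A true th} ->
  odd_power L q x -> exists x0 x1, [/\ sa_part A false x0, sa_part A true x1,
    x = x0 + x1, odd_power L q x0 & odd_power L q x1].
Proof.
elim: L q x => [|th L IH] [|q] x /= Lo.
- by have [x0 [x1 [p0 p1 e]]] := sa_sum x; exists x0, x1.
- move=> ->; exists 0, 0; split; rewrite ?addr0 //; exact: part0.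
- by have [x0 [x1 [p0 p1 e]]] := sa_sum x; exists x0, x1.
have Lo' : {in L, forall th, sa_part A true th}.
  by move=> t tL; apply: Lo; rewrite in_cons tL orbT.
have tho : sa_part A true th by apply: Lo; rewrite mem_head.
move=> [y [z [hy hz ->]]].
have [y0 [y1 [py0 py1 -> hy0 hy1]]] := IH q.+1 _ Lo' hy.
have [z0 [z1 [pz0 pz1 -> hz0 hz1]]] := IH q _ Lo' hz.
exists (y0 + z1 * th), (y1 + z0 * th); split.
- by apply: partD => //; apply: (partM pz1 tho).
- by apply: partD => //; apply: (partM pz0 tho).
- by rewrite addrACA -mulrDl [z1 + z0]addrC.
- by exists y0, (z1).
- by exists y1, z0.
Qed.

Lemma odd_powerM L p q x y : {in L, forall th, sa_part A true th} ->
  odd_power L p x -> odd_power L q y -> odd_power L (p + q) (x * y).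
Proof.
elim: L p q x y => [|th L IH] p q x y Lo.
  case: p => [|p] hx; last first.
    by have -> : x = 0 by []; rewrite mul0r => _; apply: odd_power0.
  case: q => [|q] // hy.
  by have -> : y = 0 by []; rewrite mulr0; apply: odd_power0.
have Lo' : {in L, forall th, sa_part A true th}.
  by move=> t tL; apply: Lo; rewrite in_cons tL orbT.
have tho : sa_part A true th by apply: Lo; rewrite mem_head.
(* A splitting uniform in the level: at [r = 0] the predecessor is again 0, where membership is no
   condition. *)
have dec r u : odd_power (th :: L) r u -> exists y z,
    [/\ odd_power L r y, odd_power L r.-1 z & u = y + z * th].
  case: r => [|r] //= _; exists u, 0; rewrite mul0r addr0; split=> //; exact: odd_power_all.
move=> /dec [x1 [x2 [hx1 hx2 ->]]] /dec [y1 [y2 [hy1 hy2 ->]]].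
case pq : (p + q)%N => [|r] //=.
have [u0 [u1 [pu0 pu1 eu hu0 hu1]]] := odd_power_homog Lo' hy1.
have [v0 [v1 [pv0 pv1 ev hv0 hv1]]] := odd_power_homog Lo' hy2.
(* Carrying [th] to the right past [y1 = u0 + u1] flips the sign of the odd part; the term
   containing [th] twice vanishes. *)
exists (x1 * y1), (x1 * y2 + x2 * (u0 - u1)); split.
- by rewrite -pq; apply: IH.
- apply: odd_powerD.
    have := IH p q.-1 _ _ Lo' hx1 hy2; case: q pq {hy1 hy2 hu0 hu1 hv0 hv1} => [|q].
      by rewrite !addn0 => -> /=; apply: odd_powerW.
    by rewrite addnS => -[->].
  have := IH p.-1 q _ _ Lo' hx2 (odd_power_sub hu0 hu1).
  case: p pq {hx1 hx2} => [|p]; last by rewrite addSn => -[->].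
  by rewrite !add0n => -> /=; apply: odd_powerW.
rewrite mulrDr !mulrDl -!addrA; congr (_ + _).
rewrite addrCA mulrA; congr (_ + _).
rewrite -(mulrA x2 th y1) eu (odd_swap tho pu0 pu1) mulrA.
rewrite -(mulrA x2 th) (mulrA th) ev (odd_swap tho pv0 pv1) -(mulrA _ th th).
by rewrite (odd_sqr0 tho) !mulr0 addr0.
Qed.

Lemma odd_power_nil L x : odd_power L (size L).+1 x -> x = 0.
Proof.
suff H : forall L q x, (size L < q)%N -> odd_power L q x -> x = 0 by exact: H.
elim=> [|th L' IH] [|q] y //= lq [y1 [y2 [h1 h2 ->]]].
by rewrite (IH _ _ _ h1) 1?ltnW // (IH _ _ _ h2) // mul0r addr0.
Qed.

(** The properties of the powers of an ideal that the group arguments use. [fil_sat] says that the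
    quotients have no 2- or 3-torsion, and [fil_homog] allows the odd part of an element to be taken
    inside a level. *)
Record filtration (J : nat -> set A) : Prop := Filtration {
  fil0 : forall x, J 0 x;
  fil_zero : forall q, J q 0;
  fil_sub : forall q x y, J q x -> J q y -> J q (x - y);
  filW : forall q x, J q.+1 x -> J q x;
  fil_homog : forall q x, J q x -> exists x0 x1,
    [/\ sa_part A false x0, sa_part A true x1, x = x0 + x1, J q x0 & J q x1];
  filM : forall p q x y, J p x -> J q y -> J (p + q)%N (x * y);
  fil_sat : forall q x, J q (x *+ 2) \/ J q (x *+ 3) -> J q x;
  fil_nil : exists m, forall x, J m x -> x = 0 }.

Lemma odd_power_mulrn L q x n : odd_power L q x -> odd_power L q (x *+ n).
Proof.
move=> hx; elim: n => [|n IH]; first by rewrite mulr0n; apply: odd_power0.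
by rewrite mulrS; apply: odd_powerD.
Qed.

(* Saturating at 2 and 3 makes up for the fact that the root vectors are only
   primitive away from these primes.                                          *)
Lemma odd_filtration (L : seq A) : {in L, forall th, sa_part A true th} ->
  exists2 J, filtration J & {in L, forall th, J 1%N th}.
Proof.
move=> Lo; pose J q : set A := fun x => exists n, odd_power L q (x *+ 6 ^ n).
have J_in q x : odd_power L q x -> J q x by exists 0%N; rewrite expn0 mulr1n.
have tors n (x : A) : x *+ 6 ^ n = 0 -> x = 0.
  elim: n x => [|n IH] x; first by rewrite expn0 mulr1n.
  rewrite expnS -[6%N]/(3 * 2)%N !mulrnA => /IH e.
  by apply: (proj2 (sa_torsion x)); apply: (proj1 (sa_torsion _)).
exists J; last first.
  move=> th thL; apply: J_in; elim: L thL {Lo J tors} => //= t L IH.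
  rewrite in_cons => /orP[/eqP ->|/IH h].
    by exists 0, 1; rewrite mul1r add0r; split=> //; [apply: odd_power0|apply: odd_power_all].
  by exists th, 0; rewrite mul0r addr0; split=> //; apply: odd_power_all.
split.
- by move=> x; apply/J_in/odd_power_all.
- by move=> q; apply/J_in/odd_power0.
- move=> q x y [n hn] [m hm]; exists (n + m)%N; rewrite mulrnBl //; apply: odd_power_sub.
    by rewrite expnD mulrnA; apply: odd_power_mulrn.
  by rewrite addnC expnD mulrnA; apply: odd_power_mulrn.
- by move=> q x [n hn]; exists n; apply: odd_powerW.
- move=> q x [n hn]; have [x0 [x1 [p0 p1 e]]] := sa_sum x.
  have [y0 [y1 [q0 q1 e' h0 h1]]] := odd_power_homog Lo hn.
  have [e0 e1] : x0 *+ 6 ^ n = y0 /\ x1 *+ 6 ^ n = y1.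
    apply: part_uniq => //; try exact: part_mulrn.
    by rewrite -mulrnDl -e.
  by exists x0, x1; split=> //; exists n; rewrite ?e0 ?e1.
- move=> p q x y [n hn] [m hm]; exists (n + m)%N.
  have := odd_powerM Lo hn hm.
  by rewrite mulrnAl mulrnAr -mulrnA mulnC -expnD.
- move=> q x [] [n hn]; exists n.+1.
    have -> : x *+ 6 ^ n.+1 = x *+ 2 *+ 6 ^ n *+ 3.
      by rewrite expnS -[6%N]/(2 * 3)%N mulnAC !mulrnA.
    exact: odd_power_mulrn.
  have -> : x *+ 6 ^ n.+1 = x *+ 3 *+ 6 ^ n *+ 2.
    by rewrite expnS -[6%N]/(3 * 2)%N mulnAC !mulrnA.
  exact: odd_power_mulrn.
exists (size L).+1 => x [n hn]; exact/(tors n)/(odd_power_nil hn).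
Qed.
End Superalgebra.

(** * Localization and the Zariski topology *)

Section Localization.
Variables (k : comNzRingType) (A : salg k) (x : A).
Hypothesis x_even : sa_part A false x.
Local Open Scope quotient_scope.

Let xC n y : x ^+ n * y = y * x ^+ n.
Proof. exact/even_central/part_evenX. Qed.

(** The pair (a, n) stands for a / x^n; the extra power of [x] in the comparison accounts for [x]
    being possibly a zero divisor. *)
Definition frac_eq (u v : A * nat) : bool :=
  `[< exists n, u.1 * x ^+ (v.2 + n) = v.1 * x ^+ (u.2 + n) >].

Fact frac_refl : reflexive frac_eq.
Proof. by move=> u; apply/asboolP; exists 0%N. Qed.

Fact frac_sym : symmetric frac_eq.
Proof.
by move=> u v; apply/asboolP/asboolP => -[n e]; exists n.
Qed.

Fact frac_trans : transitive frac_eq.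
Proof.
move=> [b m] [a n] [c p] /asboolP[i /= e] /asboolP[j /= e']; apply/asboolP.
exists (m + i + j)%N => /=.
have -> : (p + (m + i + j) = (m + i) + (p + j))%N by lia.
have -> : (n + (m + i + j) = (m + j) + (n + i))%N by lia.
rewrite exprD mulrA e -mulrA -exprD addnC exprD mulrA e'.
by rewrite -mulrA -exprD.
Qed.

Canonical frac_equiv := EquivRel frac_eq frac_refl frac_sym frac_trans.

Definition loc_type := {eq_quot frac_equiv}.
HB.instance Definition _ := Choice.on loc_type.
HB.instance Definition _ := EqQuotient.on loc_type.

Definition frac (a : A) (n : nat) : loc_type := \pi_loc_type (a, n).

Lemma frac_eqP a n b m :
  frac a n = frac b m <-> exists i, a * x ^+ (m + i) = b * x ^+ (n + i).
Proof.
split=> [/eqmodP/asboolP // | [i e]].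
by apply/eqmodP/asboolP; exists i.
Qed.

Lemma frac_ind (P : loc_type -> Prop) : (forall a n, P (frac a n)) -> forall u, P u.
Proof. by move=> Pf; elim/quotW => -[a n]; apply: Pf. Qed.

Lemma frac_ext i a n : frac (a * x ^+ i) (n + i) = frac a n.
Proof.
apply/frac_eqP; exists 0%N.
by rewrite -mulrA -exprD; congr (_ * _ ^+ _); lia.
Qed.

Definition loc_add (u v : loc_type) : loc_type :=
  frac ((repr u).1 * x ^+ (repr v).2 + (repr v).1 * x ^+ (repr u).2)
       ((repr u).2 + (repr v).2).
Definition loc_opp (u : loc_type) : loc_type := frac (- (repr u).1) (repr u).2.
Definition loc_mul (u v : loc_type) : loc_type :=
  frac ((repr u).1 * (repr v).1) ((repr u).2 + (repr v).2).

Lemma repr_frac a n : exists i,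
  (repr (frac a n)).1 * x ^+ (n + i) = a * x ^+ ((repr (frac a n)).2 + i).
Proof.
have := reprK (frac a n); case: (repr _) => a' n' /= e.
exact/frac_eqP.
Qed.

(** The operations are defined on chosen representatives; this computation shows that the choice is
    immaterial, and the ring axioms are then checked on explicit fractions. *)
Lemma loc_addE a n b m :
  loc_add (frac a n) (frac b m) = frac (a * x ^+ m + b * x ^+ n) (n + m).
Proof.
rewrite /loc_add; case: (repr_frac a n) (repr_frac b m) => i.
case: (repr _) => a' n' /= e [j].
case: (repr _) => b' m' /= e'.
apply/frac_eqP; exists (i + j)%N.
rewrite !mulrDl -!mulrA -!exprD; congr (_ + _).
  have -> : (m' + (n + m + (i + j)) = (n + i) + (m' + m + j))%N by lia.
  rewrite exprD mulrA e -mulrA -exprD; congr (_ * _ ^+ _); lia.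
have -> : (n' + (n + m + (i + j)) = (m + j) + (n' + n + i))%N by lia.
rewrite exprD mulrA e' -mulrA -exprD; congr (_ * _ ^+ _); lia.
Qed.

Lemma loc_oppE a n : loc_opp (frac a n) = frac (- a) n.
Proof.
rewrite /loc_opp; case: (repr_frac a n) => i.
case: (repr _) => a' n' /= e.
by apply/frac_eqP; exists i; rewrite !mulNr e.
Qed.

Lemma loc_mulE a n b m :
  loc_mul (frac a n) (frac b m) = frac (a * b) (n + m).
Proof.
rewrite /loc_mul; case: (repr_frac a n) (repr_frac b m) => i.
case: (repr _) => a' n' /= e [j].
case: (repr _) => b' m' /= e'.
apply/frac_eqP; exists (i + j)%N.
have -> : (n + m + (i + j) = (n + i) + (m + j))%N by lia.
rewrite exprD mulrA -(mulrA a') -(xC (n + i) b') mulrA e -mulrA e'.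
rewrite mulrA -(mulrA a) xC mulrA -(mulrA _ (x ^+ _)) -exprD.
by congr (_ * _ ^+ _); lia.
Qed.

Fact loc_addA : associative loc_add.
Proof.
elim/frac_ind=> a n; elim/frac_ind=> b m; elim/frac_ind=> c p.
rewrite !loc_addE !mulrDl addnA -!mulrA -!exprD addrA.
by congr (frac (_ + _ + _) _); congr (_ * _ ^+ _); lia.
Qed.

Fact loc_addC : commutative loc_add.
Proof.
elim/frac_ind=> a n; elim/frac_ind=> b m.
by rewrite !loc_addE addrC addnC.
Qed.

Fact loc_add0 : left_id (frac 0 0) loc_add.
Proof. by elim/frac_ind=> b m; rewrite loc_addE mul0r add0r mulr1. Qed.

Fact loc_addN : left_inverse (frac 0 0) loc_opp loc_add.
Proof.
elim/frac_ind=> b m; rewrite loc_oppE loc_addE mulNr addNr.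
by apply/frac_eqP; exists 0%N; rewrite !mul0r.
Qed.

HB.instance Definition _ :=
  GRing.isZmodule.Build loc_type loc_addA loc_addC loc_add0 loc_addN.

Fact loc_mulA : associative loc_mul.
Proof.
elim/frac_ind=> a n; elim/frac_ind=> b m; elim/frac_ind=> c p.
by rewrite !loc_mulE mulrA addnA.
Qed.

Fact loc_mul1 : left_id (frac 1 0) loc_mul.
Proof. by elim/frac_ind=> b m; rewrite loc_mulE mul1r. Qed.

Fact loc_mulr1 : right_id (frac 1 0) loc_mul.
Proof. by elim/frac_ind=> b m; rewrite loc_mulE mulr1 addn0. Qed.

Fact loc_mulDl : left_distributive loc_mul loc_add.
Proof.
elim/frac_ind=> a n; elim/frac_ind=> b m; elim/frac_ind=> c p.
rewrite !(loc_addE, loc_mulE) -(frac_ext p) !mulrDl.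
have h (y z : A) i j : y * x ^+ i * z * x ^+ j = y * z * x ^+ (i + j).
  by rewrite -(mulrA y) xC mulrA -mulrA -exprD.
by rewrite !h; congr frac; lia.
Qed.

Fact loc_mulDr : right_distributive loc_mul loc_add.
Proof.
elim/frac_ind=> c p; elim/frac_ind=> a n; elim/frac_ind=> b m.
rewrite !(loc_addE, loc_mulE) -(frac_ext p) mulrDr !mulrDl.
rewrite !mulrA -!mulrA -!exprD.
by congr (frac (_ * (_ * _ ^+ _) + _ * (_ * _ ^+ _)) _); lia.
Qed.

HB.instance Definition _ := GRing.Zmodule_isPzRing.Build loc_type
  loc_mulA loc_mul1 loc_mulr1 loc_mulDl loc_mulDr.

Lemma fracD a n b m :
  frac a n + frac b m = frac (a * x ^+ m + b * x ^+ n) (n + m).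
Proof. exact: loc_addE. Qed.
Lemma fracN a n : - frac a n = frac (- a) n.
Proof. exact: loc_oppE. Qed.
Lemma fracM a n b m : frac a n * frac b m = frac (a * b) (n + m).
Proof. exact: loc_mulE. Qed.
Lemma frac_eq0 a n : frac a n = 0 <-> exists i, a * x ^+ i = 0.
Proof.
split=> [/frac_eqP[i]|[i e]]; first by rewrite mul0r; exists i.
by apply/frac_eqP; exists i; rewrite mul0r.
Qed.

Lemma fracDn a b n : frac a n + frac b n = frac (a + b) n.
Proof. by rewrite fracD -mulrDl frac_ext. Qed.

Definition loc_map (a : A) : loc_type := frac a 0.

Fact loc_map_additive : {morph loc_map : a b / a - b}.
Proof. by move=> a b; rewrite /loc_map fracN fracDn. Qed.
Fact loc_map_multiplicative : monoid_morphism loc_map.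
Proof. by split=> // a b; rewrite /loc_map fracM. Qed.

HB.instance Definition _ :=
  GRing.isAdditive.Build A loc_type loc_map loc_map_additive.
HB.instance Definition _ :=
  GRing.isMonoidMorphism.Build A loc_type loc_map loc_map_multiplicative.

Definition loc_part (a : bool) : set loc_type :=
  fun u => exists2 y, sa_part A a y & exists n, u = frac y n.

Fact loc_sub a u v : loc_part a u -> loc_part a v -> loc_part a (u - v).
Proof.
move=> [y py [n ->]] [z pz [m ->]]; rewrite fracN fracD mulNr.
exists (y * x ^+ m - z * x ^+ n); last by eexists.
by apply: sa_sub; rewrite -[a]addbF; apply: partM => //; apply: part_evenX.
Qed.

Fact loc_mul_part a b u v :
  loc_part a u -> loc_part b v -> loc_part (a (+) b) (u * v).
Proof.
move=> [y py [n ->]] [z pz [m ->]]; rewrite fracM.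
by exists (y * z); [apply: partM|eexists].
Qed.

Fact loc_sum u : exists u0 u1,
  [/\ loc_part false u0, loc_part true u1 & u = u0 + u1].
Proof.
elim/frac_ind: u => a n; have [a0 [a1 [p0 p1 ->]]] := sa_sum a.
exists (frac a0 n), (frac a1 n); rewrite fracDn.
by split=> //; [exists a0|exists a1] => //; exists n.
Qed.

Fact loc_direct u : loc_part false u -> loc_part true u -> u = 0.
Proof.
move=> [y py [n ->]] [z pz [m /frac_eqP[i e]]]; apply/frac_eq0.
exists (m + i)%N; apply: sa_direct; first exact/(partM py)/part_evenX.
by rewrite e; exact: partM pz (part_evenX _ x_even).
Qed.

Fact loc_comm a b u v : loc_part a u -> loc_part b v ->
  u * v = psign loc_type a b * (v * u).
Proof.
move=> [y py [n ->]] [z pz [m ->]]; rewrite !fracM (sa_comm py pz) addnC.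
rewrite /psign; case: (a && b); rewrite ?expr0 ?expr1 ?mul1r //.
by rewrite !mulN1r fracN.
Qed.

Fact loc_torsion : no23torsion loc_type.
Proof.
have mulrn_frac a n i : frac a n *+ i = frac (a *+ i) n.
  elim: i => [|i IH]; last by rewrite !mulrS IH fracDn.
  by rewrite !mulr0n; apply/esym/frac_eq0; exists 0%N; rewrite mul0r.
elim/frac_ind=> a n; rewrite !mulrn_frac.
split=> /frac_eq0[i e]; apply/frac_eq0; exists i.
  by apply: (proj1 (sa_torsion _)); rewrite -mulrnAl.
by apply: (proj2 (sa_torsion _)); rewrite -mulrnAl.
Qed.

Definition loc_unit : {rmorphism k -> loc_type} := loc_map \o sa_unit A.

Fact loc_unit_even c : loc_part false (loc_unit c).
Proof. by exists (sa_unit A c); [apply: sa_unit_even|exists 0%N]. Qed.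

Definition localization : salg k :=
  Salg loc_unit_even loc_sub loc_mul_part loc_sum loc_direct loc_comm loc_torsion.

Fact loc_map_part a y : sa_part A a y -> sa_part localization a (loc_map y).
Proof. by move=> py; exists y => //; exists 0%N. Qed.

Definition loc_mor : salg_mor A localization :=
  @SalgMor k A localization loc_map (fun=> erefl) loc_map_part.

Lemma loc_mor_localization : is_localization x loc_mor.
Proof.
split.
- exists (frac 1 1); rewrite /= /loc_map !fracM mul1r mulr1.
  by split; apply/frac_eqP; exists 0%N; rewrite mul1r mulr1 ?addn0.
- elim/frac_ind=> b n; exists b, n.
  rewrite -rmorphXn /= /loc_map fracM addn0.
  by rewrite -(frac_ext n b 0) add0n.
- by move=> a /frac_eq0.
Qed.

End Localization.

Arguments zc_obj {k A} z i.
Arguments zc_mor {k A} z i.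

(** * Universal property of localization and pullback of covers *)

Section Morphisms.
Variable k : comNzRingType.

Definition id_mor (A : salg k) : salg_mor A A :=
  @SalgMor k A A idfun (fun=> erefl) (fun _ _ px => px).

Fact comp_mor_unit (A B C : salg k) (f' : salg_mor B C) (f : salg_mor A B) c :
  (f' \o f) (sa_unit A c) = sa_unit C c.
Proof. by rewrite /= !sm_unit. Qed.

Fact comp_mor_part (A B C : salg k) (f' : salg_mor B C) (f : salg_mor A B) a x :
  sa_part A a x -> sa_part C a ((f' \o f) x).
Proof. by move=> px; apply/sm_part/sm_part. Qed.

Definition comp_mor (A B C : salg k) (f' : salg_mor B C) (f : salg_mor A B) :
    salg_mor A C :=
  @SalgMor k A C (f' \o f) (comp_mor_unit f' f) (@comp_mor_part _ _ _ f' f).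

Section LocalizationLift.
Variables (A B C : salg k) (x : A) (f : salg_mor A B) (g : salg_mor A C).
Hypotheses (x_even : sa_part A false x) (f_loc : is_localization x f).
Variable y : C.
Hypotheses (yg : y * g x = 1) (gy : g x * y = 1).

Let gx_even : sa_part C false (g x). Proof. exact: sm_part. Qed.
Let fx_even : sa_part B false (f x). Proof. exact: sm_part. Qed.

Let gxXr n (c c' : C) : c * g x ^+ n = c' * g x ^+ n -> c = c'.
Proof.
elim: n => [|n IH] in c c' *; first by rewrite !mulr1.
by rewrite !exprSr !mulrA => /(congr1 ( *%R^~ y)); rewrite -!mulrA gy !mulr1 => /IH.
Qed.

(** The universal property as a relation over all presentations of [b] as a fraction at once;
    [is_liftP] shows that a single presentation determines the image, so a morphism is obtained
    without choosing numerators coherently. *)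
Definition is_lift (b : B) (c : C) : Prop :=
  forall a n, b * f x ^+ n = f a -> c * g x ^+ n = g a.

Lemma is_liftP b c a n : b * f x ^+ n = f a -> c * g x ^+ n = g a -> is_lift b c.
Proof.
move=> e e' a' n' e''; apply: (@gxXr n).
have [_ _ /(_ (a * x ^+ n' - a' * x ^+ n))[|i]] := f_loc.
  rewrite rmorphB !rmorphM !rmorphXn /= -e -e'' -!mulrA -!exprD addnC.
  by rewrite subrr.
move=> /(congr1 g); rewrite rmorph0 rmorphM rmorphB !rmorphM !rmorphXn /= => h.
have := @gxXr i (g a * g x ^+ n' - g a' * g x ^+ n) 0.
rewrite h mul0r => /(_ erefl)/eqP; rewrite subr_eq0 => /eqP <-.
by rewrite -e' -!mulrA -!exprD addnC.
Qed.

Lemma is_lift_ex b : exists c, is_lift b c.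
Proof.
have [_ /(_ b) [a [n e]] _] := f_loc.
exists (g a * y ^+ n); apply: (is_liftP e).
by rewrite -mulrA -exprMn_comm ?yg ?expr1n ?mulr1 // /GRing.comm yg gy.
Qed.

Definition loc_lift (b : B) : C := sval (cid (is_lift_ex b)).

Lemma loc_liftP b : is_lift b (loc_lift b).
Proof. exact: (svalP (cid (is_lift_ex b))). Qed.

Lemma loc_liftE b c a n :
  b * f x ^+ n = f a -> c * g x ^+ n = g a -> loc_lift b = c.
Proof. by move=> e e'; apply: (@gxXr n); rewrite (loc_liftP e). Qed.

Let fxC n b : f x ^+ n * b = b * f x ^+ n.
Proof. exact/even_central/part_evenX. Qed.
Let gxC n c : g x ^+ n * c = c * g x ^+ n.
Proof. exact/even_central/part_evenX. Qed.

Fact loc_lift_additive : {morph loc_lift : b b' / b - b'}.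
Proof.
move=> b b'; have [_ fr _] := f_loc.
have [a [n e]] := fr b; have [a' [n' e']] := fr b'.
apply: (@loc_liftE _ _ (a * x ^+ n' - a' * x ^+ n) (n + n')).
  by rewrite rmorphB !rmorphM !rmorphXn /= -e -e' mulrBl -!mulrA -!exprD (addnC n).
rewrite rmorphB !rmorphM !rmorphXn /= -(loc_liftP e) -(loc_liftP e').
by rewrite mulrBl -!mulrA -!exprD (addnC n).
Qed.

Fact loc_lift_multiplicative : monoid_morphism loc_lift.
Proof.
split=> [|b b'].
  by apply: (@loc_liftE _ _ 1 0); rewrite mulr1 rmorph1.
have [_ fr _] := f_loc.
have [a [n e]] := fr b; have [a' [n' e']] := fr b'.
apply: (@loc_liftE _ _ (a * a') (n + n')).
  by rewrite exprD mulrA -(mulrA b) -(fxC n) (mulrA b) e -mulrA e' rmorphM.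
rewrite rmorphM -(loc_liftP e) -(loc_liftP e') exprD !mulrA.
by rewrite -[in LHS](mulrA (loc_lift b)) -(gxC n) !mulrA.
Qed.

HB.instance Definition _ :=
  GRing.isAdditive.Build B C loc_lift loc_lift_additive.
HB.instance Definition _ :=
  GRing.isMonoidMorphism.Build B C loc_lift loc_lift_multiplicative.

Lemma loc_lift_mor a : loc_lift (f a) = g a.
Proof. by apply: (@loc_liftE _ _ a 0); rewrite mulr1. Qed.

Fact loc_lift_unit c : loc_lift (sa_unit B c) = sa_unit C c.
Proof. by rewrite -(sm_unit f) loc_lift_mor sm_unit. Qed.

(** The inverse of an even unit is even: comparing odd parts in [y * g x = 1], the odd part of [y]
    is killed by a unit. *)
Let y_even : sa_part C false y.
Proof.
have [y0 [y1 [p0 p1 e]]] := sa_sum y.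
suff -> : y = y0 by [].
have [_ e1] : y0 * g x = 1 /\ y1 * g x = 0.
  apply: part_uniq; last by rewrite -mulrDl -e yg addr0.
  - exact: (partM p0 gx_even).
  - exact: (partM p1 gx_even).
  - exact: part1.
  - exact: part0.
have -> : y = y0 + y1 by [].
by rewrite -[y1]mulr1 -gy mulrA e1 mul0r addr0.
Qed.

Fact loc_lift_part a b : sa_part B a b -> sa_part C a (loc_lift b).
Proof.
move=> pb; have [_ /(_ b) [u [n e]] _] := f_loc.
(* The numerator [u] may be inhomogeneous, but its image is homogeneous, so the component of parity
   [a] has the same image. *)
have pu : exists2 v, sa_part A a v & b * f x ^+ n = f v.
  have [u0 [u1 [p0 p1 eu]]] := sa_sum u; rewrite e eu.
  have pb' : sa_part B a (b * f x ^+ n).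
    by rewrite -[a]addbF; apply: partM => //; apply: part_evenX.
  have := @part_uniq _ _ _ _ (f u0) (f u1) _ _ (sm_part f p0) (sm_part f p1).
  rewrite -rmorphD -eu -e.
  case: a pb pb' => pb pb' h.
    by exists u1 => //; case: (h _ _ (part0 _ _) pb' (add0r _)) => _ <-; rewrite ?add0r.
  by exists u0 => //; case: (h _ _ pb' (part0 _ _) (addr0 _)) => <- _; rewrite ?addr0.
have [v pv ev] := pu.
have -> : loc_lift b = g v * y ^+ n.
  apply: (loc_liftE ev).
  by rewrite -mulrA -exprMn_comm ?yg ?expr1n ?mulr1 // /GRing.comm yg gy.
by rewrite -[a]addbF; apply: partM; [apply: sm_part|apply: part_evenX].
Qed.

Definition loc_lift_salg : salg_mor B C :=
  @SalgMor k B C loc_lift loc_lift_unit loc_lift_part.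

End LocalizationLift.

Lemma loc_lift_exists (A B C : salg k) (x : A) (f : salg_mor A B) (g : salg_mor A C) :
  sa_part A false x -> is_localization x f ->
  (exists y, y * g x = 1 /\ g x * y = 1) ->
  exists h : salg_mor B C, h \o f =1 g.
Proof.
move=> x0 fl [y [yg gy]]; exists (loc_lift_salg x0 fl yg gy) => a.
exact: loc_lift_mor.
Qed.

Section CoverPullback.
Variables (A B : salg k) (e : salg_mor A B) (U : zariski_cover A).

Let elt i : B := e (zc_elt (z := U) i).
Let elt_even i : sa_part B false (elt i).
Proof. exact/sm_part/zc_even. Qed.

Fact pullback_unit : exists c : 'I_(zc_size U) -> B,
  (forall i, sa_part B false (c i)) /\ \sum_i c i * elt i = 1.
Proof.
have [c [c0 e1]] := zc_unit U; exists (e \o c); split=> [i|].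
  exact: sm_part.
by rewrite -(rmorph1 e) -e1 rmorph_sum; apply: eq_bigr => i _; rewrite rmorphM.
Qed.

Definition cover_pullback : zariski_cover B :=
  ZariskiCover elt_even (fun i => loc_mor_localization (elt_even i)) pullback_unit.

(** The image of [zc_elt i] becomes invertible in the localization of [B] at it, so the universal
    property of the given piece of the cover applies. *)
Lemma cover_pullback_lift i :
  exists h : salg_mor (zc_obj U i) (zc_obj cover_pullback i),
    h \o zc_mor U i =1 zc_mor cover_pullback i \o e.
Proof.
have [|||h hE] := @loc_lift_exists A (zc_obj U i) (zc_obj cover_pullback i)
  (zc_elt i) (zc_mor U i) (comp_mor (zc_mor cover_pullback i) e).
- exact: zc_even.
- exact: zc_loc.
- by have [] := loc_mor_localization (elt_even i).
- by exists h.
Qed.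

End CoverPullback.
End Morphisms.

(** * Products of sheafifications *)

Section Sheaves.
Variable k : comNzRingType.
Implicit Types (S X Y Z W : presheaf k).

Lemma ps_ext X (A B : salg k) (f g : salg_mor A B) (x : X A) :
  f =1 g -> ps_map f x = ps_map g x.
Proof.
move=> fg; rewrite (@ps_comp _ X A A B (id_mor A) f g x) ?ps_id //.
by move=> a; rewrite /= fg.
Qed.

Lemma ps_map_comp X (A B C : salg k) (g : salg_mor B C) (f : salg_mor A B) (x : X A) :
  ps_map g (ps_map f x) = ps_map (comp_mor g f) x.
Proof. by rewrite -(@ps_comp _ X A B C f g (comp_mor g f) x). Qed.

Lemma sheaf_separated S (A : salg k) (U : zariski_cover A) (x y : S A) :
  is_sheaf S -> (forall i, ps_map (zc_mor U i) x = ps_map (zc_mor U i) y) -> x = y.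
Proof.
move=> Ssh exy; have [|z [_ zu]] := Ssh A U (fun i => ps_map (zc_mor U i) y).
  by move=> i j C f f' e; rewrite !ps_map_comp; apply: ps_ext.
by rewrite -(zu x exy) -(zu y).
Qed.

(** * Internal homs into a sheaf *)

Section Exponential.
Variables Y S : presheaf k.

(** The internal hom at [A]: natural families from [Y] to [S] over all superalgebras under [A].
    Naturality is stated for any [h] pointwise equal to the composite, which avoids equalities
    between bundled morphisms. *)
Record expo_pt (A : salg k) := ExpoPt {
  expo_at : forall B : salg k, salg_mor A B -> Y B -> S B;
  expo_nat : forall B C (f : salg_mor A B) (e : salg_mor B C) (h : salg_mor A C) y,
    h =1 e \o f -> expo_at h (ps_map e y) = ps_map e (expo_at f y) }.

Lemma expo_ext A (s t : expo_pt A) :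
  (forall B (f : salg_mor A B) y, expo_at s f y = expo_at t f y) -> s = t.
Proof.
case: s t => [s sn] [t tn] /= e.
have est : s = t by apply: functional_extensionality_dep => B; do 2!apply: funext => ?.
by move: sn tn; rewrite est => sn tn; congr ExpoPt; apply: Prop_irrelevance.
Qed.

Lemma expo_at_ext A (s : expo_pt A) B (f g : salg_mor A B) y :
  f =1 g -> expo_at s f y = expo_at s g y.
Proof.
move=> fg; rewrite -[in LHS](@ps_id _ Y B (id_mor B) y) //.
by rewrite (@expo_nat _ s B B g (id_mor B) f) // ps_id.
Qed.

Fact expo_map_nat A A' (e : salg_mor A A') (s : expo_pt A) B C
    (f : salg_mor A' B) (e' : salg_mor B C) (h : salg_mor A' C) y :
  h =1 e' \o f ->
  expo_at s (comp_mor h e) (ps_map e' y) = ps_map e' (expo_at s (comp_mor f e) y).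
Proof. by move=> eh; apply: expo_nat => a /=; rewrite eh. Qed.

Definition expo_map A A' (e : salg_mor A A') (s : expo_pt A) : expo_pt A' :=
  ExpoPt (expo_map_nat e s).

Fact expo_map_id A (i : salg_mor A A) s : i =1 id -> expo_map i s = s.
Proof.
move=> ei; apply: expo_ext => B f y; apply: (@expo_at_ext A s) => a.
by rewrite /= ei.
Qed.

Fact expo_map_comp A B C (f : salg_mor A B) (f' : salg_mor B C)
    (f'' : salg_mor A C) s :
  f'' =1 f' \o f -> expo_map f'' s = expo_map f' (expo_map f s).
Proof.
move=> e; apply: expo_ext => D h y; apply: (@expo_at_ext A s) => a.
by rewrite /= e.
Qed.

Definition expo : presheaf k := Presheaf expo_map_id expo_map_comp.

Hypothesis Ssh : is_sheaf S.

(* A matching family [s] of natural families is glued value by value, over the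
   pullbacks of the cover [U].                                                *)
Section Glue.
Variables (A : salg k) (U : zariski_cover A) (s : forall i, expo (zc_obj U i)).
Hypothesis sm : matching s.

(** The value is tested on every [C] through which some piece of the cover factors, not only on one
    pullback cover. Hence the condition involves no chosen lift and is inherited along morphisms,
    which yields naturality of [glue_at]. *)
Definition glued B (f : salg_mor A B) (y : Y B) (z : S B) : Prop :=
  forall (C : salg k) (e : salg_mor B C) i (h : salg_mor (zc_obj U i) C),
    h \o zc_mor U i =1 e \o f -> ps_map e z = expo_at (s i) h (ps_map e y).

Lemma glued_at_agree i j C (h : salg_mor (zc_obj U i) C) (h' : salg_mor (zc_obj U j) C) y :
  h \o zc_mor U i =1 h' \o zc_mor U j -> expo_at (s i) h y = expo_at (s j) h' y.
Proof.
move=> e; have /(congr1 (fun t : expo_pt C => expo_at t (id_mor C) y)) /= := sm e.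
by rewrite (@expo_at_ext _ (s i) _ _ h) // (@expo_at_ext _ (s j) _ _ h').
Qed.

Lemma glued_ex B (f : salg_mor A B) y : exists z, glued f y z.
Proof.
pose W := cover_pullback f U.
pose h (i : 'I_(zc_size U)) := cid (cover_pullback_lift f i).
pose t i : S (zc_obj W i) := expo_at (s i) (sval (h i)) (ps_map (zc_mor W i) y).
have tm : matching t.
  move=> i j C g g' e; rewrite /t.
  rewrite -(@expo_nat _ (s i) _ _ (sval (h i)) g (comp_mor g (sval (h i)))) //.
  rewrite -(@expo_nat _ (s j) _ _ (sval (h j)) g' (comp_mor g' (sval (h j)))) //.
  rewrite !ps_map_comp (ps_ext y (e : comp_mor g _ =1 comp_mor g' _)).
  apply: glued_at_agree => a /=.
  have /= -> := svalP (h i) a; have /= -> := svalP (h j) a.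
  exact: e.
have [z [zE _]] := Ssh tm; exists z => C e i g ge.
(* The glued value is known only on the pieces of [W]; over an arbitrary [C] the comparison is made
   after pulling [W] back once more. *)
pose W' := cover_pullback e W.
apply: (@sheaf_separated S C W') => // j.
have [l lE] := cover_pullback_lift e j.
rewrite ps_map_comp (@ps_comp _ S _ _ _ (zc_mor W j) l); last by move=> a; exact: (esym (lE a)).
rewrite zE /t -(@expo_nat _ (s j) _ _ (sval (h j)) l (comp_mor l (sval (h j)))) //.
rewrite -(@expo_nat _ (s i) _ _ g (zc_mor W' j) (comp_mor (zc_mor W' j) g)) //.
rewrite !ps_map_comp (ps_ext y (lE : comp_mor l _ =1 comp_mor _ e)).
apply: glued_at_agree => a /=.
have /= -> := svalP (h j) a; have /= -> := ge a.
exact: lE.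
Qed.

Lemma glued_uniq B (f : salg_mor A B) y z z' : glued f y z -> glued f y z' -> z = z'.
Proof.
move=> gz gz'; apply: (@sheaf_separated S B (cover_pullback f U)) => // i.
have [h hE] := cover_pullback_lift f i.
by rewrite (gz _ _ _ _ hE) (gz' _ _ _ _ hE).
Qed.

Definition glue_at B (f : salg_mor A B) y : S B := sval (cid (glued_ex f y)).

Lemma glue_atP B (f : salg_mor A B) y : glued f y (glue_at f y).
Proof. exact: (svalP (cid (glued_ex f y))). Qed.

Fact glue_nat B C (f : salg_mor A B) (e : salg_mor B C) (h : salg_mor A C) y :
  h =1 e \o f -> glue_at h (ps_map e y) = ps_map e (glue_at f y).
Proof.
move=> eh; apply: (glued_uniq (@glue_atP _ h (ps_map e y))) => D g i h' hE.
rewrite !ps_map_comp; refine (@glue_atP _ f y _ _ _ _ _) => a /=.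
by have /= -> := hE a; rewrite eh.
Qed.

Definition glue : expo A := ExpoPt glue_nat.

Lemma glueE i : ps_map (zc_mor U i) glue = s i.
Proof.
apply: expo_ext => B f y /=.
have := @glue_atP _ (comp_mor f (zc_mor U i)) y _ (id_mor B) i f.
by rewrite !ps_id // => ->.
Qed.

Lemma glue_unique (t : expo A) : (forall i, ps_map (zc_mor U i) t = s i) -> glue = t.
Proof.
move=> tE; apply: expo_ext => B f y /=.
apply: (glued_uniq (@glue_atP _ f y)) => C e i h hE.
rewrite -tE /= -(@expo_nat _ t _ _ f e (comp_mor e f)) //.
by apply: expo_at_ext => a; have /= -> := hE a.
Qed.

End Glue.

Lemma expo_sheaf : is_sheaf expo.
Proof.
move=> A U s sm; exists (glue sm); split=> [i|t]; first exact: glueE.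
exact: glue_unique.
Qed.

Definition curry X (w : nat_trans (prod2 X Y) S) : nat_trans X expo.
Proof.
unshelve refine (@NatTrans k X expo (fun A x => @ExpoPt A
    (fun B f y => w B (ps_map f x, y)) _) _).
- move=> B C f e h y eh /=; rewrite -nt_nat /= /prod2_map /=.
  by rewrite (@ps_comp _ X _ _ _ f e h x eh).
- move=> A B f x; apply: expo_ext => C g y /=.
  by rewrite ps_map_comp.
Defined.

Definition uncurry X (w : nat_trans X expo) : nat_trans (prod2 X Y) S.
Proof.
unshelve refine (@NatTrans k (prod2 X Y) S
   (fun A p => expo_at (w A p.1) (id_mor A) p.2) _).
move=> A B f [x y] /=; rewrite nt_nat /=.
by apply: expo_nat.
Defined.

Lemma sheafification_prodl X X' (u : nat_trans X X') (w : nat_trans (prod2 X Y) S) :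
  is_sheafification u -> exists2 w' : nat_trans (prod2 X' Y) S,
    (forall A x y, w' A (u A x, y) = w A (x, y)) &
    forall w'' : nat_trans (prod2 X' Y) S,
      (forall A x y, w'' A (u A x, y) = w A (x, y)) -> forall A p, w'' A p = w' A p.
Proof.
move=> [_ /(_ _ (curry w) expo_sheaf) [v [vE vu]]].
exists (uncurry v) => [A x y|w'' wE A [x y]] /=.
  by rewrite vE /= ps_id.
have h B z : curry w'' B (u B z) = curry w B z.
  by apply: expo_ext => C f t /=; rewrite -nt_nat wE.
have /(congr1 (fun t : expo_pt A => expo_at t (id_mor A) y)) /= <- := vu _ h A x.
by rewrite ps_id.
Qed.

End Exponential.

Definition swap2 X Y : nat_trans (prod2 X Y) (prod2 Y X).
Proof. by exists (fun A (p : prod2 X Y A) => (p.2, p.1)). Defined.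

Lemma prod2_sheaf X Y : is_sheaf X -> is_sheaf Y -> is_sheaf (prod2 X Y).
Proof.
move=> Xsh Ysh A U s sm.
have [|x [xE xu]] := Xsh A U (fun i => (s i).1).
  by move=> i j C f f' e; have /(congr1 fst) := sm i j C f f' e.
have [|y [yE yu]] := Ysh A U (fun i => (s i).2).
  by move=> i j C f f' e; have /(congr1 snd) := sm i j C f f' e.
exists (x, y); split=> [i|[x' y'] e] /=.
  by rewrite /prod2_map /= xE yE; case: (s i).
congr (_, _); first by apply: xu => i; rewrite -e.
by apply: yu => i; rewrite -e.
Qed.

(** One factor is sheafified at a time, the second after an exchange of the factors; uniqueness is
    likewise tested on one factor after the other. *)
Lemma sheafification_prod X X' Y Y' (u : nat_trans X X') (v : nat_trans Y Y') :
  is_sheafification u -> is_sheafification v ->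
  is_sheafification (nat_prod2 u v).
Proof.
move=> uS vS; split; first exact: prod2_sheaf uS.1 vS.1.
move=> S w Ssh.
have [w1 w1E w1u] := sheafification_prodl Ssh w uS.
have [w2 w2E w2u] := sheafification_prodl Ssh (nat_comp w1 (swap2 Y X')) vS.
exists (nat_comp w2 (swap2 X' Y')); split=> [A [x y]|w'' wE A [x y]] /=.
  by rewrite w2E /= w1E.
rewrite -(w2u (nat_comp w'' (swap2 Y' X'))) //= => B y' x'.
pose idv : nat_trans X' X' := @NatTrans k X' X' (fun=> id) (fun _ _ _ _ => erefl).
by rewrite -(w1u (nat_comp w'' (nat_prod2 idv v))) //= => C x'' y''; rewrite (wE C (x'', y'')).
Qed.

Lemma nat_iso_comp X Y Z (v : nat_trans Y Z) (u : nat_trans X Y) :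
  nat_iso v -> nat_iso u -> nat_iso (nat_comp v u).
Proof.
move=> [v' vK] [u' uK]; exists (nat_comp u' v') => A /=.
have [vK1 vK2] := vK A; have [uK1 uK2] := uK A.
by split=> x /=; rewrite ?vK1 ?uK1 ?uK2 ?vK2.
Qed.

(** The inverse of [m'] is the extension of the inverse of [m]; both composites are identities by
    uniqueness in the universal property. *)
Lemma sheafification_iso X X' W W' (u : nat_trans X X') (v : nat_trans W W')
    (m : nat_trans X W) (m' : nat_trans X' W') :
  is_sheafification u -> is_sheafification v -> extends_along u v m m' ->
  nat_iso m -> nat_iso m'.
Proof.
move=> uS vS mm' [n nK].
have [n' [n'E _]] := vS.2 _ (nat_comp u n) uS.1.
pose idn Z : nat_trans Z Z := @NatTrans k Z Z (fun=> id) (fun _ _ _ _ => erefl).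
exists n' => A; split=> x.
  have [t [_ tu]] := uS.2 _ u uS.1.
  rewrite -[RHS]/(idn X' A x) (tu (idn X')) // -(tu (nat_comp n' m')) // => B y /=.
  by rewrite mm' n'E /= (nK B).1.
have [t [_ tu]] := vS.2 _ v vS.1.
rewrite -[RHS]/(idn W' A x) (tu (idn W')) // -(tu (nat_comp m' n')) // => B y /=.
by rewrite n'E /= mm' (nK B).2.
Qed.

Lemma swap12_iso X Y Z : nat_iso (swap12 X Y Z).
Proof. by exists (swap12 Y X Z) => A; split=> -[[x y] z]. Qed.

Lemma swap23_iso X Y Z : nat_iso (swap23 X Y Z).
Proof. by exists (swap23 X Z Y) => A; split=> -[[x y] z]. Qed.

Lemma iso_all_orders X Y Z W (m : nat_trans (prod3 X Y Z) W) :
  nat_iso m -> iso_in_all_orders m.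
Proof.
move=> mi; split=> //; [split|..]; apply: nat_iso_comp => //;
  do ?[exact: swap12_iso|exact: swap23_iso|apply: nat_iso_comp].
Qed.

Lemma nat_iso_bij X Y (u : nat_trans X Y) :
  (forall A, injective (u A)) -> (forall A y, exists x, u A x = y) -> nat_iso u.
Proof.
move=> ui us; pose v A y := sval (cid (us A y)).
have vK A y : u A (v A y) = y := svalP (cid (us A y)).
unshelve eexists.
  exists v => A B f y; apply: ui; rewrite vK nt_nat vK; exact: erefl.
by move=> A; split=> x /=; [apply: ui|]; rewrite vK.
Qed.

Theorem sheafified_decompositions (G X0 Xm Xp : presheaf k)
    (mul : nat_trans (prod2 G G) G) (j0 : nat_trans X0 G)
    (jm : nat_trans Xm G) (jp : nat_trans Xp G)
    (bG bX0 bXm bXp : presheaf k)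
    (u : nat_trans G bG) (u0 : nat_trans X0 bX0)
    (um : nat_trans Xm bXm) (up : nat_trans Xp bXp) :
  nat_iso (triple_product mul j0 jm jp) -> nat_iso (triple_product mul j0 jp jm) ->
  nat_iso (triple_product mul jm jp j0) -> nat_iso (triple_product mul jp jm j0) ->
  is_sheafification u -> is_sheafification u0 ->
  is_sheafification um -> is_sheafification up ->
  let induced (mul' : nat_trans (prod2 bG bG) bG) (j0' : nat_trans bX0 bG)
      (jm' : nat_trans bXm bG) (jp' : nat_trans bXp bG) :=
    [/\ extends_along (nat_prod2 u u) u mul mul', extends_along u0 u j0 j0',
        extends_along um u jm jm' & extends_along up u jp jp'] in
  (exists mul' j0' jm' jp', induced mul' j0' jm' jp') /\
  forall mul' j0' jm' jp', induced mul' j0' jm' jp' ->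
    product_decompositions mul' j0' jm' jp'.
Proof.
move=> i1 i2 i3 i4 uS u0S umS upS induced; split.
  have ext X X' (v : nat_trans X X') (j : nat_trans X G) : is_sheafification v ->
      exists j' : nat_trans X' bG, extends_along v u j j'.
    by move=> vS; have [j' [jE _]] := vS.2 _ (nat_comp u j) uS.1; exists j'.
  have [mul' mulE] := ext _ _ _ mul (sheafification_prod uS uS).
  have [j0' j0E] := ext _ _ _ j0 u0S.
  have [jm' jmE] := ext _ _ _ jm umS.
  have [jp' jpE] := ext _ _ _ jp upS.
  by exists mul', j0', jm', jp'.
move=> mul' j0' jm' jp' [mulE j0E jmE jpE].
have tr X Y Z X' Y' Z' (x : nat_trans X X') (y : nat_trans Y Y') (z : nat_trans Z Z')
    (jx : nat_trans X G) (jy : nat_trans Y G) (jz : nat_trans Z G)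
    (jx' : nat_trans X' bG) (jy' : nat_trans Y' bG) (jz' : nat_trans Z' bG) :
  is_sheafification x -> is_sheafification y -> is_sheafification z ->
  extends_along x u jx jx' -> extends_along y u jy jy' -> extends_along z u jz jz' ->
  nat_iso (triple_product mul jx jy jz) -> iso_in_all_orders (triple_product mul' jx' jy' jz').
  move=> xS yS zS xE yE zE ti; apply: iso_all_orders.
  apply: (sheafification_iso (sheafification_prod (sheafification_prod xS yS) zS) uS) ti.
  move=> A [[a b] c] /=; rewrite xE yE zE.
  by rewrite (mulE A (jx A a, jy A b)) (mulE A (_, jz A c)).
by split; [apply: tr i1|apply: tr i2|apply: tr i3|apply: tr i4]; eassumption.
Qed.

End Sheaves.

(** * Admissible lattices and weights *)

Section ZSpan.
Variables (W : zmodType) (S : set W).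

Lemma zspan0 : zspan S 0.
Proof. by exists [::]; split=> //; rewrite big_nil. Qed.

Lemma zspan_mem x : S x -> zspan S x.
Proof.
move=> Sx; exists [:: (x, 1)]; split=> [p|]; last by rewrite big_seq1.
by rewrite inE => /eqP ->.
Qed.

Lemma zspanD x y : zspan S x -> zspan S y -> zspan S (x + y).
Proof.
move=> [s [sS ->]] [t [tS ->]]; exists (s ++ t); split; last by rewrite big_cat.
by move=> p; rewrite mem_cat => /orP[/sS|/tS].
Qed.

Lemma zspanMz x (z : int) : zspan S x -> zspan S (x *~ z).
Proof.
move=> [s [sS ->]]; exists [seq (p.1, p.2 * z) | p <- s]; split.
  by move=> p /mapP[q /sS Sq ->].
by rewrite big_map mulrz_suml; apply: eq_bigr => p _; rewrite mulrzA.
Qed.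

Lemma zspanN x : zspan S x -> zspan S (- x).
Proof. by rewrite -mulrN1z; apply: zspanMz. Qed.

Lemma zspan_sum I (r : seq I) (P : pred I) (F : I -> W) :
  (forall i, P i -> zspan S (F i)) -> zspan S (\sum_(i <- r | P i) F i).
Proof. by move=> SF; apply: big_ind => //; [apply: zspan0|apply: zspanD]. Qed.

Lemma zspan_ind (P : W -> Prop) : P 0 -> (forall x y, P x -> P y -> P (x + y)) ->
  (forall x (z : int), S x -> P (x *~ z)) -> forall x, zspan S x -> P x.
Proof.
move=> P0 PD PM x [s [sS ->]]; rewrite big_seq.
by apply: big_ind => // p /sS; apply: PM.
Qed.

End ZSpan.

Section CharZero.
Variables (K : fieldType) (hK : [pchar K] =i pred0).

Lemma natK_eq0 n : (n%:R == 0 :> K) = (n == 0)%N.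
Proof. exact: (pcharf0P K).1 hK n. Qed.

Lemma intK_eq0 (z : int) : (z%:~R == 0 :> K) = (z == 0).
Proof.
case: z => n; first by rewrite -pmulrn natK_eq0.
by rewrite NegzE mulrNz oppr_eq0 -pmulrn natK_eq0.
Qed.

Lemma intK_inj : injective (fun z : int => z%:~R : K).
Proof.
move=> z z' e; apply/eqP; rewrite -subr_eq0 -intK_eq0 rmorphB /=.
by rewrite e subrr.
Qed.

Lemma factK_neq0 n : n`!%:R != 0 :> K.
Proof. by rewrite natK_eq0 -lt0n fact_gt0. Qed.

Lemma integer_ofK (z : int) : integer_of (z%:~R : K) = z.
Proof.
rewrite /integer_of; apply: intK_inj.
exact: (@xgetPex _ 0 (fun z' : int => z'%:~R = z%:~R :> K) (ex_intro _ z erefl)).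
Qed.

End CharZero.

Section LinearFun.
Variables (K : fieldType) (U W : lmodType K) (f : U -> W).
Hypothesis lf : linear f.

Lemma lin0 : f 0 = 0.
Proof.
by have := lf (-1) 0 0; rewrite scaler0 addr0 scaleN1r addNr.
Qed.

Lemma linD u v : f (u + v) = f u + f v.
Proof. by have := lf 1 u v; rewrite !scale1r. Qed.

Lemma linZ a u : f (a *: u) = a *: f u.
Proof. by have := lf a u 0; rewrite lin0 !addr0. Qed.

Lemma linN u : f (- u) = - f u.
Proof. by rewrite -scaleN1r linZ scaleN1r. Qed.

Lemma linB u v : f (u - v) = f u - f v.
Proof. by rewrite linD linN. Qed.

Lemma linMn u n : f (u *+ n) = f u *+ n.
Proof. by elim: n => [|n IH]; rewrite ?mulr0n ?lin0 // !mulrS linD IH. Qed.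

Lemma linMz u (z : int) : f (u *~ z) = f u *~ z.
Proof. by case: z => n; rewrite ?NegzE ?mulrNz -?pmulrn ?linN linMn. Qed.

Lemma lin_sum I (r : seq I) (P : pred I) (F : I -> U) :
  f (\sum_(i <- r | P i) F i) = \sum_(i <- r | P i) f (F i).
Proof. by elim/big_rec2: _ => [|i y x _ <-]; rewrite ?lin0 ?linD. Qed.

End LinearFun.

(** * Integer matrices of operators preserving the lattice *)

Section Lattice.
Variables (K : fieldType) (hK : [pchar K] =i pred0) (g : lieSuperalg K).
Variables (V : superModule g) (d : nat) (b : d.-tuple V).
Hypothesis b_basis : basis_of fullv b.

Lemma coord_tnth i j : coord b i (tnth b j) = (i == j)%:R.
Proof. by rewrite (tnth_nth 0) coord_free ?(basis_free b_basis) // eq_sym. Qed.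

Lemma coord_sum v : v = \sum_i coord b i v *: tnth b i.
Proof.
rewrite [LHS](coord_basis b_basis (memvf v)).
by apply: eq_bigr => i _; rewrite (tnth_nth 0).
Qed.

(** Lattice vectors have integral coordinates, so the default value of [integer_of] never intervenes
    for them. *)
Lemma lattice_coordE v : lattice b v -> forall i,
  coord b i v = (lattice_coord b v 0 i)%:~R.
Proof.
move=> bv i; rewrite mxE.
suff [z ->] : exists z : int, coord b i v = z%:~R by rewrite integer_ofK.
move: v bv; apply: zspan_ind => [|v w [z ez] [z' ez']|v z].
- by exists 0; rewrite linear0.
- by exists (z + z'); rewrite linearD /= ez ez' rmorphD.
- rewrite /= => /tnthP[j ->]; exists ((i == j)%:R * z).
  by rewrite raddfMz /= coord_tnth rmorphM /= mulrzr rmorph_nat.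
Qed.

Lemma lattice_tnth j : lattice b (tnth b j).
Proof. by apply: zspan_mem; rewrite /= mem_tnth. Qed.

Lemma lattice_coord_sum v : lattice b v -> v = \sum_i tnth b i *~ lattice_coord b v 0 i.
Proof.
move=> bv; rewrite [LHS]coord_sum; apply: eq_bigr => i _.
by rewrite lattice_coordE // -scaler_int.
Qed.

Lemma lattice_coord_inj v w : lattice b v -> lattice b w ->
  lattice_coord b v = lattice_coord b w -> v = w.
Proof.
by move=> bv bw e; rewrite (lattice_coord_sum bv) (lattice_coord_sum bw) e.
Qed.

Lemma lattice_coord_uniq v (c : 'rV_d) : v = \sum_i tnth b i *~ c 0 i ->
  lattice b v /\ lattice_coord b v = c.
Proof.
move=> e; have bv : lattice b v.
  by rewrite e; apply: zspan_sum => i _; apply/zspanMz/lattice_tnth.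
split=> //; apply/rowP => i; apply: (intK_inj hK); rewrite /= -lattice_coordE //.
rewrite e raddf_sum /= (bigD1 i) //= big1 => [|j ji].
  by rewrite addr0 raddfMz /= coord_tnth eqxx.
by rewrite raddfMz /= coord_tnth eq_sym (negPf ji) mul0rz.
Qed.

Lemma lattice_coordD v w : lattice b v -> lattice b w ->
  lattice_coord b (v + w) = lattice_coord b v + lattice_coord b w.
Proof.
move=> bv bw; apply: (proj2 (lattice_coord_uniq _)).
rewrite {1}(lattice_coord_sum bv) {1}(lattice_coord_sum bw) -big_split /=.
by apply: eq_bigr => i _; rewrite [fun_of_matrix (_ + _) 0 i]mxE mulrzDr.
Qed.

Lemma lattice_coordMz v z : lattice b v ->
  lattice_coord b (v *~ z) = z *: lattice_coord b v.
Proof.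
move=> bv; apply: (proj2 (lattice_coord_uniq _)).
rewrite {1}(lattice_coord_sum bv) mulrz_suml.
by apply: eq_bigr => i _; rewrite [fun_of_matrix (_ *: _) 0 i]mxE -mulrzA mulrC.
Qed.

Lemma lattice_coord0 : lattice_coord b 0 = 0.
Proof.
apply: (proj2 (lattice_coord_uniq _)).
by rewrite big1 // => i _; rewrite mxE mulr0z.
Qed.

Lemma lattice_coord_tnth j : lattice_coord b (tnth b j) = delta_mx 0 j.
Proof.
apply: (proj2 (lattice_coord_uniq _)); rewrite (bigD1 j) //= big1 => [|i ij].
  by rewrite mxE !eqxx addr0.
by rewrite mxE (negPf ij) andbF mulr0z.
Qed.

Lemma row_lattice_mx f j : row j (lattice_mx b f) = lattice_coord b (f (tnth b j)).
Proof. by apply/rowP => i; rewrite !mxE. Qed.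

Definition lat_op (f : V -> V) : Prop :=
  linear f /\ forall v, lattice b v -> lattice b (f v).

Lemma lattice_coord_op f v : lat_op f -> lattice b v ->
  lattice_coord b (f v) = lattice_coord b v *m lattice_mx b f.
Proof.
move=> [lf bf] bv; rewrite mulmx_sum_row.
rewrite {1}(lattice_coord_sum bv) (lin_sum lf).
rewrite (eq_bigr (fun i => f (tnth b i) *~ lattice_coord b v 0 i)); last first.
  by move=> i _; rewrite (linMz lf).
suff H (s : seq 'I_d) : lattice b (\sum_(i <- s) f (tnth b i) *~ lattice_coord b v 0 i) /\
    lattice_coord b (\sum_(i <- s) f (tnth b i) *~ lattice_coord b v 0 i) =
    \sum_(i <- s) lattice_coord b v 0 i *: row i (lattice_mx b f) by have [_] := H (index_enum 'I_d).
elim: s => [|i s [IH1 IH2]]; first by rewrite !big_nil lattice_coord0; split=> //; apply: zspan0.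
have bi : lattice b (f (tnth b i) *~ lattice_coord b v 0 i).
  by apply/zspanMz/bf/lattice_tnth.
rewrite !big_cons; split; first exact: zspanD.
by rewrite lattice_coordD // IH2 lattice_coordMz ?row_lattice_mx //; apply/bf/lattice_tnth.
Qed.

Lemma eq_lattice_mx f f' : f =1 f' -> lattice_mx b f = lattice_mx b f'.
Proof. by move=> e; apply/matrixP => i j; rewrite !mxE e. Qed.

Lemma lattice_mx_ext f (M : 'M_d) :
  (forall j, lattice_coord b (f (tnth b j)) = row j M) -> lattice_mx b f = M.
Proof. by move=> e; apply/row_matrixP => j; rewrite row_lattice_mx. Qed.

Lemma lat_op_comp f f' : lat_op f -> lat_op f' -> lat_op (f' \o f).
Proof.
move=> [lf bf] [lf' bf']; split=> [a u v|v bv] /=; last exact/bf'/bf.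
by rewrite lf lf'.
Qed.

(** With row vectors, the operator applied first stands on the left. *)
Lemma lattice_mx_comp f f' : lat_op f -> lat_op f' ->
  lattice_mx b (f' \o f) = lattice_mx b f *m lattice_mx b f'.
Proof.
move=> of_ of'; apply: lattice_mx_ext => j /=.
rewrite lattice_coord_op //; last exact/of_.2/lattice_tnth.
by rewrite -row_lattice_mx row_mul.
Qed.

Lemma lat_opD f f' : lat_op f -> lat_op f' -> lat_op (fun v => f v + f' v).
Proof.
move=> [lf bf] [lf' bf']; split=> [a u v|v bv] /=; last exact/zspanD/bf'/bv/bf.
by rewrite lf lf' scalerDr addrACA.
Qed.

Lemma lattice_mxD f f' : lat_op f -> lat_op f' ->
  lattice_mx b (fun v => f v + f' v) = lattice_mx b f + lattice_mx b f'.
Proof.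
move=> of_ of'; apply: lattice_mx_ext => j.
rewrite linearD /= !row_lattice_mx lattice_coordD //; first exact/of_.2/lattice_tnth.
exact/of'.2/lattice_tnth.
Qed.

Lemma lat_opMz f z : lat_op f -> lat_op (fun v => f v *~ z).
Proof.
move=> [lf bf]; split=> [a u v|v bv] /=; last exact/zspanMz/bf.
by rewrite lf mulrzDl scalerMzr.
Qed.

Lemma lattice_mxMz f z : lat_op f ->
  lattice_mx b (fun v => f v *~ z) = z *: lattice_mx b f.
Proof.
move=> of_; apply: lattice_mx_ext => j.
rewrite linearZ /= row_lattice_mx lattice_coordMz //.
exact/of_.2/lattice_tnth.
Qed.

Lemma lat_op_id : lat_op id.
Proof. by split=> [a u v|v]. Qed.

Lemma lattice_mx_id : lattice_mx b id = 1%:M.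
Proof. by apply: lattice_mx_ext => j; rewrite lattice_coord_tnth row1. Qed.

Lemma lat_op0 : lat_op (fun=> 0).
Proof. by split=> [a u v|v _]; rewrite ?scaler0 ?addr0 //; apply: zspan0. Qed.

Lemma lattice_mx0 : lattice_mx b (fun=> 0) = 0.
Proof. by apply: lattice_mx_ext => j; rewrite lattice_coord0 linear0. Qed.

Lemma lat_op_sum I (r : seq I) (F : I -> V -> V) :
  (forall i, lat_op (F i)) -> lat_op (fun v => \sum_(i <- r) F i v).
Proof.
move=> oF; elim: r => [|i r IH].
  by have [l0 b0] := lat_op0; split=> [a u v|v bv]; rewrite !big_nil; [apply: l0|apply: b0 bv].
have [l0 b0] := lat_opD (oF i) IH.
by split=> [a u v|v bv]; rewrite !big_cons; [apply: l0|apply: b0 bv].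
Qed.

Lemma lattice_mx_sum I (r : seq I) (F : I -> V -> V) : (forall i, lat_op (F i)) ->
  lattice_mx b (fun v => \sum_(i <- r) F i v) = \sum_(i <- r) lattice_mx b (F i).
Proof.
move=> oF; elim: r => [|i r IH].
  by rewrite big_nil -lattice_mx0; apply: eq_lattice_mx => v; rewrite big_nil.
rewrite big_cons -IH -lattice_mxD //; last exact: lat_op_sum.
by apply: eq_lattice_mx => v; rewrite big_cons.
Qed.

End Lattice.

Section BaseChange.
Variables (A : pzRingType).
Notation bc := (basechange_mx A).

Lemma basechangeM m n p (M : 'M_(m, n)) (N : 'M_(n, p)) : bc (M *m N) = bc M *m bc N.
Proof.
apply/matrixP => i j; rewrite !mxE rmorph_sum; apply: eq_bigr => l _.
by rewrite !mxE rmorphM.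
Qed.

Lemma basechangeD m n (M N : 'M_(m, n)) : bc (M + N) = bc M + bc N.
Proof. by apply/matrixP => i j; rewrite !mxE rmorphD. Qed.

Lemma basechangeZ m n z (M : 'M_(m, n)) : bc (z *: M) = z%:~R *: bc M.
Proof. by apply/matrixP => i j; rewrite !mxE rmorphM. Qed.

Lemma basechange0 m n : bc (0 : 'M_(m, n)) = 0.
Proof. by apply/matrixP => i j; rewrite !mxE. Qed.

Lemma basechange1 n : bc (1%:M : 'M_n) = 1%:M.
Proof. by apply/matrixP => i j; rewrite !mxE; case: (i == j). Qed.

Lemma basechange_sum m n I (r : seq I) (F : I -> 'M_(m, n)) :
  bc (\sum_(i <- r) F i) = \sum_(i <- r) bc (F i).
Proof. by elim/big_rec2: _ => [|i x y _ <-]; rewrite ?basechange0 ?basechangeD. Qed.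

Lemma intr_comm (z : int) (a : A) : z%:~R * a = a * z%:~R.
Proof. by rewrite mulrzl mulrzr. Qed.

Lemma basechange_scale m n p (M : 'M_(m, n)) (a : A) (N : 'M_(n, p)) :
  bc M *m (a *: N) = a *: (bc M *m N).
Proof.
apply/matrixP => i j; rewrite !mxE mulr_sumr; apply: eq_bigr => l _.
by rewrite !mxE mulrA intr_comm mulrA.
Qed.

Lemma scale_basechangeM m n p a a' (M : 'M_(m, n)) (N : 'M_(n, p)) :
  (a *: bc M) *m (a' *: bc N) = (a * a') *: bc (M *m N).
Proof.
by rewrite -scalemxAl basechange_scale scalerA basechangeM.
Qed.

End BaseChange.

(** * Eigenvalues and nilpotency *)

Section Eigenvalues.
Variables (K : closedFieldType) (hK : [pchar K] =i pred0) (V : vectType K).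
Variables (d : nat) (b : d.-tuple V).
Hypothesis b_basis : basis_of fullv b.

Lemma eigen_roots (f : V -> V) : linear f -> exists2 rs : seq K, (size rs <= d)%N &
  forall a v, v != 0 -> f v = a *: v -> a \in rs.
Proof.
move=> lf; pose M : 'M[K]_d := \matrix_(j, i) coord b i (f (tnth b j)).
pose c v : 'rV[K]_d := \row_i coord b i v.
have csum v : v = \sum_i c v 0 i *: tnth b i.
  rewrite [LHS](coord_basis b_basis (memvf v)).
  by apply: eq_bigr => i _; rewrite mxE (tnth_nth 0).
have cM v : c (f v) = c v *m M.
  apply/rowP => i; rewrite !mxE {1}(csum v) (lin_sum lf) linear_sum /=.
  by apply: eq_bigr => j _; rewrite (linZ lf) linearZ /= !mxE.
have [rs ers] := closed_field_poly_normal (char_poly M).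
have mon : char_poly M \is monic := char_poly_monic M.
rewrite (monicP mon) scale1r in ers.
exists rs => [|a v v0 e].
  by have := size_char_poly M; rewrite ers size_prod_XsubC => -[->].
rewrite -root_prod_XsubC -ers -eigenvalue_root_char; apply/eigenvalueP.
exists (c v).
  by rewrite -cM e; apply/rowP => i; rewrite !mxE linearZ.
apply: contra v0 => /eqP c0; rewrite (csum v) c0 big1 // => i _.
by rewrite mxE scale0r.
Qed.

(** Otherwise v, e v, ..., e^d v would be eigenvectors of [f] for the eigenvalues c + j a, which in
    characteristic 0 are [d.+1] distinct numbers, more than the characteristic polynomial can
    have. *)
Lemma nilpotent_shift (f e : V -> V) (a c : K) v : linear f -> linear e -> a != 0 ->
  (forall w, f (e w) = e (f w) + a *: e w) -> f v = c *: v -> iter d e v = 0.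
Proof.
move=> lf le a0 fe fv; apply/eqP; apply: contraT => nz.
have [rs srs rsE] := eigen_roots lf.
have ev j : f (iter j e v) = (c + a *+ j) *: iter j e v.
  elim: j => [|j IH]; first by rewrite mulr0n addr0.
  by rewrite iterS fe IH (linZ le) -scalerDl mulrSr addrA.
have nzj j : (j <= d)%N -> iter j e v != 0.
  move=> jd; apply: contra nz => /eqP z.
  rewrite -(subnK jd) iterD z; apply/eqP.
  by elim: (d - j)%N => //= n ->; exact: lin0.
have := @uniq_leq_size _ [seq c + a *+ j | j <- iota 0 d.+1] rs.
rewrite size_map size_iota => H.
have : (d.+1 <= size rs)%N.
  apply: H.
    rewrite map_inj_uniq ?iota_uniq // => i j /addrI eij.
    have : (Posz i - Posz j)%:~R == 0 :> K.
      have /eqP : a * (Posz i - Posz j)%:~R = 0.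
        by rewrite rmorphB /= mulrBr -!pmulrn !mulr_natr eij subrr.
      by rewrite mulf_eq0 (negPf a0).
    by rewrite intK_eq0 // subr_eq0 => /eqP[].
  move=> x /mapP[j]; rewrite mem_iota /= => jd ->.
  by apply: rsE (ev j); apply: nzj; rewrite -ltnS.
by move/leq_trans/(_ srs); rewrite ltnn.
Qed.

End Eigenvalues.

(** * Integral projectors on the weight spaces *)

Section Weights.
Variables (K : closedFieldType) (hK : [pchar K] =i pred0) (g : lieSuperalg K).
Variables (h : {vspace g}) (V : superModule g) (l : nat) (H : l.-tuple g).
Variables (d : nat) (b : d.-tuple V).
Hypotheses (H_basis : basis_of h H) (V_rat : rational h V H).
Hypotheses (b_basis : basis_of fullv b).
Hypothesis bin_stable : forall v, lattice b v ->
  forall i n, lattice b (binomial_power (act V (tnth H i)) n v).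

Notation hdual := 'Hom(subvs_of h, K^o).
Implicit Types (mu nu : hdual) (v w : V).

Lemma tnth_h i : tnth H i \in h.
Proof. by have /andP[/eqP <- _] := H_basis; apply/memv_span/mem_tnth. Qed.

Lemma pairingD mu x y : x \in h -> y \in h -> pairing mu (x + y) = pairing mu x + pairing mu y.
Proof. by move=> xh yh; rewrite /pairing linearD /= linearD. Qed.

Lemma pairingZ mu a x : pairing mu (a *: x) = a * pairing mu x.
Proof. by rewrite /pairing linearZ /= linearZ. Qed.

Lemma pairing_eq mu nu :
  (forall i, pairing mu (tnth H i) = pairing nu (tnth H i)) -> mu = nu.
Proof.
move=> e; apply/lfunP => u.
have uh : vsval u \in <<H>>%VS.
  by have /andP[/eqP -> _] := H_basis; apply: subvsP.
have -> : u = vsproj h (vsval u) by rewrite vsvalK.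
rewrite (coord_span uh) !linear_sum; apply: eq_bigr => i _.
by rewrite !linearZ /=; congr (_ * _); have := e i; rewrite /pairing (tnth_nth 0).
Qed.

Definition is_weight mu := exists2 v : V, v != 0 & weight_vector mu v.

Lemma weight_ext (f f' : V -> V) : linear f -> linear f' ->
  (forall mu v, weight_vector mu v -> f v = f' v) -> f =1 f'.
Proof.
move=> lf lf' e v; have [s [sw ->]] := V_rat.1 v.
rewrite (lin_sum lf) (lin_sum lf') big_seq [RHS]big_seq.
by apply: eq_bigr => w /sw[mu]; apply: e.
Qed.

Lemma weight_int mu i : is_weight mu -> exists z : int, pairing mu (tnth H i) = z%:~R.
Proof. by move=> [v v0 mv]; exact: V_rat.2 v0 mv i. Qed.

(** Functions of the weight realized by operators that preserve the lattice. They are closed under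
    sums, products and integer multiples and contain the binomials in the values at [H_i]; the
    projectors are built inside this ring. *)
Definition diag_op (phi : hdual -> K) := exists2 f : V -> V, lat_op b f &
  forall mu v, weight_vector mu v -> f v = phi mu *: v.

Lemma diag_ext phi psi : (forall mu, is_weight mu -> phi mu = psi mu) ->
  diag_op phi -> diag_op psi.
Proof.
move=> e [f fo fE]; exists f => // mu v mv; rewrite (fE mu) //.
have [->|v0] := eqVneq v 0; first by rewrite !scaler0.
by rewrite e //; exists v.
Qed.

Lemma diag1 : diag_op (fun=> 1).
Proof. by exists id; [apply: lat_op_id|move=> mu v _; rewrite scale1r]. Qed.

Lemma diagD phi psi : diag_op phi -> diag_op psi -> diag_op (fun mu => phi mu + psi mu).
Proof.
move=> [f fo fE] [f' fo' fE']; exists (fun v => f v + f' v); first exact: lat_opD.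
by move=> mu v mv; rewrite scalerDl (fE mu) ?(fE' mu).
Qed.

Lemma diagMz phi z : diag_op phi -> diag_op (fun mu => phi mu *~ z).
Proof.
move=> [f fo fE]; exists (fun v => f v *~ z); first exact: lat_opMz.
by move=> mu v mv; rewrite (fE mu) // -scalerMzl.
Qed.

Lemma diagM phi psi : diag_op phi -> diag_op psi -> diag_op (fun mu => phi mu * psi mu).
Proof.
move=> [f fo fE] [f' fo' fE']; exists (f \o f'); first exact: lat_op_comp.
move=> mu v mv; rewrite /= (fE' mu) // (linZ fo.1) (fE mu) // scalerA.
by rewrite mulrC.
Qed.

Lemma diag_prod I (r : seq I) (F : I -> hdual -> K) :
  (forall i, diag_op (F i)) -> diag_op (fun mu => \prod_(i <- r) F i mu).
Proof.
move=> dF; elim: r => [|i r IH].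
  by apply: diag_ext diag1 => mu _; rewrite big_nil.
by apply: diag_ext (diagM (dF i) IH) => mu _; rewrite big_cons.
Qed.

Definition binK (x : K) n : K := (\prod_(m < n) (x - m%:R)) / n`!%:R.

Lemma binK0 x : binK x 0 = 1.
Proof. by rewrite /binK big_ord0 fact0 divr1. Qed.

Lemma binKS x n : binK (x + 1) n.+1 = binK x n.+1 + binK x n.
Proof.
rewrite /binK big_ord_recl /= subr0.
have -> : \prod_(i < n) (x + 1 - (bump 0 i)%:R) = \prod_(i < n) (x - i%:R).
  apply: eq_bigr => i _; rewrite /bump leq0n add1n mulrS opprD addrA.
  by rewrite addrK.
rewrite big_ord_recr /= factS natrM.
have n0 : n.+1%:R != 0 :> K by rewrite natK_eq0.
have F0 := factK_neq0 hK n.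
rewrite -natr1 in n0 *.
by field; rewrite F0 n0.
Qed.

Lemma binK_nat a n : binK a%:R n = 'C(a, n)%:R.
Proof.
elim: n a => [|n IH] a; first by rewrite binK0 bin0.
elim: a => [|a IHa]; last by rewrite -natr1 binKS IHa IH binS natrD.
by rewrite /binK big_ord_recl subrr mul0r mul0r.
Qed.

Lemma binKN x n : binK (- x) n = (-1) ^+ n * binK (x + n%:R - 1) n.
Proof.
rewrite /binK mulrA; congr (_ / _).
rewrite [in RHS](reindex_inj rev_ord_inj) /=.
rewrite (eq_bigr (fun i : 'I_n => (-1) * (x + i%:R))) => [|i _]; last by ring.
rewrite big_split prodr_const card_ord; congr (_ * _).
apply: eq_bigr => i _; rewrite natrB // -natr1; ring.
Qed.

Definition intweight mu := forall i, exists z : int, pairing mu (tnth H i) = z%:~R.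

Lemma falling_weight i n mu v : weight_vector mu v ->
  falling_power (act V (tnth H i)) n v =
  (\prod_(m < n) (pairing mu (tnth H i) - m%:R)) *: v.
Proof.
move=> mv; elim: n => [|n IH] /=; first by rewrite big_ord0 scale1r.
rewrite IH (linZ (act_linr (tnth H i))) (mv _ (tnth_h i)) !scalerA -scalerBl big_ord_recr /=.
by congr (_ *: _); ring.
Qed.

Lemma falling_linear i n : linear (falling_power (act V (tnth H i)) n).
Proof.
elim: n => [|n IH] a u v //=.
rewrite IH act_linr scalerDr !scalerA opprD -!addrA; rewrite scalerBr scalerA [_ * a]mulrC.
by rewrite -!addrA; congr (_ + _); rewrite addrCA.
Qed.

Lemma diag_bin i n : diag_op (fun mu => binK (pairing mu (tnth H i)) n).
Proof.
exists (binomial_power (act V (tnth H i)) n).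
  split=> [a u v|v bv]; last exact: bin_stable.
  by rewrite /binomial_power falling_linear scalerDr !scalerA mulrC.
move=> mu v mv; rewrite /binomial_power (falling_weight _ _ mv) scalerA.
by rewrite mulrC.
Qed.

(** Pascal's rule raises the shift by one; solved for its other term, and with an inner induction on
    [n], it lowers the shift. *)
Lemma diag_bin_shift i n (c : int) : diag_op (fun mu => binK (pairing mu (tnth H i) + c%:~R) n).
Proof.
elim: c n => [|c IH|c IH] n.
- by apply: diag_ext (diag_bin i n) => mu _; rewrite addr0.
- case: n => [|n].
    by apply: diag_ext diag1 => mu _; rewrite binK0.
  apply: diag_ext (diagD (IH n.+1) (IH n)) => mu _.
  have -> : (Posz c.+1)%:~R = c%:~R + 1 :> K by rewrite intS rmorphD addrC.
  by rewrite addrA binKS.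
- elim: n => [|n IHn].
    by apply: diag_ext diag1 => mu _; rewrite binK0.
  apply: diag_ext (diagD (IH n.+1) (diagMz (-1) IHn)) => mu _.
  have -> : (- Posz c)%:~R = (- Posz c.+1)%:~R + 1 :> K.
    by rewrite intS opprD rmorphD /= addrAC rmorphN1 addNr add0r.
  by rewrite addrA binKS mulrN1z addrK.
Qed.

(** [tnth H i] has finitely many eigenvalues, and the sum of their absolute values is a crude common
    bound. *)
Lemma weight_bound i : exists B : nat, forall mu (z : int), is_weight mu ->
  pairing mu (tnth H i) = z%:~R -> (`|z| <= B)%N.
Proof.
have [rs _ rsE] := eigen_roots b_basis (act_linr (s := V) (tnth H i)).
exists (\sum_(r <- rs) `|integer_of r|)%N => mu z [v v0 mv] ez.
have zr : (z%:~R : K) \in rs by apply: (rsE _ v) => //; rewrite -ez; apply/mv/tnth_h.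
by rewrite (big_rem _ zr) /= integer_ofK // leq_addr.
Qed.

Lemma diag_indicator i (z : int) :
  diag_op (fun mu => (pairing mu (tnth H i) == z%:~R)%:R).
Proof.
have [B BP] := weight_bound i.
have [zB|zB] := leqP `|z| B; last first.
  apply: diag_ext (diagMz 0 diag1) => mu muw; rewrite mulr0z.
  by case: eqP => // /(BP _ _ muw); rewrite leqNgt zB.
(* on [0, 2B] the function a |-> C(a, j) C(2B - a, 2B - j) is the indicator of j *)
have [j ej] : exists j : nat, z = Posz j - Posz B by exists (absz (z + Posz B)); lia.
have jB : (j <= 2 * B)%N by lia.
pose m := (2 * B - j)%N.
(* The factor C(2B - a, m) has its argument decreasing in [a]; upper negation writes it as (-1)^m
   C(m - 1 - (2B - a), m), whose argument is a shift of the weight value. *)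
apply: diag_ext (diagM (diag_bin_shift i j B)
  (diagMz ((-1) ^+ m) (diag_bin_shift i m (Posz m - 1 - Posz B)))) => mu muw.
have [y ey] := weight_int i muw; have yB := BP _ _ muw ey.
have [a ea] : exists a : nat, y = Posz a - Posz B by exists (absz (y + Posz B)); lia.
have aB : (a <= 2 * B)%N by lia.
rewrite ey (inj_eq (intK_inj hK)) -!rmorphD /=.
have -> : y + Posz B = a by lia.
have -> : y + (Posz m - 1 - Posz B) = Posz m - 1 - Posz (2 * B - a)%N by lia.
rewrite -[(Posz a)%:~R]/(a%:R) binK_nat.
have -> : (Posz m - 1 - Posz (2 * B - a))%:~R = - ((2 * B - a)%:R - m%:R + 1) :> K.
  by rewrite !rmorphB /= rmorph1 -!pmulrn; ring.
rewrite binKN -mulrzr.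
have -> : (2 * B - a)%:R - m%:R + 1 + m%:R - 1 = (2 * B - a)%:R :> K by ring.
rewrite binK_nat rmorphXn /= rmorphN1 [(-1) ^+ m * _ * _]mulrAC -exprMn mulrNN mulr1 expr1n mul1r.
have -> : (y == z) = (a == j) by lia.
rewrite -natrM; congr (_%:R); have [->|aj] := eqVneq a j; first by rewrite !binn.
have [lt|gt|/eqP] := ltngtP a j; last by rewrite (negPf aj).
  by rewrite bin_small.
by rewrite mulnC bin_small // /m; lia.
Qed.

Lemma weight_projection mu : intweight mu -> exists2 f : V -> V, lat_op b f &
  forall nu v, weight_vector nu v -> f v = (nu == mu)%:R *: v.
Proof.
move=> mui; pose z i := sval (cid (mui i)).
have zE i : pairing mu (tnth H i) = (z i)%:~R := svalP (cid (mui i)).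
have [f fo fE] := diag_prod (index_enum 'I_l) (fun i => diag_indicator i (z i)).
exists f => // nu v nv; rewrite (fE _ _ nv); congr (_ *: _).
have [->|ne] := eqVneq nu mu.
  by rewrite big1 // => i _; rewrite zE eqxx.
have [i ni] : exists i, pairing nu (tnth H i) != pairing mu (tnth H i).
  apply: contrapT => /forallNP e; move/eqP: ne; apply; apply: pairing_eq => i.
  by apply/eqP; have /negP := e i; rewrite negbK.
by rewrite (bigD1 i) //= -zE (negPf ni) mul0r.
Qed.

(** The zero map on nonintegral [mu] makes this preserve the lattice for every [mu], without a side
    condition. *)
Definition wproj mu : V -> V :=
  if pselect (intweight mu) is left mui then
    s2val (cid2 (weight_projection mui)) else fun=> 0.

Lemma wproj_op mu : lat_op b (wproj mu).
Proof.
rewrite /wproj; case: pselect => [mui|_]; last exact: lat_op0.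
exact: (s2valP (cid2 (weight_projection mui))).
Qed.

Lemma wprojE mu nu v : intweight mu -> weight_vector nu v ->
  wproj mu v = (nu == mu)%:R *: v.
Proof.
rewrite /wproj; case: pselect => // mui _ nv.
exact: (s2valP' (cid2 (weight_projection mui))).
Qed.

Lemma weight_intweight mu : is_weight mu -> intweight mu.
Proof. by move=> muw i; apply: weight_int. Qed.

(** Each of the [d] basis vectors is a finite sum of weight vectors; the weights that occur are
    collected, and their projectors resolve the identity. *)
Lemma weight_list : exists ws : seq hdual, [/\ uniq ws,
  forall mu, mu \in ws -> is_weight mu &
  forall v, v = \sum_(mu <- ws) wproj mu v].
Proof.
have spanned j : exists s : seq (hdual * V),
    (forall p, p \in s -> weight_vector p.1 p.2 /\ p.2 != 0) /\
    tnth b j = \sum_(p <- s) p.2.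
  have [s [sw ->]] := V_rat.1 (tnth b j).
  elim: s sw => [|w s IH] sw; first by exists [::]; split=> //; rewrite !big_nil.
  have [|t [tP e]] := IH; first by move=> x xs; apply: sw; rewrite in_cons xs orbT.
  have [->|w0] := eqVneq w 0; first by exists t; rewrite big_cons add0r.
  have [mu mw] := sw w (mem_head _ _).
  exists ((mu, w) :: t); split; last by rewrite !big_cons e.
  by move=> p; rewrite in_cons => /orP[/eqP ->|/tP].
pose s j := sval (cid (spanned j)).
have sP j := svalP (cid (spanned j)).
pose ws := undup (flatten [seq [seq p.1 | p <- s j] | j <- enum 'I_d]).
have wsw mu : mu \in ws -> is_weight mu.
  rewrite mem_undup => /flattenP[r /mapP[j _ ->] /mapP[p ps ->]].
  by have [pw p0] := (sP j).1 p ps; exists p.2.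
exists ws; split=> //; first exact: undup_uniq.
have lin_pi : linear (fun v => \sum_(mu <- ws) wproj mu v).
  by case: (lat_op_sum ws wproj_op).
move=> v; rewrite [LHS](coord_sum b_basis v) [in RHS](coord_sum b_basis v).
rewrite (lin_sum lin_pi); apply: eq_bigr => j _; rewrite (linZ lin_pi); congr (_ *: _).
rewrite (sP j).2 (lin_sum lin_pi) big_seq [RHS]big_seq; apply: eq_bigr => p ps.
have [pw p0] := (sP j).1 p ps.
have pws : p.1 \in ws.
  rewrite mem_undup; apply/flattenP; exists [seq q.1 | q <- s j].
    by apply/mapP; exists j; rewrite ?mem_enum.
  exact: map_f.
rewrite (bigD1_seq _ pws (undup_uniq _)) /= (wprojE (weight_intweight (wsw _ pws)) pw) eqxx scale1r.
rewrite big_seq_cond big1 ?addr0 // => mu /andP[muws ne].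
by rewrite (wprojE (weight_intweight (wsw _ muws)) pw) eq_sym (negPf ne) scale0r.
Qed.

End Weights.

(** * Chevalley bases and root data *)

Section Chevalley.
Variables (K : closedFieldType) (hK : [pchar K] =i pred0) (g : lieSuperalg K).
Variables (h : {vspace g}) (h_even : (h <= lie_part g false)%VS).
Variables (R : rootDatum h) (R_dist : distinguished R).
Variables (l : nat) (H : l.-tuple g) (X : rd_lat R -> g).
Hypothesis hX : chevalley_basis H X.
Implicit Types (a c : rd_lat R).

Lemma brD (x y z : g) : br x (y + z) = br x y + br x z.
Proof. exact: linD (br_linr x) y z. Qed.
Lemma brZ (t : K) (x y : g) : br x (t *: y) = t *: br x y.
Proof. exact: linZ (br_linr x) t y. Qed.
Lemma brDl (x y z : g) : br (x + y) z = br x z + br y z.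
Proof. exact: linD (br_linl z) x y. Qed.
Lemma brZl (t : K) (x y : g) : br (t *: x) y = t *: br x y.
Proof. exact: linZ (br_linl y) t x. Qed.
Lemma br0 (x : g) : br x 0 = 0. Proof. exact: lin0 (br_linr x). Qed.
Lemma br0l (x : g) : br 0 x = 0. Proof. exact: lin0 (br_linl x). Qed.

Lemma part_direct (x : g) : x \in lie_part g false -> x \in lie_part g true -> x = 0.
Proof.
move=> x0 x1; apply/eqP; rewrite -memv0 -(lie_direct g).
by rewrite memv_cap x0.
Qed.

Lemma root_vector_part p c : rd_part R p c -> X c \in lie_part g p.
Proof. by case: hX => -[s [_ _ XP]] _ _ _ _; apply: XP. Qed.

Lemma cartan_basis : basis_of h H.
Proof. by case: hX => _ [? _]. Qed.

Lemma H_even i : tnth H i \in lie_part g false.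
Proof. exact/(subvP h_even)/(tnth_h cartan_basis). Qed.

Lemma root_vector_neq0 c : Delta R c -> X c != 0.
Proof.
case: hX => -[s [[us sE] /basis_free f _]] _ _ _ _ /sE cs.
by apply: free_not0 f _; rewrite mem_cat map_f ?orbT.
Qed.

Lemma chevalley_ind (P : g -> Prop) : P 0 -> (forall x y, P x -> P y -> P (x + y)) ->
  (forall t x, P x -> P (t *: x)) -> (forall i, P (tnth H i)) ->
  (forall c, Delta R c -> P (X c)) -> forall x, P x.
Proof.
move=> P0 PD PZ PH PX x; case: hX => -[s [[us sE] sb _]] _ _ _ _.
have xs : x \in <<in_tuple (H ++ map X s)>>%VS.
  by have /andP[/eqP -> _] := sb; apply: memvf.
rewrite (coord_span xs); apply: big_ind => // i _; apply: PZ.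
have : (in_tuple (H ++ map X s))`_i \in H ++ map X s by apply: mem_nth.
rewrite mem_cat => /orP[/tnthP[j ->]|/mapP[c /sE cD ->]]; [exact: PH|exact: PX].
Qed.

Lemma root_part_uniq p q c : rd_part R p c -> rd_part R q c -> p = q.
Proof.
have H0 : rd_part R false c -> rd_part R true c -> False.
  move=> c0 c1; have /negP := root_vector_neq0 (or_introl c0); apply.
  by apply/eqP/part_direct; apply: root_vector_part.
by case: p q => -[] // c0 c1; case: H0.
Qed.

Lemma Delta_part c : Delta R c -> exists p, rd_part R p c.
Proof. by case=> ?; [exists false|exists true]. Qed.

Lemma part_Delta p c : rd_part R p c -> Delta R c.
Proof. by case: p => ?; [right|left]. Qed.

Lemma root_part_vector p c : Delta R c -> X c \in lie_part g p -> rd_part R p c.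
Proof.
move=> cD Xp; have [q cq] := Delta_part cD; have Xq := root_vector_part cq.
have /eqP X0 := root_vector_neq0 cD.
by case: p q Xp Xq cq => -[] //= Xp Xq _; case: X0; apply: part_direct.
Qed.

(** Being its own opposite, 0 would be positive and negative at the same time. *)
Lemma root_neq0 c : Delta R c -> c <> 0.
Proof.
move=> cD c0; have [_ pn excl _ _] := R_dist; apply: (excl c).
by have := pn c cD; rewrite /negative c0 oppr0 => -[] h0; split.
Qed.

Lemma cartan_ind (P : g -> Prop) : P 0 -> (forall x y, x \in h -> y \in h -> P x -> P y -> P (x + y)) ->
  (forall t x, x \in h -> P x -> P (t *: x)) -> (forall i, P (tnth H i)) ->
  forall x, x \in h -> P x.
Proof.
move=> P0 PD PZ PH x xh; have /andP[/eqP e _] := cartan_basis.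
have xs : x \in <<H>>%VS by rewrite e.
rewrite (coord_span xs).
have mH (i : 'I_l) : H`_i \in h /\ P H`_i.
  rewrite -tnth_nth; split; [exact: tnth_h cartan_basis i|exact: PH].
suff Hs : forall s : seq 'I_l, (\sum_(i <- s) coord H i x *: H`_i \in h) /\
    P (\sum_(i <- s) coord H i x *: H`_i) by have [] := Hs (index_enum 'I_l).
elim=> [|i s [IH1 IH2]]; first by rewrite !big_nil mem0v.
have [hi Pi] := mH i.
by rewrite !big_cons; split; [apply: memvD => //; apply: memvZ|apply: PD => //;
  [apply: memvZ|apply: PZ]].
Qed.

Lemma rpairD c x y : x \in h -> y \in h -> rpair c (x + y) = rpair c x + rpair c y.
Proof. exact: pairingD. Qed.

Lemma rpairZ c t x : rpair c (t *: x) = t * rpair c x.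
Proof. exact: pairingZ. Qed.

Lemma rpair_opp c x : rpair c (- x) = - rpair c x.
Proof. by rewrite -scaleN1r rpairZ mulN1r. Qed.

Lemma rpair0 c : rpair c 0 = 0.
Proof. by rewrite -(scale0r 0) rpairZ mul0r. Qed.

Lemma cartan_root_vector c y : Delta R c -> y \in h -> br y (X c) = rpair c y *: X c.
Proof.
move=> cD; move: y; apply: (@cartan_ind (fun y => br y (X c) = rpair c y *: X c)).
- by rewrite br0l rpair0 scale0r.
- by move=> x y xh yh ex ey; rewrite brDl rpairD // ex ey scalerDl.
- by move=> t x _ e; rewrite brZl rpairZ e scalerA.
- by case: hX => _ _ [_ e] _ _ i; apply: e.
Qed.

Lemma coroot_zspan c : Delta R c -> Delta R (- c) -> zspan [set` H]%classic (rd_coroot c).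
Proof.
move=> cD ncD; case: hX => _ [_ ->] _ _ _.
by apply: zspan_mem; exists c.
Qed.

Lemma zspan_h x : zspan [set` H]%classic x -> x \in h.
Proof.
move: x; apply: zspan_ind; first exact: mem0v.
- by move=> x y; apply: memvD.
- move=> x z /= /tnthP[i ->]; rewrite -scaler_int memvZ //.
  exact: tnth_h cartan_basis i.
Qed.

Lemma coroot_h c : Delta R c -> Delta R (- c) -> rd_coroot c \in h.
Proof. by move=> cD ncD; apply/zspan_h/coroot_zspan. Qed.

Lemma chevalley_opp c : Delta R c -> Delta R (- c) ->
  br (X c) (X (- c)) = chevalley_sign c *: rd_coroot c.
Proof. by case: hX => _ _ _ + _; apply. Qed.

Lemma chevalley_sign_sqr c : chevalley_sign c * chevalley_sign c = 1 :> K.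
Proof. by rewrite /chevalley_sign; case: asboolP => _; rewrite ?mulrNN mulr1. Qed.

Lemma chevalley_add a c : Delta R a -> Delta R c -> a <> - c ->
  (~ Delta R (a + c) -> br (X a) (X c) = 0) /\
  (Delta R (a + c) -> exists2 t : K, br (X a) (X c) = t *: X (a + c) &
          (rnorm a != 0 \/ rnorm c != 0 ->
             exists2 r, string_depth a c r &
               (~ rd_exc a c -> pm r.+1%:R t) /\
               (rd_exc a c -> pm r.+2%:R t)) /\
          (rnorm a = 0 -> rnorm c = 0 -> pm (rpair c (rd_coroot a)) t)).
Proof. by case: hX => _ _ _ _; apply. Qed.

Section Module.
Variable V : superModule g.

Lemma act_evenl x y (v : V) : x \in lie_part g false ->
  act V x (act V y v) = act V (br x y) v + act V y (act V x v).
Proof.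
move=> x0; have [y0 y0P [y1 y1P ->]] : exists2 y0, y0 \in lie_part g false &
    exists2 y1, y1 \in lie_part g true & y = y0 + y1.
  have : y \in (lie_part g false + lie_part g true)%VS by rewrite lie_sum memvf.
  by case/memv_addP => y0 y0P [y1 y1P ->]; exists y0 => //; exists y1.
have aD (u w : g) v' : act V (u + w) v' = act V u v' + act V w v'.
  exact: linD (act_linl (s := V) v') u w.
rewrite brD !aD (act_br _ x0 y0P) (act_br _ x0 y1P) /psign /= expr0 !scale1r.
by rewrite (linD (act_linr x)) addrACA !subrK.
Qed.

Hypotheses (V_faithful : faithful V) (V_rat : rational h V H).

Lemma root_shift c mu (v : V) : Delta R c -> weight_vector (h := h) mu v ->
  weight_vector (mu + rd_ev c) (act V (X c) v).
Proof.
move=> cD mv y yh; rewrite act_evenl; last exact: (subvP h_even).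
rewrite cartan_root_vector // (linZ (act_linl v)) (mv y yh) (linZ (act_linr (X c))).
by rewrite -scalerDl addrC /pairing lfunE.
Qed.

Lemma root_act_neq0 c : Delta R c -> exists mu (v : V),
  [/\ v != 0, weight_vector (h := h) mu v & act V (X c) v != 0].
Proof.
move=> cD; apply: contrapT => nex; have /negP := root_vector_neq0 cD; apply.
apply/eqP/V_faithful; apply: (weight_ext V_rat (act_linr (X c)) (f' := fun=> 0)).
  by move=> a u v; rewrite scaler0 addr0.
move=> mu v mv; apply/eqP; apply: contrapT => /negP nz; apply: nex.
exists mu, v; split=> //; apply: contra nz => /eqP ->.
by rewrite (lin0 (act_linr (X c))).
Qed.

(** By faithfulness X_c carries some weight vector to a nonzero one, so the value of [c] is the
    difference of two weight values, both integral by rationality. *)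
Lemma root_int c i : Delta R c -> exists z : int, rpair c (tnth H i) = z%:~R.
Proof.
move=> cD; have [mu [v [v0 mv nz]]] := root_act_neq0 cD.
have [z ez] := V_rat.2 _ _ v0 mv i.
have [z' ez'] := V_rat.2 _ _ nz (root_shift cD mv) i.
exists (z' - z); rewrite rmorphB /= -ez -ez' /pairing lfunE /=.
by rewrite addrC addKr.
Qed.

Lemma pairing_zspan_int (mu : 'Hom(subvs_of h, K^o)) x :
  (forall i, exists z : int, pairing mu (tnth H i) = z%:~R) ->
  zspan [set` H]%classic x -> exists z : int, pairing mu x = z%:~R.
Proof.
move=> mui hx; suff [_ //] : x \in h /\ exists z : int, pairing mu x = z%:~R.
move: x hx; apply: zspan_ind.
- split; [exact: mem0v|exists 0].
  by rewrite -(scale0r (0 : g)) pairingZ mul0r.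
- move=> x y [xh [z ez]] [yh [z' ez']]; split; first exact: memvD.
  by exists (z + z'); rewrite pairingD // ez ez' rmorphD.
- move=> x z /= /tnthP[i ->]; rewrite -scaler_int; split.
    exact/memvZ/(tnth_h cartan_basis).
  have [z' ez'] := mui i; exists (z * z').
  by rewrite pairingZ ez' rmorphM.
Qed.

Variables (d : nat) (b : d.-tuple V) (b_basis : basis_of fullv b).

Lemma iter_linear n (f : V -> V) : linear f -> linear (iter n f).
Proof. by move=> lf; elim: n => [|n IH] a u v //=; rewrite IH lf. Qed.

(** Some [H_i] takes a nonzero value on [c], so [nilpotent_shift] applies on every weight vector.
    The exponent [d] is the one at which [exp_mx] is truncated. *)
Lemma root_nilpotent c v : Delta R c -> rd_ev c != 0 -> iter d (act V (X c)) v = 0.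
Proof.
move=> cD c0.
have [i ci] : exists i, rpair c (tnth H i) != 0.
  apply: contrapT => /forallNP e; move/eqP: c0; apply.
  apply: (pairing_eq cartan_basis) => i.
  have /negP := e i; rewrite negbK => /eqP e0.
  by rewrite [RHS]/pairing lfunE; exact: e0.
move: v; apply: (weight_ext V_rat (f' := fun=> 0)).
- exact/iter_linear/act_linr.
- by move=> a u v; rewrite scaler0 addr0.
move=> mu v mv; have ih := tnth_h cartan_basis i.
apply: (nilpotent_shift hK b_basis (act_linr (tnth H i)) (act_linr (X c)) ci _ (mv _ ih)).
move=> w; rewrite act_evenl; last exact: H_even.
by rewrite cartan_root_vector // (linZ (act_linl w)) addrC.
Qed.

End Module.

Definition combination (m : seq (rd_lat R * int)) (x : g) : K :=
  \sum_(p <- m) rpair p.1 x *~ p.2.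

(* The last condition says that [H_c] is primitive away from 2. *)
Definition primitive_root c : Prop :=
  [/\ rd_part R true c, Delta R (- c) &
     exists m, (forall p, p \in m -> Delta R p.1) /\
       (combination m (rd_coroot c) = 1 \/ combination m (rd_coroot c) = 2)].

(** The facts whose proofs depend on the type, gathered so that all types are treated alike
    afterwards. [rf_exc] keeps the constant r + 2 off the strings along even roots, [rf_double]
    makes the square of an odd X_c integral, and the second alternative of [rf_primitive] serves the
    roots 2 eps_i of P(n). *)
Record root_facts : Prop := RootFacts {
  rf_evD : forall a c, rd_ev (a + c) = rd_ev a + rd_ev c;
  rf_even_ev : forall c, rd_part R false c -> rd_ev c != 0;
  rf_odd_inj : forall a c, rd_part R true a -> rd_part R true c ->
    rd_ev a = rd_ev c -> a = c;
  rf_two : forall c, c + c = 0 -> c = 0;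
  rf_even_norm : forall c, rd_part R false c -> rnorm c != 0;
  rf_even_opp : forall c, rd_part R false c -> ~ rd_part R true (- c);
  rf_exc : forall a c, rd_exc a c -> ~ rd_part R false a;
  rf_isotropic : forall a c, Delta R a -> Delta R c -> rnorm a = 0 -> rnorm c = 0 ->
    exists z : int, rpair c (rd_coroot a) = z%:~R;
  rf_double : forall c, rd_part R true c -> Delta R (c *+ 2) ->
    exists m : int, br (X c) (X c) = X (c *+ 2) *~ (2 * m);
  rf_primitive : forall c, rd_part R true c -> primitive_root c \/
    exists a c', [/\ rd_part R false a, primitive_root c' &
      br (X a) (X c) = X c' \/ br (X a) (X c) = - X c'] }.

End Chevalley.

(** * Root facts outside type P(n) *)

Section NotTypeP.
Variables (K : closedFieldType) (hK : [pchar K] =i pred0) (g : lieSuperalg K).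
Variables (h : {vspace g}) (h_even : (h <= lie_part g false)%VS).
Variables (B : g -> g -> K) (Hc : 'Hom(subvs_of h, K^o) -> g).
Variables (Pi : set 'Hom(subvs_of h, K^o)) (s : seq 'Hom(subvs_of h, K^o)).
Let R := @RootDatum K g h ('Hom(subvs_of h, K^o) : zmodType) id (@root_part K g h) B Hc Pi
                        (fun _ _ => False).
Hypotheses (R_dist : distinguished R) (B_form : even_invariant_form B).
Hypotheses (sE : enumerates s (Delta R)) (Hc_std : standard_coroots (R := R) s).
Variables (l : nat) (H : l.-tuple g) (X : rd_lat R -> g).
Hypothesis hX : chevalley_basis H X.
Variables (V : superModule g) (V_faithful : faithful V) (V_rat : rational h V H).
Variables (d : nat) (b : d.-tuple V) (b_basis : basis_of fullv b).
Implicit Types (a c : rd_lat R).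

(** Otherwise X_c would lie in the radical of the form. By invariance under [H], a nonzero value of
    [B] on X_c and X_{c'} forces c' = - c, and evenness of [B] then forces equal parities; a nonzero
    value against an [H_j] would force c = 0. *)
Lemma notP_opp p c : rd_part R p c -> rd_part R p (- c).
Proof.
move=> cp; apply: contrapT => ncp; have cD := part_Delta cp.
have [[Bl Br] [Bs B01] Binv Bnd] := B_form.
have /negP := root_vector_neq0 hX cD; apply; apply/eqP/Bnd => y.
have B10 x z : x \in lie_part g true -> z \in lie_part g false -> B x z = 0.
  by move=> x1 z0; rewrite (Bs true false) // B01 // mulr0.
have BN x z : B (- x) z = - B x z.
  have B0 : B 0 z = 0 by have := Br z (-1) 0 0; rewrite scaler0 addr0 mulN1r addNr.
  by have := Br z (-1) x 0; rewrite !addr0 B0 addr0 scaleN1r mulN1r.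
have BZ t x z : B (t *: x) z = t * B x z.
  have B0 : B 0 z = 0 by have := Br z (-1) 0 0; rewrite scaler0 addr0 mulN1r addNr.
  by have := Br z t x 0; rewrite addr0 B0 addr0.
have BrZ t x z : B x (t *: z) = t * B x z.
  have B0 : B x 0 = 0 by have := Bl x (-1) 0 0; rewrite scaler0 addr0 mulN1r addNr.
  by have := Bl x t z 0; rewrite addr0 B0 addr0.
have anti i x : x \in lie_part g false \/ x \in lie_part g true ->
    br x (tnth H i) = - br (tnth H i) x.
  move=> xp; have Hi := H_even h_even hX i.
  by case: xp => xp; rewrite (br_anti xp Hi) /psign ?andbF expr0 scale1r.
have Xpp c' : Delta R c' -> X c' \in lie_part g false \/ X c' \in lie_part g true.
  by case=> /(root_vector_part hX); [left|right].
have cX i x : B (br (tnth H i) (X c)) x = - B (X c) (br (tnth H i) x).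
  by rewrite -[br (tnth H i) (X c)]opprK -anti ?BN ?Binv //; apply: Xpp.
move: y; apply: (chevalley_ind hX).
- by have := Bl (X c) (-1) 0 0; rewrite scaler0 addr0 mulN1r addNr.
- by move=> x y ex ey; have := Bl (X c) 1 x y; rewrite scale1r ex ey mulr0 addr0.
- by move=> t x ex; rewrite BrZ ex mulr0.
- move=> j; apply: contrapT => /eqP nz; apply: (root_neq0 R_dist cD).
  apply: (pairing_eq (cartan_basis hX)) => i; rewrite [RHS]/pairing lfunE /=.
  have := cX i (tnth H j); rewrite (cartan_root_vector hX cD) ?(tnth_h (cartan_basis hX)) //.
  have -> : br (tnth H i) (tnth H j) = 0 by case: hX => _ _ [-> _].
  rewrite BZ -[0 in RHS](scale0r 0) BrZ mul0r oppr0 => /eqP.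
  by rewrite mulf_eq0 (negPf nz) orbF => /eqP.
move=> c' c'D; apply: contrapT => /eqP nz.
have e : c' = - c.
  apply: (pairing_eq (cartan_basis hX)) => i.
  have hi := tnth_h (cartan_basis hX) i.
  have := cX i (X c'); rewrite !(cartan_root_vector hX) // BZ BrZ -mulNr => /(mulIf nz) e.
  by rewrite /pairing opp_lfunE; move: e; rewrite /rpair /pairing /= => ->; rewrite opprK.
subst c'; have [q cq] := Delta_part c'D; move/negP: nz; apply; apply/eqP.
have Xc := root_vector_part hX cp; have Xnc := root_vector_part hX cq.
by case: p q cp ncp cq Xc Xnc => -[] cp ncp cq Xc Xnc //; [apply: B10|apply: B01].
Qed.

Lemma notP_opp_Delta c : Delta R c -> Delta R (- c).
Proof. by move=> /Delta_part[p /notP_opp/part_Delta]. Qed.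

Lemma notP_two c : c + c = 0 -> c = 0.
Proof.
rewrite -mulr2n -scaler_nat => /eqP.
by rewrite scaler_eq0 (natK_eq0 hK) /= => /eqP.
Qed.

Lemma notP_three c : c *+ 3 = 0 -> c = 0.
Proof.
rewrite -scaler_nat => /eqP.
by rewrite scaler_eq0 (natK_eq0 hK) /= => /eqP.
Qed.

Lemma notP_norm_coroot c : Delta R c -> rnorm c = 0 -> rpair c (rd_coroot c) = 0.
Proof.
move=> cD n0; have [[t ->] _ _ _] := Hc_std cD.
by rewrite rpairZ -[rpair _ _]/(rnorm (R := R) c) n0 mulr0.
Qed.

Lemma notP_norm_opp c : Delta R c -> rnorm c != 0 -> rnorm (- c) != 0.
Proof.
move=> cD n0; apply/eqP => nn; have ncD := notP_opp_Delta cD.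
have := notP_norm_coroot ncD nn; have [_ e /(_ n0) e2 _] := Hc_std cD.
rewrite e rpair_opp /rpair /pairing opp_lfunE opprK; move: e2; rewrite /rpair /pairing => -> /eqP.
by rewrite -[2]/(2%:R) (natK_eq0 hK).
Qed.

(* If [c] were isotropic, [X_c], [X_{-c}] and [H_c] would span a Heisenberg
   algebra whose centre acts on [V] by a nonzero scalar somewhere.            *)
Lemma notP_even_norm c : rd_part R false c -> rnorm c != 0.
Proof.
move=> c0; apply/eqP => n0; have cD := part_Delta c0.
have ncD := notP_opp_Delta cD; have nc0 := notP_opp c0.
have cz := notP_norm_coroot cD n0; set z := rd_coroot c in cz.
have zh : z \in h := coroot_h hX cD ncD.
have [_ _ _ /(_ n0) [_ [m m1]]] := Hc_std cD.
have [c' c'D c'z] : exists2 c', Delta R c' & rpair c' z != 0.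
  apply: contrapT => nex; have /eqP := oner_neq0 K; apply.
  rewrite -m1 big_seq big1 // => c' /sE.2 c'D.
  have [->|nz] := eqVneq (rpair c' z) 0; first by rewrite mul0rz.
  by case: nex; exists c'.
have [mu [v [v0 mv Xv0]]] := root_act_neq0 hX V_faithful V_rat c'D.
(* If [mu] vanishes at [z], then mu + c' does not, because c'(z) is nonzero. *)
have [lam lam0 [u u0 zu]] : exists2 lam, lam != 0 & exists2 u : V, u != 0 &
    act V z u = lam *: u.
  have [muz|muz] := eqVneq (pairing mu z) 0; last first.
    by exists (pairing mu z) => //; exists v => //; apply: mv.
  exists (rpair c' z) => //; exists (act V (X c') v) => //.
  rewrite (root_shift h_even hX c'D mv zh) {1}/pairing lfunE /= -[mu _]/(pairing mu z).
  by rewrite muz add0r.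
pose e := act V (X c); pose f := act V (X (- c)).
have zcomm a x : Delta R a -> rpair a z = 0 -> act V z (act V (X a) x) = act V (X a) (act V z x).
  move=> aD az; rewrite (act_evenl _ _ (subvP h_even _ zh)) (cartan_root_vector hX aD zh).
  by rewrite az scale0r (lin0 (act_linl x)) add0r.
have zf x : act V z (f x) = f (act V z x).
  by apply: zcomm => //; rewrite /rpair /pairing opp_lfunE; move: cz; rewrite /rpair /pairing => ->; rewrite oppr0.
have ze x : act V z (e x) = e (act V z x) by apply: zcomm.
have itz n (F : V -> V) x : linear F -> (forall x, act V z (F x) = F (act V z x)) ->
    act V z x = lam *: x -> act V z (iter n F x) = lam *: iter n F x.
  by move=> lF zF zx; elim: n => //= n IH; rewrite zF IH (linZ lF).
(* [w] is the last nonzero vector among the iterates of [e] on [u], which end because X_c is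
   nilpotent on [V]. *)
have [w [w0 ew zw]] : exists w, [/\ w != 0, e w = 0 & act V z w = lam *: w].
  have ex : exists n, iter n e u == 0.
    exists d; apply/eqP; apply: (root_nilpotent hK h_even hX V_rat b_basis _ cD).
    by case: c0.
  case: (ex_minnP ex) => -[|n] n0' nmin; first by rewrite /= (negPf u0) in n0'.
  exists (iter n e u); split; last exact: itz (act_linr _) ze zu.
    by apply/negP => /nmin; rewrite ltnn.
  exact/eqP.
pose t := chevalley_sign (R := R) c : K.
have t0 : t != 0.
  by apply/eqP => t0; have := chevalley_sign_sqr c; rewrite -/t t0 mul0r => /eqP; rewrite eq_sym oner_eq0.
have ef x : e (f x) = t *: act V z x + f (e x).
  rewrite /e (act_evenl _ _ (root_vector_part hX c0)) (chevalley_opp hX cD ncD).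
  by rewrite (linZ (act_linl x)).
have f0 : f 0 = 0 by exact: lin0 (act_linr _).
have fZ r x : f (r *: x) = r *: f x by exact: linZ (act_linr _) r x.
have e0 : e 0 = 0 by exact: lin0 (act_linr _).
have zw' n := itz n f w (act_linr _) zf zw.
(* These coefficients never vanish, so no power of [f] kills [w], against the nilpotency of
   X_{-c}. *)
have efn n : e (iter n.+1 f w) = (n.+1%:R * (t * lam)) *: iter n f w.
  elim: n => [|n IH]; first by rewrite /= ef ew f0 addr0 zw scalerA mul1r.
  rewrite iterS ef zw' IH fZ -iterS scalerA -scalerDl.
  by rewrite -[n.+2%:R]natr1 mulrDl mul1r addrC.
have nz n : iter n f w != 0.
  elim: n => // n IH; apply/eqP => z0; have := efn n; rewrite z0.
  rewrite e0 => /esym/eqP; rewrite scaler_eq0 (negPf IH) orbF.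
  by rewrite !mulf_eq0 (negPf t0) (negPf lam0) (natK_eq0 hK).
have := nz d; rewrite /f (root_nilpotent hK h_even hX V_rat b_basis w ncD) ?eqxx //.
by case: nc0.
Qed.

(** For isotropic [c] the constant is +-c(H_c) = 0. Otherwise the string -2c, -c, 0, c has depth 3,
    so that [X_c, X_c] is +-4 X_{2c}. *)
Lemma notP_double c : rd_part R true c -> Delta R (c *+ 2) ->
  exists m : int, br (X c) (X c) = X (c *+ 2) *~ (2 * m).
Proof.
move=> c1 c2D; have cD := part_Delta c1; have c0 := root_neq0 R_dist cD.
have cnc : c <> - c by move=> e; apply/c0/notP_two; rewrite {2}e subrr.
have [_ /(_ c2D) [t te [tn ti]]] := chevalley_add hX cD cD cnc.
rewrite -mulr2n in te.
have [n0|n0] := eqVneq (rnorm c) 0.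
  exists 0; rewrite mulr0 mulr0z te.
  by case: (ti n0 n0) => ->; rewrite notP_norm_coroot // ?oppr0 scale0r.
have ncD := notP_opp_Delta cD.
have nc2D : Delta R (- c - c) by rewrite -opprD -mulr2n; apply: notP_opp_Delta.
have pm_neq0 r (x : K) : pm r.+1%:R x -> x != 0.
  by case=> ->; rewrite ?oppr_eq0 (natK_eq0 hK).
have nn0 := notP_norm_opp cD n0.
(* The Jacobi identity kills [x, [x, x]] for the odd vector x = X_{-c}, whereas a root -3c would
   make both structure constants involved nonzero. *)
have no3 : ~ Delta R (- c *+ 3).
  rewrite mulrSr mulr2n => n3D; have n1 := notP_opp c1; have Xn1 := root_vector_part hX n1.
  have nn : - c <> - - c by move=> /oppr_inj/cnc.
  have [_ /(_ nc2D) [t3 e3 [/(_ (or_introl nn0)) [r3 _ [/(_ id) t3n _]] _]]] :=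
    chevalley_add hX ncD ncD nn.
  have nn' : - c <> - (- c - c).
    by move=> /oppr_inj e; apply/c0/notP_three; rewrite mulrSr mulr2n {3}e -opprD subrr.
  have n3D' : Delta R (- c + (- c - c)) by rewrite addrC.
  have [_ /(_ n3D') [t2 e2 [/(_ (or_introl nn0)) [r2 _ [/(_ id) t2n _]] _]]] :=
    chevalley_add hX ncD nc2D nn'.
  have J : br (X (- c)) (br (X (- c)) (X (- c))) = 0.
    set x := X (- c); set y := br x (br x x).
    have xx : br x x \in lie_part g false by apply: (br_part Xn1 Xn1).
    have := br_jacobi x Xn1 Xn1; rewrite -/x -/y (br_anti xx Xn1) -/y /psign /= expr0 expr1.
    rewrite scale1r scaleN1r => /eqP; rewrite -subr_eq0 opprD !opprK addrA -mulr2n -mulrSr.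
    by rewrite -scaler_nat scaler_eq0 (natK_eq0 hK) /= => /eqP.
  move: J; rewrite e3 brZ e2 scalerA => /eqP.
  rewrite scaler_eq0 (negPf (root_vector_neq0 hX n3D')) orbF mulf_eq0.
  by rewrite (negPf (pm_neq0 _ _ t3n)) (negPf (pm_neq0 _ _ t2n)).
have [r [rle rgt] [/(_ id) tr _]] := tn (or_introl n0).
(* c - j c for j = 1, 2, 3 is 0, -c, -2c, all allowed in a string, while -3c for j = 4 is neither a
   root nor 0. *)
have r3 : r = 3.
  have cj j : c - c *+ j.+1 = - (c *+ j) by rewrite mulrS opprD addrA subrr add0r.
  have [r3|r3|//] := ltngtP r 3.
    case: rgt; rewrite cj; case: r r3 {rle tr} => [|[|[|//]]] _.
    - by right; rewrite mulr0n oppr0.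
    - by left.
    - by left; rewrite mulr2n opprD.
  have := rle 4 r3; rewrite cj => -[|e]; first by rewrite -mulNrn.
  by case: c0; apply: notP_three; apply/eqP; rewrite -oppr_eq0 e.
rewrite te; move: tr; rewrite r3 => -[->|->]; [exists 2|exists (-2)].
  by rewrite -scaler_int.
by rewrite -scaler_int.
Qed.

Lemma notP_root_facts : root_facts X.
Proof.
split.
- by [].
- by move=> c [].
- by [].
- exact: notP_two.
- exact: notP_even_norm.
- move=> c c0 nc1; have := root_part_uniq hX (notP_opp c0) nc1; by [].
- by [].
- move=> a c aD cD na nc; have [_ _ _ /(_ na) [hz _]] := Hc_std aD; exact: hz.
- exact: notP_double.
move=> c c1; left; have cD := part_Delta c1; split=> //.
  exact: notP_opp_Delta.
have [_ _ h1 h2] := Hc_std cD.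
(* A nonisotropic root takes the value 2 on its own coroot; for an isotropic one the normalization
   supplies a combination with value 1. *)
have [n0|n0] := eqVneq (rnorm c) 0; last first.
  exists [:: (c, 1)]; split; first by move=> p; rewrite inE => /eqP ->.
  by right; rewrite /combination big_seq1 /= mulr1z h1.
have [_ [m m1]] := h2 n0.
exists [seq (c', m c') | c' <- s]; split.
  by move=> p /mapP[c' /sE.2 c'D ->].
by left; rewrite /combination big_map.
Qed.

End NotTypeP.

(** * Root facts in type P(n) *)

Section TypeP.
Variables (K : closedFieldType) (hK : [pchar K] =i pred0) (g : lieSuperalg K).
Variables (h : {vspace g}) (h_even : (h <= lie_part g false)%VS).
Variables (n : nat) (pi : 'M[K]_(n.+1 + n.+1) -> g).
Variables (ev : 'rV[int]_n.+1 -> 'Hom(subvs_of h, K^o)) (F : g -> g -> K).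
Variables (Hc : 'rV[int]_n.+1 -> g) (Pi : set 'rV[int]_n.+1).
Let R := @RootDatum K g h ('rV[int]_n.+1 : zmodType) ev (@P_roots n) F Hc Pi (@P_exc n).
Hypotheses (n_gt1 : (1 < n)%N) (n_neq3 : n <> 3%N).
Hypothesis h_diag : forall x, x \in h <->
       exists2 d : 'rV_n.+1, \sum_i d 0 i = 0 & x = pi (P_diag d).
Hypothesis evE : forall (c : 'rV_n.+1) (d : 'rV_n.+1), \sum_i d 0 i = 0 ->
       pairing (ev c) (pi (P_diag d)) = \sum_i d 0 i *~ c 0 i.
Hypothesis FE : forall d d' : 'rV_n.+1, \sum_i d 0 i = 0 -> \sum_i d' 0 i = 0 ->
       F (pi (P_diag d)) (pi (P_diag d')) = \sum_i d 0 i * d' 0 i.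
Hypothesis Hc_beta : forall i j : 'I_n.+1, (i < j)%N ->
       Hc (eps i + eps j) = pi (P_alpha_coroot K i j) /\
       Hc (- (eps i + eps j)) = - pi (P_alpha_coroot K i j).
Variables (l : nat) (H : l.-tuple g) (X : rd_lat R -> g).
Hypothesis hX : chevalley_basis H X.
Implicit Types (a c : 'rV[int]_n.+1).

(** An additive invariant equal to 0 on even roots and +-2 on odd ones; it decides the parity of a
    root and rules out many sums of roots. *)
Definition csum c : int := \sum_i c 0 i.
Definition cdot a c : int := \sum_i a 0 i * c 0 i.

Lemma csumD a c : csum (a + c) = csum a + csum c.
Proof. by rewrite /csum -big_split; apply: eq_bigr => i _; rewrite mxE. Qed.

Lemma csumN a : csum (- a) = - csum a.
Proof. by rewrite /csum -sumrN; apply: eq_bigr => i _; rewrite mxE. Qed.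

Lemma eps_coef (i k : 'I_n.+1) : eps i ord0 k = (k == i)%:R :> int.
Proof. by rewrite !mxE eqxx. Qed.

Lemma sum_delta (W : pzRingType) (f : 'I_n.+1 -> W) i : \sum_k f k * (k == i)%:R = f i.
Proof.
rewrite (bigD1 i) //= eqxx mulr1 big1 ?addr0 // => k /negPf ->.
by rewrite mulr0.
Qed.

Lemma csum_eps i : csum (eps i) = 1.
Proof.
rewrite /csum -[RHS](sum_delta (fun=> 1) i).
by apply: eq_bigr => k _; rewrite eps_coef mul1r.
Qed.

Lemma cdotD a a' c : cdot (a + a') c = cdot a c + cdot a' c.
Proof. by rewrite /cdot -big_split; apply: eq_bigr => i _; rewrite mxE mulrDl. Qed.

Lemma cdotN a c : cdot (- a) c = - cdot a c.
Proof. by rewrite /cdot -sumrN; apply: eq_bigr => i _; rewrite mxE mulNr. Qed.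

Lemma cdot_eps i c : cdot (eps i) c = c 0 i.
Proof.
rewrite /cdot -[RHS](sum_delta (fun k => c 0 k) i).
by apply: eq_bigr => k _; rewrite eps_coef mulrC.
Qed.

Lemma coefN a k : (- a) 0 k = - a 0 k. Proof. by rewrite mxE. Qed.
Lemma coefD a c k : (a + c) 0 k = a 0 k + c 0 k. Proof. by rewrite mxE. Qed.

Lemma P_even_sum c : P_roots false c -> csum c = 0.
Proof. by move=> [i [j [_ ->]]]; rewrite csumD csumN !csum_eps subrr. Qed.

Lemma P_odd_sum c : P_roots true c -> csum c = 2 \/ csum c = - 2.
Proof.
case=> [[i [j [_ []->]]]|[i ->]]; rewrite ?mulr2n ?csumN !csumD !csum_eps;
  by [left|right].
Qed.

(* (n + 1) times the squared norm of the projection of [c] to the hyperplane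
   of vectors of sum 0                                                        *)
Lemma P_root_norm c : Delta R c -> cdot c c * n.+1%:Z - csum c * csum c != 0.
Proof.
have n3 : (2 < n.+1)%N by rewrite ltnS.
case=> [c0|c1].
  rewrite (P_even_sum c0); case: c0 => i [j [ij ->]].
  rewrite cdotD cdotN !cdot_eps !coefD !coefN !eps_coef !eqxx eq_sym (negPf ij).
  by lia.
have sum4 : csum c * csum c = 4 by case: (P_odd_sum c1) => ->.
rewrite sum4; case: c1 {sum4} => [[i [j [ij []->]]]|[i ->]];
  rewrite ?mulr2n ?cdotN ?cdotD ?cdotN !cdot_eps ?coefN !coefD !eps_coef !eqxx ?(eq_sym j i) ?(negPf ij); by lia.
Qed.

Definition zero_sum (d : 'rV[K]_n.+1) := \sum_i d 0 i = 0.

(** The orthogonal projection of [c] to the vectors of sum 0, which gives the element of [h] dual to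
    [ev c]. *)
Definition proj0 c : 'rV[K]_n.+1 :=
  \row_i ((c 0 i)%:~R - (csum c)%:~R / n.+1%:R).

Let N0 : n.+1%:R != 0 :> K. Proof. by rewrite natK_eq0. Qed.

Lemma proj0_sum c : zero_sum (proj0 c).
Proof.
rewrite /zero_sum (eq_bigr (fun i => (c 0 i)%:~R - (csum c)%:~R / n.+1%:R)); last first.
  by move=> i _; rewrite mxE.
rewrite sumrB sumr_const card_ord -[_ / _ *+ _]mulr_natr divfK //.
by rewrite -rmorph_sum subrr.
Qed.

Lemma proj0_dot c (d : 'rV[K]_n.+1) : zero_sum d ->
  \sum_i proj0 c 0 i * d 0 i = \sum_i d 0 i *~ c 0 i.
Proof.
move=> d0; rewrite (eq_bigr (fun i => d 0 i *~ c 0 i - (csum c)%:~R / n.+1%:R * d 0 i)); last first.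
  by move=> i _; rewrite mxE mulrBl; congr (_ - _); rewrite mulrzl.
by rewrite sumrB -mulr_sumr d0 mulr0 subr0.
Qed.

(** The dual vector of [ev c] is given by [proj0 c], and [n.+1] times its squared norm is the
    integer of [P_root_norm]. Thus no root of P(n) is isotropic, and its structure constants all
    come from strings. *)
Lemma P_norm_neq0 c : Delta R c -> rnorm (R := R) c != 0.
Proof.
move=> cD; have p0 := proj0_sum c.
pose D := [set x | x \in h /\ forall y, y \in h -> F x y = pairing (ev c) y]%classic.
have [vh vE] : D (dual_vector F (ev c)).
  apply: (@xgetPex _ 0 D); exists (pi (P_diag (proj0 c))); split.
    by apply/h_diag; exists (proj0 c).
  move=> y /h_diag[d d0 ->]; rewrite FE // evE //; exact: proj0_dot.
have [d d0 ed] := (h_diag _).1 vh.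
have e1 : rnorm (R := R) c = \sum_i d 0 i *~ c 0 i.
  by rewrite /rnorm /dual_form /= ed evE.
have ph : pi (P_diag (proj0 c)) \in h by apply/h_diag; exists (proj0 c).
have := vE _ ph; rewrite ed FE // evE // => e2.
have e3 : rnorm (R := R) c = \sum_i proj0 c 0 i *~ c 0 i.
  rewrite e1 -e2 -proj0_dot //; apply: eq_bigr => i _; exact: mulrC.
have e4 : rnorm (R := R) c * n.+1%:R = (cdot c c * n.+1%:Z - csum c * csum c)%:~R.
  rewrite e3 (eq_bigr (fun i => (c 0 i * c 0 i)%:~R - (csum c)%:~R / n.+1%:R * (c 0 i)%:~R)); last first.
    by move=> i _; rewrite mxE -mulrzr mulrBl rmorphM.
  rewrite sumrB -mulr_sumr -!rmorph_sum /= -/(csum c) -/(cdot c c) mulrBl mulrAC divfK //.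
  by rewrite rmorphB !rmorphM.
by apply: contra (P_root_norm cD) => /eqP z; rewrite -(intK_eq0 hK) -e4 z mul0r.
Qed.

Lemma P_pairing_ext mu nu : (forall d, zero_sum d ->
  pairing mu (pi (P_diag d)) = pairing nu (pi (P_diag d))) -> mu = nu :> 'Hom(subvs_of h, K^o).
Proof.
move=> e; apply: (pairing_eq (cartan_basis hX)) => i.
have [d d0 ->] := (h_diag _).1 (tnth_h (cartan_basis hX) i).
exact: e.
Qed.

Lemma P_evD a c : ev (a + c) = ev a + ev c.
Proof.
apply: P_pairing_ext => d d0; rewrite evE //.
rewrite (eq_bigr (fun i => d 0 i *~ a 0 i + d 0 i *~ c 0 i)).
  by rewrite big_split /= -!evE // /pairing lfunE.
by move=> i _; rewrite mxE mulrzDr.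
Qed.

Definition alpha_diag (i j : 'I_n.+1) : 'rV[K]_n.+1 := delta_mx 0 i - delta_mx 0 j.

Lemma alpha_dot i j c : \sum_k alpha_diag i j 0 k *~ c 0 k = (c 0 i - c 0 j)%:~R.
Proof.
rewrite (eq_bigr (fun k => (c 0 k)%:~R * (k == i)%:R - (c 0 k)%:~R * (k == j)%:R)).
  by rewrite sumrB !(sum_delta (fun k => (c 0 k)%:~R)) rmorphB.
by move=> k _; rewrite !mxE eqxx /= -mulrzr mulrBl ![_ * (c 0 k)%:~R]mulrC.
Qed.

Lemma alpha_zero_sum i j : zero_sum (alpha_diag i j).
Proof.
rewrite /zero_sum (eq_bigr (fun k => 1 * (k == i)%:R - 1 * (k == j)%:R)).
  by rewrite sumrB !(sum_delta (fun=> 1)) subrr.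
by move=> k _; rewrite !mxE !mul1r.
Qed.

Lemma ev_alpha i j c : pairing (ev c) (pi (P_diag (alpha_diag i j))) = (c 0 i - c 0 j)%:~R.
Proof. by rewrite evE ?alpha_dot //; apply: alpha_zero_sum. Qed.

Lemma ev_inj_const a c : ev a = ev c -> forall i j, a 0 i - a 0 j = c 0 i - c 0 j.
Proof. by move=> e i j; apply: (intK_inj hK); rewrite -!ev_alpha e. Qed.

(** If the restrictions agree, a - c is [t] times the vector of ones, and t (n + 1) is a difference
    of two numbers +-2. A nonzero [t] would require n = 3 with t = +-1, or n at most 1. *)
Lemma P_odd_inj a c : P_roots true a -> P_roots true c -> ev a = ev c -> a = c.
Proof.
move=> a1 c1 /ev_inj_const e; pose t := a 0 0 - c 0 0.
have et k : a 0 k = c 0 k + t by have := e k 0; rewrite /t; lia.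
have st : csum a = csum c + t * n.+1%:Z.
  rewrite /csum (eq_bigr (fun k => c 0 k + t)) => [|k _]; last exact: et.
  by rewrite big_split sumr_const card_ord -mulr_natr natz.
suff t0 : t = 0 by apply/rowP => k; rewrite et t0 addr0.
have : (t == 0) || (`|t|%N == 1) || (1 < `|t|)%N by lia.
case/orP=> [/orP[/eqP //|/eqP t1]|t2]; case: (P_odd_sum a1) (P_odd_sum c1) st => -> [] -> st; nia.
Qed.

(** Up to sign the coroot is that of the even root eps_i - eps_j, which takes the value 2 on it. *)
Lemma P_beta_primitive i j (c : 'rV[int]_n.+1) : i != j ->
  c = eps i + eps j \/ c = - (eps i + eps j) -> primitive_root (c : rd_lat R).
Proof.
wlog ij : i j / (i < j)%N => [hw ij ce|_ ce].
  have [lt|gt|/val_inj e] := ltngtP i j; first exact: hw lt ij ce.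
    by apply: hw gt _ _; rewrite 1?eq_sym // addrC.
  by rewrite e eqxx in ij.
have ne : i != j by rewrite -val_eqE /= ltn_eqF.
have aD : Delta R (eps i - eps j) by left; exists i, j.
have bE : P_roots true (eps i + eps j) by left; exists i, j; split=> //; left.
have bN : P_roots true (- (eps i + eps j)) by left; exists i, j; split=> //; right.
have v2 : pairing (ev (eps i - eps j)) (pi (P_alpha_coroot K i j)) = 2.
  rewrite -/(alpha_diag i j) ev_alpha !coefD !coefN !eps_coef !eqxx.
  by rewrite (eq_sym j i) (negPf ne).
have [e1 e2] := Hc_beta ij.
case: ce => ->; split=> //.
- by right.
- exists [:: (eps i - eps j, 1)]; split; first by move=> p; rewrite inE => /eqP ->.
  by right; rewrite /combination big_seq1 mulr1z /= /rpair /= e1.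
- by rewrite opprK; right.
exists [:: (eps i - eps j, -1)]; split; first by move=> p; rewrite inE => /eqP ->.
right; rewrite /combination big_seq1 mulrN1z /= e2 -(rpair_opp) opprK.
exact: v2.
Qed.

Lemma P_root_facts : root_facts X.
Proof.
split.
- exact: P_evD.
- move=> _ [i [j [ij ->]]]; apply/eqP => e0.
  have := ev_alpha i j (eps i - eps j); rewrite -[ev _]/(rd_ev (_ : rd_lat R)) e0.
  rewrite /pairing lfunE /= !coefD !coefN !eps_coef !eqxx (eq_sym j i) (negPf ij) => /esym/eqP.
  by rewrite intK_eq0.
- exact: P_odd_inj.
- move=> c e; apply/rowP => k; have /rowP/(_ k) := e.
  by rewrite coefD [X in _ = X -> _]mxE [X in _ -> _ = X]mxE; move: (c 0 k) => z; lia.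
- by move=> c c0; apply: P_norm_neq0; left.
- move=> c /P_even_sum c0 /P_odd_sum; rewrite csumN c0 => -[] //.
- by move=> a c [i [j [_ -> _]]] /P_even_sum; rewrite csumD !csum_eps.
- by move=> a c aD _ /eqP; rewrite (negPf (P_norm_neq0 aD)).
- move=> c c1 c2; exfalso.
  have e2 : csum (c *+ 2) = csum c + csum c by rewrite mulr2n csumD.
  by move: c2 (P_odd_sum c1) => [/P_even_sum|/P_odd_sum]; rewrite e2; lia.
move=> c [[i [j [ij ce]]]|[i ->]]; first by left; apply: P_beta_primitive ij ce.
(* The even root eps_j - eps_i carries 2 eps_i to eps_i + eps_j, which has an opposite; it remains
   to see that the structure constant is +-1, that is, r = 0. *)
right; have [j ji] : exists j : 'I_n.+1, j != i.
  have [->|i0] := eqVneq i ord0; last by exists ord0; rewrite eq_sym.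
  by exists (lift ord0 (Ordinal (ltnW n_gt1))).
exists (eps j - eps i), (eps j + eps i); split.
- by exists j, i.
- by apply: (P_beta_primitive ji); left.
clear c; pose a : rd_lat R := eps j - eps i; pose c : rd_lat R := eps i *+ 2.
have ac : a + c = eps j + eps i by rewrite /a /c mulr2n addrA subrK.
have a0 : rd_part R false a by exists j, i.
have cD : Delta R c by right; right; exists i.
have bD : Delta R (a + c) by rewrite ac; right; left; exists j, i; split=> //; left.
have anc : a <> - c.
  by move=> e; have := P_even_sum a0; rewrite e csumN /c mulr2n csumD !csum_eps.
have [_ /(_ bD) [t te [tn _]]] := chevalley_add hX (part_Delta a0) cD anc.
have [r [rle _] [tr _]] := tn (or_introl (P_norm_neq0 (or_introl a0))).
(* One step down the string lies 3 eps_i - eps_j, whose coordinate sum is 2 and whose coordinate 3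
   occurs in no odd root. *)
have r0 : r = 0%N.
  apply/eqP; rewrite -leqn0 leqNgt; apply/negP => /rle; rewrite mulr1n.
  have e : csum (c - a) = 2 by rewrite csumD csumN (P_even_sum a0) /c mulr2n csumD !csum_eps.
  have e3 : (c - a) 0 i = 3.
    by rewrite /c /a mulr2n opprB !coefD !coefN !eps_coef !eqxx ?(eq_sym i j) (negPf ji).
  case=> [[/P_even_sum|]|e0]; first by rewrite e.
    move: e3 => /[swap] -[[i' [j' [_ []->]]]|[i' ->]];
      rewrite ?mulr2n ?coefN !coefD !eps_coef; case: (i == i'); case: (i == _) => //.
  by move: e; rewrite e0 /csum big1 // => k _; rewrite mxE.
move: (tr); rewrite r0 => h1; rewrite -/a -/c te -ac.
have [] := h1 _; last 2 first.
- by move=> ->; left; rewrite scale1r.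
- by move=> ->; right; rewrite scaleN1r.
by move=> [i' [j' [_ e _]]]; move/P_even_sum: a0; rewrite e csumD !csum_eps.
Qed.

End TypeP.

Lemma standard_root_facts (K : closedFieldType) (hK : [pchar K] =i pred0)
  (g : lieSuperalg K) (hg' : standing_type g) (h : {vspace g})
  (h_even : (h <= lie_part g false)%VS)
  (R : rootDatum h) (hR : standard_rootDatum R) (hPi : distinguished R)
  (l : nat) (H : l.-tuple g) (X : rd_lat R -> g) (hX : chevalley_basis H X)
  (V : superModule g) (hV : faithful V) (hV' : rational h V H)
  (d : nat) (b : d.-tuple V) (b_basis : basis_of fullv b) : root_facts X.
Proof.
case: R / hR hPi X hX => [B Hc Pi s R _ Bf sE Hstd|n pi ev F Hc Pi R n1 model hh evE FE Ha Hb _] hPi X hX.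
  exact: (notP_root_facts hK h_even hPi Bf sE Hstd hX hV hV' b_basis).
apply: (P_root_facts hK h_even n1 _ hh evE FE Hb hX).
by move=> n3; move: pi model {hh evE FE Ha Hb R hPi X hX}; rewrite n3 => pi model;
   case: hg' => _ /(_ (ex_intro _ pi model)).
Qed.

(** * Subgroups and gcds of integer matrix entries *)

Section IdempotentContent.
Variables (W : zmodType) (J : set W).
Hypotheses (J0 : J 0) (J_sub : forall x y, J x -> J y -> J (x - y)).

Lemma subgroupN x : J x -> J (- x).
Proof. by move=> Jx; rewrite -[- x]add0r; apply: J_sub. Qed.

Lemma subgroupD x y : J x -> J y -> J (x + y).
Proof. by move=> Jx Jy; rewrite -[y]opprK; apply/J_sub/subgroupN. Qed.

Lemma subgroupMz x (z : int) : J x -> J (x *~ z).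
Proof.
have Jn n : J x -> J (x *+ n).
  by move=> Jx; elim: n => [|n IH]; rewrite ?mulr0n // mulrS; apply: subgroupD.
by case: z => n Jx; rewrite ?NegzE ?mulrNz -?pmulrn; [|apply: subgroupN]; apply: Jn.
Qed.

Lemma subgroup_sum I (r : seq I) (P : pred I) (F : I -> W) :
  (forall i, P i -> J (F i)) -> J (\sum_(i <- r | P i) F i).
Proof. by move=> JF; apply: big_ind => //; apply: subgroupD. Qed.

Lemma subgroup_gcd x (zs : seq int) : (forall z, z \in zs -> J (x *~ z)) ->
  J (x *~ foldr gcdz 0 zs).
Proof.
elim: zs => [|z zs IH] Jz /=; first by rewrite mulr0z.
have [u [v <-]] := Bezoutz z (foldr gcdz 0 zs).
rewrite mulrzDr; apply: subgroupD.
  by rewrite mulrC mulrzA; apply/subgroupMz/Jz/mem_head.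
rewrite mulrC mulrzA; apply/subgroupMz/IH => z' z's.
by apply: Jz; rewrite in_cons z's orbT.
Qed.

Lemma foldr_gcd_dvd (zs : seq int) z : z \in zs -> (foldr gcdz 0 zs %| z)%Z.
Proof.
elim: zs => //= y zs IH; rewrite in_cons => /orP[/eqP ->|/IH h].
  exact: dvdz_gcdl.
exact: dvdz_trans (dvdz_gcdr _ _) h.
Qed.

Lemma dvd_foldr_gcd (zs : seq int) m : (forall z, z \in zs -> (m %| z)%Z) ->
  (m %| foldr gcdz 0 zs)%Z.
Proof.
elim: zs => [|y zs IH] h /=; first exact: dvdz0.
rewrite dvdz_gcd h ?mem_head //=; apply: IH => z zs'.
by apply: h; rewrite in_cons zs' orbT.
Qed.

(* If [G] is the gcd of the entries, E = E * E gives G^2 | G, hence G = 1. *)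
Lemma idempotent_content d (E : 'M[int]_d) x : E *m E = E -> E != 0 ->
  (forall i j, J (x *~ E i j)) -> J x.
Proof.
move=> EE E0 JE; pose zs := [seq E p.1 p.2 | p : 'I_d * 'I_d].
have zsP z : z \in zs -> exists i j, z = E i j.
  by move=> /mapP[[i j] _ ->]; exists i, j.
have Ezs i j : E i j \in zs by apply/mapP; exists (i, j); rewrite ?mem_enum.
pose G := foldr gcdz 0 zs.
have GE i j : (G %| E i j)%Z by apply: foldr_gcd_dvd.
have GG : (G * G %| G)%Z.
  apply: dvd_foldr_gcd => z /zsP[i [j ->]]; rewrite -EE mxE.
  apply: (big_ind (fun z => (G * G %| z)%Z)) => [|y w|l _]; [exact: dvdz0|exact: rpredD|].
  by apply: dvdz_mul.
have G0 : G != 0.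
  apply: contra E0 => /eqP G0; apply/eqP/matrixP => i j; rewrite mxE.
  by have := GE i j; rewrite G0 dvd0z => /eqP.
have : J (x *~ G) by apply: subgroup_gcd => z /zsP[i [j ->]].
have : (G %| 1)%Z by rewrite -(@dvdz_mul2l G G 1 G0) mulr1.
rewrite dvdz1 => /eqP G1 JG; have [e|e] : G = 1 \/ G = -1 by lia.
  by rewrite e mulr1z in JG.
by rewrite -[x]opprK; apply: subgroupN; rewrite e mulrN1z in JG.
Qed.

End IdempotentContent.

(** * Regrouping of finite double sums *)

Section Truncation.
Variable W : nmodType.

Lemma sum_truncate (F : nat -> W) m n : (m <= n)%N -> (forall i, (m <= i)%N -> F i = 0) ->
  \sum_(i < n) F i = \sum_(i < m) F i.
Proof.
move=> mn F0; rewrite (big_ord_widen n F mn) [RHS]big_mkcond.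
by apply: eq_bigr => i _; case: ltnP => // /F0.
Qed.

Lemma sum_triangle (f : nat -> nat -> W) n :
  \sum_(m < n) \sum_(i < m.+1) f i (m - i)%N = \sum_(i < n) \sum_(j < n - i) f i j.
Proof.
elim: n => [|n IH]; first by rewrite !big_ord0.
rewrite big_ord_recr /= IH [RHS]big_ord_recr /= subSnn big_ord1.
rewrite big_ord_recr /= subnn addrA -big_split /=; congr (_ + _).
by apply: eq_bigr => i _; rewrite subSn ?big_ord_recr // ltnW.
Qed.

(** Cauchy product: a rectangle of terms is regrouped by total degree. Any [n] from [I + D] on will
    do, because [f] vanishes outside the rectangle. *)
Lemma sum_diagonals (f : nat -> nat -> W) I D n : (I + D <= n)%N ->
  (forall i j, (I <= i)%N -> f i j = 0) -> (forall i j, (D <= j)%N -> f i j = 0) ->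
  \sum_(m < n) \sum_(i < m.+1) f i (m - i)%N = \sum_(i < I) \sum_(j < D) f i j.
Proof.
move=> n_ge fI fD; rewrite sum_triangle.
rewrite (@sum_truncate (fun i => \sum_(j < n - i) f i j) I); first last.
- by move=> i Ii; rewrite big1 // => j _; apply: fI.
- by apply: leq_trans n_ge; apply: leq_addr.
apply: eq_bigr => i _; apply: sum_truncate => [|j]; last exact: fD.
have iI := ltn_ord i; lia.
Qed.

End Truncation.

(** The commutator of [u] and [v] gives 0 when multiplied on the right by [u] or by [v]; hence in
    the right-hand side it contributes only itself. *)
Lemma square_zero_swap (Q : pzRingType) (u v : Q) :
  u * u = 0 -> v * v = 0 -> u * v * u = 0 -> v * u * v = 0 ->
  (1 + u) * (1 + v) = (1 + (u * v - v * u)) * ((1 + v) * (1 + u)).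
Proof.
move=> uu vv uvu vuv.
have cv : (u * v - v * u) * v = 0 by rewrite mulrBl vuv -mulrA vv mulr0 subr0.
have cu : (u * v - v * u) * u = 0 by rewrite mulrBl uvu -mulrA uu mulr0 subr0.
have cz : (u * v - v * u) * ((1 + v) * (1 + u)) = u * v - v * u.
  by rewrite mulrA (mulrDr _ 1 v) mulr1 cv addr0 (mulrDr _ 1 u) mulr1 cu addr0.
rewrite [RHS]mulrDl mul1r cz !mulrDl !mul1r !mulrDr !mulr1 -!addrA; congr (_ + _).
by rewrite addrCA; congr (_ + (_ + _)); rewrite [v * u + _]addrC subrK.
Qed.

Section UnitPower.
Variables (k : comNzRingType) (A : salg k) (t t' : A).
Hypotheses (t_even : sa_part A false t) (t'_even : sa_part A false t') (tt' : t * t' = 1).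

Let t't : t' * t = 1. Proof. by rewrite -tt' (even_central t t'_even). Qed.

Lemma unit_power_even z : sa_part A false (unit_power t t' z).
Proof. by case: z => n; apply: part_evenX. Qed.

Lemma unit_powerS z : unit_power t t' (z + 1) = t * unit_power t t' z.
Proof.
case: z => [n|[|n]].
- by rewrite -PoszD addn1 /= exprS.
- by rewrite /= expr1 tt'.
have -> : Negz n.+1 + 1 = Negz n by lia.
by rewrite /= [in RHS]exprS mulrA tt' mul1r.
Qed.

Lemma unit_powerD y z : unit_power t t' (y + z) = unit_power t t' y * unit_power t t' z.
Proof.
elim: y => [|y IH|y IH]; first by rewrite add0r mul1r.
  have -> : Posz y.+1 + z = (Posz y + z) + 1 by lia.
  by rewrite unit_powerS IH mulrA -unit_powerS; congr (unit_power _ _ _ * _); lia.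
have e1 : t * unit_power t t' (- Posz y.+1 + z) = unit_power t t' (- Posz y + z).
  by rewrite -unit_powerS; congr unit_power; lia.
have e2 : t * unit_power t t' (- Posz y.+1) = unit_power t t' (- Posz y).
  by rewrite -unit_powerS; congr unit_power; lia.
have tI (a c : A) : t * a = t * c -> a = c.
  by move=> /(congr1 ( *%R t')); rewrite !mulrA t't !mul1r.
by apply: tI; rewrite e1 IH -e2 mulrA.
Qed.

Lemma unit_power_inv z : unit_power t t' z * unit_power t' t z = 1.
Proof.
have c : GRing.comm t t' by rewrite /GRing.comm tt' t't.
by case: z => n /=; rewrite -exprMn_comm // ?tt' ?t't ?expr1n //; apply: commr_sym.
Qed.

End UnitPower.

(** The additive identity behind a product rule: [aP], [a'P], [a'P'] and [a'S] name matrix products,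
    whose multiplicative structure does not matter here. *)
Lemma telescope_letters (W : zmodType) (P P' S a a' aP a'P a'P' a'S : W) :
  P + aP - (P' + a'P') - (a - a' + S) =
  (aP - a - (a'P - a')) + ((P - P' - S + (a'P - a'P' - a'S)) + a'S).
Proof.
rewrite (addrA (P - P' - S)) subrK [_ + (a'P - a'P')]addrC -(addrA a'P) opprB.
rewrite (addrA (aP - a)) (addrA (aP - a + a' - a'P)) subrK.
by rewrite !opprD !opprK !addrA [LHS](ACl (2*5*6*4*1*3*7)).
Qed.

(** * Chevalley supergroups *)

Section ChevalleyGroups.
Variables (K : closedFieldType) (hK : [pchar K] =i pred0) (g : lieSuperalg K).
Variables (h : {vspace g}) (h_even : (h <= lie_part g false)%VS).
Variables (R : rootDatum h) (R_dist : distinguished R).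
Variables (l : nat) (H : l.-tuple g) (X : rd_lat R -> g).
Hypotheses (hX : chevalley_basis H X) (rf : root_facts X).
Variables (V : superModule g) (V_faithful : faithful V) (V_rat : rational h V H).
Variables (d : nat) (b : d.-tuple V) (b_adm : admissible_lattice H X b).
Implicit Types (a c : rd_lat R) (x y z : g) (mu nu : 'Hom(subvs_of h, K^o)).

Let b_basis : basis_of fullv b. Proof. by case: b_adm. Qed.
Let H_basis := cartan_basis hX.
Let bin_stable v : lattice b v ->
  forall i n, lattice b (binomial_power (act V (tnth H i)) n v).
Proof. by case: b_adm => _ _ + /[dup] bv => /(_ v bv) [_ _]. Qed.
Notation wp := (wproj hK H_basis V_rat b_basis bin_stable).
Let wp_op mu : lat_op b (wp mu).
Proof. exact: wproj_op. Qed.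

(** * The integral form spanned by the Chevalley basis *)

Definition gZ_gen p : set g :=
  fun x => (~~ p /\ x \in H) \/ exists2 c, rd_part R p c & x = X c.

Definition gZ p : set g := zspan (gZ_gen p).

Lemma gZ_X p c (z : int) : rd_part R p c -> gZ p (X c *~ z).
Proof. by move=> cp; apply/zspanMz/zspan_mem; right; exists c. Qed.

Lemma gZ_H x : zspan [set` H]%classic x -> gZ false x.
Proof.
move: x; apply: zspan_ind; [exact: zspan0|exact: zspanD|].
by move=> x z /= xH; apply/zspanMz/zspan_mem; left.
Qed.

Lemma gZ_part p x : gZ p x -> x \in lie_part g p.
Proof.
move: x; apply: zspan_ind; [exact: mem0v|by move=> x y; apply: memvD|].
move=> x z xg; rewrite -scaler_int memvZ //.
case: xg => [[/negPf -> /tnthP[i ->]]|[c cp ->]]; first exact: (H_even h_even hX).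
exact (root_vector_part hX cp).
Qed.

Lemma brMz x y (z : int) : br x (y *~ z) = br x y *~ z.
Proof. exact: linMz (br_linr x) y z. Qed.

Lemma scale_pm (v : g) (t : K) (z : int) : pm z%:~R t ->
  exists2 e : int, e = 1 \/ e = -1 & t *: v = v *~ (e * z).
Proof.
case=> ->; [exists 1|exists (-1)]; rewrite ?mul1r ?mulN1r ?scaler_int //; [by left|by right|].
by rewrite scaleNr scaler_int mulrNz.
Qed.

(** Integrality of the structure constants: a string length if one of the roots is nonisotropic, and
    otherwise a coroot value, integral by [rf_isotropic]. *)
Lemma br_root_int a c : Delta R a -> Delta R c -> a <> - c ->
  br (X a) (X c) = 0 \/
  Delta R (a + c) /\ exists z : int, br (X a) (X c) = X (a + c) *~ z.
Proof.
move=> aD cD ac; have [h0 h1] := chevalley_add hX aD cD ac.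
have [acD|nD] := pselect (Delta R (a + c)); last by left; apply: h0.
right; split=> //; have [t -> [tn ti]] := h1 acD.
suff [z tz] : exists z : int, pm z%:~R t.
  by have [e _ ->] := scale_pm (X (a + c)) tz; exists (e * z).
have [[na nc]|nn] := pselect (rnorm a = 0 /\ rnorm c = 0).
  have [z ez] := rf_isotropic rf aD cD na nc.
  by exists z; rewrite -ez; apply: ti.
have [|r _ [h2 h3]] := tn.
  have [na|na] := eqVneq (rnorm a) 0; last by left.
  by right; apply/eqP => nc; apply: nn.
have [ex|nex] := pselect (rd_exc a c); [exists r.+2; exact: h3|exists r.+1; exact: h2].
Qed.

Lemma br_odd_gZ c p z : rd_part R true c -> gZ p z -> gZ (~~ p) (br (X c) z).
Proof.
move=> c1; have cD := part_Delta c1; have Xc := root_vector_part hX c1; move: z.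
apply: zspan_ind.
- by rewrite br0; apply: zspan0.
- by move=> x y hx hy; rewrite brD; apply: zspanD.
move=> x n xg; rewrite brMz; apply: zspanMz.
case: xg => [[/negPf p0 /tnthP[i ->]]|[c' c'p ->]].
  have Hi := H_even h_even hX i.
  rewrite (br_anti Xc Hi) /psign /= expr0 scale1r p0.
  rewrite (cartan_root_vector hX cD (tnth_h (cartan_basis hX) i)).
  have [m ->] := root_int h_even hX V_faithful V_rat i cD.
  by rewrite scaler_int -mulrNz; apply: gZ_X.
have c'D := part_Delta c'p; have Xc' := root_vector_part hX c'p.
have brp : br (X c) (X c') \in lie_part g (~~ p) by apply: br_part Xc Xc'.
have [e|ne] := pselect (c = - c').
  have p1 : p = true.
    by case: p c'p {brp Xc'} => // c'p; case: (rf_even_opp rf c'p); rewrite -e.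
  have c'E : c' = - c by rewrite e opprK.
  rewrite c'E in c'D *; rewrite (chevalley_opp hX cD c'D) p1.
  have zc := gZ_H (coroot_zspan hX cD c'D).
  by rewrite /chevalley_sign; case: asboolP => _; rewrite ?scaleN1r ?scale1r //; apply: zspanN.
have [->|[sD [n' e]]] := br_root_int cD c'D ne; first exact: zspan0.
(* The parity of c + c' has to be derived: if [n'] is nonzero, the root vector is a multiple of the
   bracket and inherits its parity. *)
have [n0|n0] := eqVneq n' 0; first by rewrite e n0 mulr0z; apply: zspan0.
rewrite e; apply/gZ_X/(root_part_vector hX sD).
have n0' : (n'%:~R : K) != 0 by rewrite intK_eq0.
have -> : X (c + c') = n'%:~R^-1 *: br (X c) (X c').
  by rewrite e -scaler_int scalerA mulVf // scale1r.
exact: memvZ.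
Qed.

Lemma br_gZ_odd c p z : rd_part R true c -> gZ p z -> gZ (~~ p) (br z (X c)).
Proof.
move=> c1 zg; have Xc := root_vector_part hX c1.
rewrite (br_anti (gZ_part zg) Xc) /psign; case: (p && true); rewrite ?expr0 ?expr1.
  by rewrite scaleN1r opprK; apply: br_odd_gZ.
by rewrite scale1r; apply/zspanN/br_odd_gZ.
Qed.

Lemma actD (W : superModule g) x y (v : W) : act W (x + y) v = act W x v + act W y v.
Proof. exact: linD (act_linl (s := W) v) x y. Qed.
Lemma actMz (W : superModule g) x (z : int) (v : W) : act W (x *~ z) v = act W x v *~ z.
Proof. exact: linMz (act_linl (s := W) v) x z. Qed.
Lemma act0 (W : superModule g) (v : W) : act W 0 v = 0.
Proof. exact: lin0 (act_linl (s := W) v). Qed.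

(** The square of an odd operator is half its superbracket with itself, and [rf_double] makes the
    coefficient of X_{2c} there even. When 2c is not a root, [m] is 0 and [c'] is a dummy. *)
Lemma odd_square c : rd_part R true c -> exists c' (m : int),
  [/\ m != 0 -> rd_part R false c', Delta R (c *+ 2) -> c' = c *+ 2 &
      forall v : V, act V (X c) (act V (X c) v) = act V (X c') v *~ m].
Proof.
move=> c1; have cD := part_Delta c1; have Xc := root_vector_part hX c1.
have half (v w : V) : w *+ 2 = v *+ 2 -> w = v.
  rewrite -!scaler_nat => e; apply: (scalerI _ e).
  by rewrite (natK_eq0 hK).
have sq (v : V) : act V (X c) (act V (X c) v) *+ 2 = act V (br (X c) (X c)) v.
  by rewrite (act_br v Xc Xc) /psign expr1 scaleN1r opprK mulr2n.
have cnc : c <> - c.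
  by move=> e; apply: (root_neq0 R_dist cD); apply: (rf_two rf); rewrite {2}e subrr.
have [c2D|nD] := pselect (Delta R (c *+ 2)); last first.
  exists c, 0; split=> // v; apply: half; rewrite sq mulr0z mul0rn.
  by have [h0 _] := chevalley_add hX cD cD cnc; rewrite h0 -?mulr2n // act0.
have [m e] := rf_double rf c1 c2D.
exists (c *+ 2), m; split=> // [m0|v]; last first.
  by apply: half; rewrite sq e actMz mulrC mulrzA [RHS]pmulrn.
apply: (root_part_vector hX c2D).
have m2 : ((2 * m)%:~R : K) != 0 by rewrite intK_eq0 // mulf_eq0.
have -> : X (c *+ 2) = (2 * m)%:~R^-1 *: br (X c) (X c).
  by rewrite e -scaler_int scalerA mulVf // scale1r.
by apply: memvZ; apply: (br_part Xc Xc).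
Qed.

Lemma string_depth_uniq a c r r' : string_depth a c r -> string_depth a c r' -> r = r'.
Proof.
move=> [h1 h2] [h3 h4]; have [lt|lt|//] := ltngtP r r'.
  by case: h2; apply: h3.
by case: h4; apply: h1.
Qed.

Lemma string_depthS a c r : Delta R (c + a) -> string_depth a c r ->
  string_depth a (c + a) r.+1.
Proof.
move=> caD [h1 h2]; have e j : c + a - a *+ j.+1 = c - a *+ j.
  by rewrite mulrS opprD addrA addrK.
split; last by rewrite e.
by case=> [_|j jr]; rewrite ?mulr0n ?subr0 ?e; [left|apply: h1].
Qed.

(** * Divided powers of ad X_a on odd root vectors *)

Section RootString.
Variables (a c : rd_lat R).
Hypotheses (a0 : rd_part R false a) (c1 : rd_part R true c).

(* (ad X_a)^i / i! applied to X_c *)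
Fixpoint ad_power (i : nat) : g :=
  if i is i'.+1 then (i'.+1%:R)^-1 *: br (X a) (ad_power i') else X c.

Lemma ad_powerS i : br (X a) (ad_power i) = ad_power i.+1 *+ i.+1.
Proof.
by rewrite /= -scaler_nat scalerA divff ?scale1r // (natK_eq0 hK).
Qed.

(* Moving up the string by [a] raises its depth by one, so that the structure
   constants +-(r + 1), ..., +-(r + i) multiply to a binomial times i!.       *)
Lemma ad_power_string i : ad_power i = 0 \/ exists m (e : int),
  [/\ rd_part R true (c + a *+ i), e = 1 \/ e = -1,
      ad_power i = X (c + a *+ i) *~ (e * 'C(m + i, i)%:Z) &
      forall r, string_depth a (c + a *+ i) r -> r = (m + i)%N].
Proof.
have aD := part_Delta a0; have cD := part_Delta c1.
elim: i => [|i [IH|[m [e [ci e1 Yi mr]]]]].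
- right; rewrite mulr0n addr0.
  (* For i = 0 the binomial is 1 whatever [m] is; if the string had no depth, the last clause would
     be void and any [m] would do. *)
  have [[m hm]|nm] := pselect (exists m, string_depth a c m).
    exists m, 1; split=> //; [by left|by rewrite addn0 bin0 mulr1z|].
    by move=> r hr; rewrite addn0; apply: string_depth_uniq hr hm.
  exists 0%N, 1; split=> //; first by left.
  by move=> r hr; case: nm; exists r.
- by left; rewrite /= IH br0 scaler0.
have ciD := part_Delta ci; rewrite /= Yi brMz.
have ne : a <> - (c + a *+ i).
  by move=> ea; apply: (rf_even_opp rf a0); rewrite ea opprK.
have [h0 h1] := chevalley_add hX aD ciD ne.
have [sD|nD] := pselect (Delta R (a + (c + a *+ i))); last first.
  by left; rewrite h0 // mul0rz scaler0.
have aE : a + (c + a *+ i) = c + a *+ i.+1 by rewrite addrCA -mulrS.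
have [t te [/(_ (or_introl (rf_even_norm rf a0))) [r rd [tr _]] _]] := h1 sD.
have tr1 : pm (Posz r.+1)%:~R t by apply: tr => /(rf_exc rf).
have rE := mr r rd; right; exists m; rewrite te.
have [e' e1' ->] := scale_pm (X (a + (c + a *+ i))) tr1.
exists (e * e'); rewrite -aE; split.
- apply: (root_part_vector hX sD).
  have -> : X (a + (c + a *+ i)) = t^-1 *: br (X a) (X (c + a *+ i)).
    rewrite te scalerA mulVf ?scale1r //.
    by case: tr1 => ->; rewrite ?oppr_eq0 -pmulrn (natK_eq0 hK).
  apply: memvZ; apply: (br_part (root_vector_part hX a0) (root_vector_part hX ci)).
- by case: e1 e1' => -> [] ->; [left|right|right|left].
- rewrite -mulrzA -scaler_int scalerA -scaler_int; congr (_ *: _).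
  have i0 : i.+1%:R != 0 :> K by rewrite (natK_eq0 hK).
  apply: (mulfI i0); rewrite mulVKf //.
  (* As r = m + i, the identity (i + 1) C(m + i + 1, i + 1) = (r + 1) C(m + i, i) absorbs both the
     new constant and the division by i + 1. *)
  have := mul_bin_diag (m + i).+1 i; rewrite /= -addnS => eb.
  have eb' : (i.+1%:Z * 'C(m + i.+1, i.+1)%:Z = r.+1%:Z * 'C(m + i, i)%:Z)%R.
    by rewrite rE -!PoszM -eb addnS.
  rewrite -[i.+1%:R]/((i.+1%:Z)%:~R) -rmorphM /=; congr (_%:~R).
  rewrite [RHS]mulrCA eb'; ring.
have := string_depthS _ rd; rewrite -addrA -mulrSr aE => /(_ _) rd'.
move=> r' hr'; rewrite addnS -rE.
by apply: string_depth_uniq hr' (rd' _); rewrite -aE.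
Qed.

Lemma ad_power_gZ i : gZ true (ad_power i).
Proof.
case: (ad_power_string i) => [->|[m [e [ci _ -> _]]]]; first exact: zspan0.
exact: gZ_X.
Qed.

(** Otherwise all [c + a *+ i] would be roots, pairwise distinct because [rd_ev a] is nonzero in
    characteristic 0, against the finiteness of the root system. *)
Lemma ad_power_nil : exists n, forall i, (n <= i)%N -> ad_power i = 0.
Proof.
have [s [[us sE] _ _] ] : exists s : seq (rd_lat R),
    [/\ enumerates s (Delta R), True & True] by case: hX => -[s [? _ _]]; exists s.
suff [n nz] : exists n, ad_power n = 0.
  exists n => i /subnK <-; elim: (i - n)%N => [|j IH]; first by rewrite add0n.
  by rewrite addSn /= IH br0 scaler0.
apply: contrapT => /forallNP nz.
have := @uniq_leq_size _ [seq c + a *+ i | i <- iota 0 (size s).+1] s.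
rewrite size_map size_iota ltnn => H'; apply: (notF (H' _ _)).
  rewrite map_inj_uniq ?iota_uniq // => i j /addrI.
  have evMn n : rd_ev (a *+ n) = rd_ev a *+ n.
    elim: n => [|n IH]; last by rewrite !mulrS (rf_evD rf) IH.
    by rewrite !mulr0n; apply: (addrI (rd_ev (0 : rd_lat R))); rewrite -(rf_evD rf) !addr0.
  move=> /(congr1 (@rd_ev _ _ _ R)); rewrite !evMn => eij.
  have : (rd_ev a) *~ (Posz i - Posz j) = 0 by rewrite mulrzBr -!pmulrn eij subrr.
  move=> /eqP; rewrite -scaler_int scaler_eq0 (negPf (rf_even_ev rf a0)) orbF intK_eq0 //.
  by rewrite subr_eq0 => /eqP[].
move=> x /mapP[i _ ->]; apply/sE.
by case: (ad_power_string i) => [/nz//|[m [e [ci _ _ _]]]]; apply: part_Delta ci.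
Qed.

End RootString.
Lemma lat_op_divided a n : rd_part R false a -> lat_op b (divided_power (act V (X a)) n).
Proof.
move=> a0; split=> [t u v|v bv]; last by case: b_adm => _ _ /(_ v bv) [+ _ _]; apply.
by rewrite /divided_power (iter_linear n (act_linr _)) scalerDr !scalerA mulrC.
Qed.

Lemma lat_op_gZ p z : gZ p z -> lat_op b (act V z).
Proof.
move: z; apply: zspan_ind.
- split=> [t u v|v _]; rewrite ?act0 ?scaler0 ?addr0 //; exact: zspan0.
- move=> x y ox oy; split; first exact: act_linr.
  by move=> v bv; rewrite actD; apply: zspanD; [apply: ox.2|apply: oy.2].
move=> x z xg; split; first exact: act_linr.
move=> v bv; rewrite actMz; apply: zspanMz.
case: b_adm => _ _ /(_ v bv) [b0 b1 bH].
case: xg => [[_ /tnthP[i ->]]|[c cp ->]].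
  by have := bH i 1%N; rewrite /binomial_power /= mulr0n scale0r subr0 invr1 scale1r.
case: p cp => cp; first exact: b1.
by have := b0 _ 1%N cp; rewrite /divided_power /= invr1 scale1r.
Qed.

Lemma root_gZ p c : rd_part R p c -> gZ p (X c).
Proof. by move=> cp; rewrite -[X c]mulr1z; apply: gZ_X. Qed.

Lemma divided_powerS (e : V -> V) n v : linear e ->
  divided_power e n (e v) = divided_power e n.+1 v *+ n.+1 /\
  e (divided_power e n v) = divided_power e n.+1 v *+ n.+1.
Proof.
move=> le; rewrite /divided_power (linZ le) -iterS -iterSr -scaler_nat scalerA.
suff -> : n.+1%:R / n.+1`!%:R = n`!%:R^-1 :> K by [].
rewrite factS natrM invfM mulrA divff ?mul1r // (natK_eq0 hK) //.
Qed.

Section AdPower.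
Variables (a c : rd_lat R) (a0 : rd_part R false a) (c1 : rd_part R true c).
Notation e := (act V (X a)).
Notation Y := (ad_power a c).

Lemma ad_power_act i v :
  act V (Y i) (e v) = e (act V (Y i) v) - act V (Y i.+1) v *+ i.+1.
Proof.
rewrite (act_evenl _ _ (root_vector_part hX a0)) ad_powerS //.
by rewrite (linMn (act_linl v)) addrC addrA addNr add0r.
Qed.

(* X_c exp(t X_a) = exp(t X_a) (exp(- t ad X_a) X_c), degree by degree in t *)
Lemma ad_power_conj n v : act V (X c) (divided_power e n v) =
  \sum_(i < n.+1) (-1) ^+ i *: divided_power e (n - i) (act V (Y i) v).
Proof.
elim: n v => [|n IH] v.
  by rewrite big_ord1 expr0 scale1r subn0 /divided_power /= invr1 !scale1r.
have le : linear e := act_linr (X a).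
pose T i j : V := divided_power e j (act V (Y i) v).
have n0 : n.+1%:R != 0 :> K by rewrite (natK_eq0 hK).
apply: (scalerI n0); rewrite -(linZ (act_linr _)) {1}scaler_nat.
rewrite -(divided_powerS n v le).1 IH.
have l2 j : linear (divided_power e j).
  by move=> t u w; rewrite /divided_power (iter_linear j le) scalerDr !scalerA mulrC.
rewrite (eq_bigr (fun i : 'I_n.+1 => (-1) ^+ i *: (T i (n - i).+1 *+ (n - i).+1) +
    (-1) ^+ i.+1 *: (T i.+1 (n - i)%N *+ i.+1))); last first.
  move=> i _; rewrite ad_power_act (linB (l2 _)) (linMn (l2 _)) (divided_powerS _ _ le).1.
  by rewrite scalerBr exprS mulN1r scaleNr.
rewrite big_split /= scaler_sumr.
(* After reindexing, the term of index [i] comes from both halves of the sum, with multiplicities n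
   + 1 - i and i, which add up to n + 1. *)
pose f1 i := (-1) ^+ i *: (T i (n.+1 - i)%N *+ (n.+1 - i)).
pose f2 i := (-1) ^+ i *: (T i (n.+1 - i)%N *+ i).
have -> : \sum_(i < n.+1) (-1) ^+ i *: (T i (n - i).+1 *+ (n - i).+1) = \sum_(i < n.+2) f1 i.
  have f1n : f1 n.+1 = 0 by rewrite /f1 subnn mulr0n scaler0.
  rewrite [RHS]big_ord_recr /= f1n addr0.
  by apply: eq_bigr => i _; rewrite /f1 subSn // -ltnS.
have -> : \sum_(i < n.+1) (-1) ^+ i.+1 *: (T i.+1 (n - i)%N *+ i.+1) = \sum_(i < n.+2) f2 i.
  have f20 : f2 0%N = 0 by rewrite /f2 mulr0n scaler0.
  rewrite [RHS]big_ord_recl /= f20 add0r.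
  by apply: eq_bigr => i _; rewrite /f2 /bump /= add1n subSS.
rewrite -big_split; apply: eq_bigr => i _ /=.
rewrite /f1 /f2 -scalerDr -mulrnDr subnK; last by rewrite -ltnS.
by rewrite -[_ *+ n.+1]scaler_nat scalerA mulrC -scalerA.
Qed.

End AdPower.

(** * Matrices over a superalgebra *)

Section Points.
Variables (k : comNzRingType) (A : salg k).
Implicit Types (th ze eta : A) (F M : 'M[A]_d) (tau : rd_lat R -> A).
Implicit Types (s : seq (rd_lat R)).
Notation bc := (basechange_mx A).
Notation G0_set := (G0_set H X b (A := A)).
Notation G_set := (G_set H X b (A := A)).
Notation G1_set := (G1_set X b (A := A)).

(** Because of the row convention this reverses products, so that the bracket formula below has its
    factors exchanged. *)
Definition rho z : 'M[A]_d := bc (lattice_mx b (act V z)).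

Lemma rhoD p q x y : gZ p x -> gZ q y -> rho (x + y) = rho x + rho y.
Proof.
move=> /lat_op_gZ ox /lat_op_gZ oy; rewrite /rho -basechangeD -(lattice_mxD hK b_basis) //.
by congr bc; apply: eq_lattice_mx => v; rewrite actD.
Qed.

Lemma rhoMz p x (z : int) : gZ p x -> rho (x *~ z) = z%:~R *: rho x.
Proof.
move=> /lat_op_gZ ox; rewrite /rho -basechangeZ -(lattice_mxMz hK b_basis) //.
by congr bc; apply: eq_lattice_mx => v; rewrite actMz.
Qed.

Lemma rho0 : rho 0 = 0.
Proof.
rewrite /rho -(basechange0 A d d) -(lattice_mx0 hK b_basis).
by congr bc; apply: eq_lattice_mx => v; rewrite act0.
Qed.

Lemma rho_mul p q x y : gZ p x -> gZ q y ->
  rho x *m rho y = bc (lattice_mx b (fun v => act V y (act V x v))).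
Proof.
move=> /lat_op_gZ ox /lat_op_gZ oy.
by rewrite -basechangeM -(lattice_mx_comp hK b_basis).
Qed.

Lemma rho_br p q x y : gZ p x -> gZ q y ->
  rho (br x y) = rho y *m rho x - psign A p q *: (rho x *m rho y).
Proof.
move=> xg yg; have ox := lat_op_gZ xg; have oy := lat_op_gZ yg.
have oxy := lat_op_comp oy ox; have oyx := lat_op_comp ox oy.
rewrite (rho_mul yg xg) (rho_mul xg yg).
have -> : psign A p q = (psign int p q)%:~R.
  by rewrite /psign; case: (p && q); rewrite ?expr0 ?expr1 ?rmorphN1.
rewrite -scaleNr -rmorphN -basechangeZ -basechangeD -(lattice_mxMz hK b_basis) //.
rewrite -(lattice_mxD hK b_basis) //; last exact: lat_opMz.
congr bc; apply: eq_lattice_mx => v.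
rewrite (act_br v (gZ_part xg) (gZ_part yg)) /psign.
by case: (p && q); rewrite ?expr0 ?expr1 ?opprK ?mulrN1z ?mulr1z ?scaleN1r ?scale1r ?opprK.
Qed.

Section EvenRoot.
Variables (a : rd_lat R) (a0 : rd_part R false a).
Notation e := (act V (X a)).
Notation M n := (lattice_mx b (divided_power e n)).

Lemma divided_power_nil n v : (d <= n)%N -> divided_power e n v = 0.
Proof.
move=> dn; rewrite /divided_power -(subnK dn) iterD.
rewrite (root_nilpotent hK h_even hX V_rat b_basis v (part_Delta a0) (rf_even_ev rf a0)).
by rewrite (lin0 (iter_linear _ (act_linr _))) scaler0.
Qed.

Lemma lattice_mx_divided_nil n : (d <= n)%N -> M n = 0.
Proof.
move=> dn; rewrite -(lattice_mx0 hK b_basis).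
by apply: eq_lattice_mx => v; apply: divided_power_nil.
Qed.

Lemma x_evenE n (t : A) : (d <= n)%N -> x_even X b a t = \sum_(i < n) t ^+ i *: bc (M i).
Proof.
move=> dn; rewrite /x_even /exp_mx.
rewrite (@sum_truncate _ (fun i => t ^+ i *: bc (M i)) d n) // => i di.
by rewrite lattice_mx_divided_nil // basechange0 scaler0.
Qed.

Lemma divided_power_mul i j v :
  divided_power e j (divided_power e i v) = divided_power e (i + j) v *+ 'C(i + j, i).
Proof.
have le : linear e := act_linr (X a).
rewrite /divided_power (linZ (iter_linear j le)) scalerA -iterD addnC -scaler_nat scalerA.
congr (_ *: _); rewrite -(bin_fact (leq_addr j i)) addKn addnC.
have C0 : 'C(i + j, i)%:R != 0 :> K by rewrite (natK_eq0 hK) -lt0n bin_gt0 leq_addr.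
by rewrite !natrM !invfM mulVKf 1?mulrC // addnC.
Qed.

Lemma lattice_mx_divided_mul i j : M i *m M j = 'C(i + j, i)%:Z *: M (i + j).
Proof.
rewrite -(lattice_mx_comp hK b_basis); try exact: lat_op_divided _ _ a0.
rewrite -(lattice_mxMz hK b_basis); last exact: lat_op_divided _ _ a0.
by apply: eq_lattice_mx => v /=; rewrite divided_power_mul pmulrn.
Qed.

(** By the binomial theorem the degree [m] part of the product is (t - t)^m times a divided power,
    so only degree 0 survives. *)
Lemma x_even_inv (t : A) : x_even X b a t *m x_even X b a (- t) = 1%:M.
Proof.
(* The extra unit provides a degree 0 term even when [d] is 0. *)
pose n := (d + d).+1.
rewrite !(x_evenE _ (leqnn d)) mulmx_suml.
pose f i j := (t ^+ i * (- t) ^+ j) *: bc (M i *m M j).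
rewrite (eq_bigr (fun i : 'I_d => \sum_(j < d) f i j)); last first.
  by move=> i _; rewrite mulmx_sumr; apply: eq_bigr => j _; rewrite scale_basechangeM.
rewrite -(@sum_diagonals _ f d d n) //; first last.
- by move=> i j dj; rewrite /f (lattice_mx_divided_nil dj) mulmx0 basechange0 scaler0.
- by move=> i j di; rewrite /f (lattice_mx_divided_nil di) mul0mx basechange0 scaler0.
rewrite (eq_bigr (fun m : 'I_n => ((t - t) ^+ m) *: bc (M m))); last first.
  move=> m _; rewrite exprDn_comm; last by rewrite /GRing.comm mulrN mulNr.
  rewrite scaler_suml [RHS](reindex_inj rev_ord_inj) /=.
  apply: eq_bigr => i _; rewrite /f.
  have im : (i <= m)%N by rewrite -ltnS.
  rewrite subSS subKn // bin_sub // lattice_mx_divided_mul subnKC //.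
  by rewrite basechangeZ scalerA mulr_natr.
rewrite big_ord_recl expr0 scale1r big1 => [|i _]; last by rewrite subrr expr0n scale0r.
rewrite addr0 -(basechange1 A) -(lattice_mx_id hK b_basis); congr bc.
by apply: eq_lattice_mx => v; rewrite /divided_power /= invr1 scale1r.
Qed.

Lemma x_even_even (t : A) i j : sa_part A false t -> sa_part A false (x_even X b a t i j).
Proof.
move=> t0; rewrite /x_even /exp_mx summxE; apply: part_sum => n _.
rewrite !mxE; apply: (partM (a := false) (a' := false)); [exact: part_evenX|exact: part_int].
Qed.

Lemma x_even_square0 (t : A) : t * t = 0 -> x_even X b a t = 1%:M + t *: rho (X a).
Proof.
move=> t2; rewrite (@x_evenE d.+2) //; last by rewrite -addn2 leq_addr.
rewrite 2!big_ord_recl big1 ?addr0 => [|i _]; last first.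
  by rewrite /bump /= !exprS mulrA t2 mul0r scale0r.
rewrite expr0 scale1r /bump /= expr1; congr (_ + _ *: _).
  rewrite -(basechange1 A) -(lattice_mx_id hK b_basis); congr bc.
  by apply: eq_lattice_mx => v; rewrite /divided_power /= invr1 scale1r.
by congr bc; apply: eq_lattice_mx => v; rewrite /divided_power /= invr1 scale1r.
Qed.

Variables (c : rd_lat R) (c1 : rd_part R true c).

(** The sum of [ad_power_conj] over all degrees in [t]. The number [n] of terms comes from the end
    of the root string and does not depend on [t]. *)
Lemma ad_exp_conj : exists n, forall t : A, x_even X b a t *m rho (X c) =
  (\sum_(i < n) (- t) ^+ i *: rho (ad_power a c i)) *m x_even X b a t.
Proof.
have [n Yn] := ad_power_nil a0 c1; exists n => t.
pose N i := lattice_mx b (act V (ad_power a c i)).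
have Yop i : lat_op b (act V (ad_power a c i)).
  exact: (lat_op_gZ (ad_power_gZ a0 c1 i)).
pose f i j := ((- t) ^+ i * t ^+ j) *: bc (N i *m M j).
rewrite [in LHS](x_evenE t (leq_addl n d)) mulmx_suml.
rewrite [in RHS](x_evenE t (leqnn d)) mulmx_suml.
rewrite [RHS](eq_bigr (fun i : 'I_n => \sum_(j < d) f i j)); last first.
  by move=> i _; rewrite mulmx_sumr; apply: eq_bigr => j _; rewrite scale_basechangeM.
rewrite -(@sum_diagonals _ f n d (n + d)) //; first last.
- by move=> i j dj; rewrite /f (lattice_mx_divided_nil dj) mulmx0 basechange0 scaler0.
- move=> i j ni; rewrite /f /N Yn //.
  have -> : lattice_mx b (act V (0 : g)) = 0.
    by rewrite -(lattice_mx0 hK b_basis); apply: eq_lattice_mx => v; rewrite act0.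
  by rewrite mul0mx basechange0 scaler0.
apply: eq_bigr => m _; rewrite -scalemxAl -basechangeM.
rewrite -(lattice_mx_comp hK b_basis); first last.
- exact: (lat_op_gZ (root_gZ c1)).
- exact: lat_op_divided _ _ a0.
pose F i v := divided_power e (m - i) (act V (ad_power a c i) v) *~ (-1) ^+ i.
have Fop i : lat_op b (F i).
  by apply: lat_opMz; apply: lat_op_comp (Yop i) (lat_op_divided _ a0).
rewrite (@eq_lattice_mx _ _ _ _ b _ (fun v => \sum_(i < m.+1) F i v)); last first.
  move=> v /=; rewrite (ad_power_conj c a0); apply: eq_bigr => i _.
  by rewrite /F -scaler_int rmorphXn /= rmorphN1.
rewrite (lattice_mx_sum hK b_basis); last by move=> i; apply: Fop.
rewrite basechange_sum scaler_sumr; apply: eq_bigr => i _.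
rewrite /F (lattice_mxMz hK b_basis); last first.
  exact: lat_op_comp (Yop i) (lat_op_divided _ a0).
rewrite (lattice_mx_comp hK b_basis (Yop i)); last exact: lat_op_divided _ _ a0.
rewrite basechangeZ scalerA /f; congr (_ *: _).
have im : (i <= m)%N by rewrite -ltnS.
by rewrite -intr_comm rmorphXn /= rmorphN1 exprNn -mulrA -exprD subnKC.
Qed.

End EvenRoot.

(** * Independence of the odd root vectors modulo a subgroup *)

Section Independence.
Variable J : set A.
Hypotheses (J0 : J 0) (J_sub : forall x y : A, J x -> J y -> J (x - y)).
Hypothesis J_sat : forall x : A, J (x *+ 2) -> J x.

Definition mxin m n (M : 'M[A]_(m, n)) := forall i j, J (M i j).

Lemma mxin_mull m n q (N : 'M[int]_(m, n)) (M : 'M_(n, q)) : mxin M -> mxin (bc N *m M).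
Proof.
move=> JM i j; rewrite mxE; apply: subgroup_sum => // l' _.
by rewrite mxE mulrzl; apply: subgroupMz.
Qed.

Lemma mxin_mulr m n q (M : 'M_(m, n)) (N : 'M[int]_(n, q)) : mxin M -> mxin (M *m bc N).
Proof.
move=> JM i j; rewrite mxE; apply: subgroup_sum => // l' _.
by rewrite mxE mulrzr; apply: subgroupMz.
Qed.

Lemma mxinD m n (M N : 'M_(m, n)) : mxin M -> mxin N -> mxin (M + N).
Proof. by move=> JM JN i j; rewrite mxE; apply: subgroupD. Qed.

Lemma mxinN m n (M : 'M_(m, n)) : mxin M -> mxin (- M).
Proof. by move=> JM i j; rewrite mxE; apply: subgroupN. Qed.

(** Sandwiching the sum between the projectors at [mu] and [mu + rd_ev c] keeps only the term of
    [c], because odd roots are determined by their restriction to [h]. Summing over the weights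
    recovers that term. *)
Lemma independence_root (s : seq (rd_lat R)) (eta : rd_lat R -> A) c :
  uniq s -> (forall c', c' \in s -> rd_part R true c') -> c \in s ->
  mxin (\sum_(c' <- s) eta c' *: rho (X c')) -> mxin (eta c *: rho (X c)).
Proof.
move=> us s1 cs JS; have [ws [uws wsw wsum]] := weight_list hK H_basis V_rat b_basis bin_stable.
have c1 := s1 c cs; have Xop c' : c' \in s -> lat_op b (act V (X c')).
  by move=> /s1 c'1; apply: (lat_op_gZ (root_gZ c'1)).
have key mu : mu \in ws -> mxin (eta c *: bc (lattice_mx b (act V (X c) \o wp mu))).
  move=> /wsw muw; have mui := weight_intweight V_rat muw.
  have nui : intweight H (mu + rd_ev c).
    move=> i; have [z ez] := mui i.
    have [z' ez'] := root_int h_even hX V_faithful V_rat i (part_Delta c1).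
    exists (z + z'); rewrite /pairing lfunE /= rmorphD /=.
    by move: ez ez'; rewrite /rpair /pairing => -> ->.
  have comp3 c' : c' \in s -> bc (lattice_mx b (wp mu)) *m (eta c' *: rho (X c')) *m
      bc (lattice_mx b (wp (mu + rd_ev c))) =
      eta c' *: bc (lattice_mx b (wp (mu + rd_ev c) \o (act V (X c') \o wp mu))).
    move=> c's; rewrite basechange_scale -scalemxAl -!basechangeM.
    rewrite (lattice_mx_comp hK b_basis (lat_op_comp (wp_op mu) (Xop _ c's)) (wp_op _)).
    by rewrite (lattice_mx_comp hK b_basis (wp_op mu) (Xop _ c's)).
  have := mxin_mulr (lattice_mx b (wp (mu + rd_ev c)))
    (mxin_mull (lattice_mx b (wp mu)) JS).
  rewrite mulmx_sumr mulmx_suml (bigD1_seq c) //= big_seq_cond big1 => [|c' /andP[c's ne]].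
    rewrite addr0 (comp3 c cs).
    congr mxin; congr (_ *: bc _); apply: eq_lattice_mx.
    apply: (weight_ext V_rat) => [||nu v nv].
    - by case: (lat_op_comp (lat_op_comp (wp_op mu) (Xop _ cs)) (wp_op (mu + rd_ev c))).
    - by case: (lat_op_comp (wp_op mu) (Xop _ cs)).
    rewrite /= (wprojE hK H_basis V_rat b_basis bin_stable mui nv).
    rewrite (linZ (act_linr (X c))) (linZ (wp_op _).1).
    rewrite (wprojE hK H_basis V_rat b_basis bin_stable nui (root_shift h_even hX (part_Delta c1) nv)).
    rewrite (inj_eq (addIr _)); case: eqP => _; rewrite ?scale0r // !scale1r //.
  rewrite (comp3 c' c's).
  rewrite (@eq_lattice_mx _ _ _ _ b _ (fun=> 0)).
    by rewrite (lattice_mx0 hK b_basis) basechange0 scaler0.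
  apply: (weight_ext V_rat) => [||nu v nv].
  - by case: (lat_op_comp (lat_op_comp (wp_op mu) (Xop _ c's)) (wp_op (mu + rd_ev c))).
  - by move=> t u w; rewrite scaler0 addr0.
  rewrite /= (wprojE hK H_basis V_rat b_basis bin_stable mui nv).
  rewrite (linZ (act_linr (X c'))) (linZ (wp_op _).1).
  rewrite (wprojE hK H_basis V_rat b_basis bin_stable nui (root_shift h_even hX (part_Delta (s1 _ c's)) nv)).
  have [->|_] := eqVneq nu mu; last by rewrite scale0r.
  rewrite scale1r (inj_eq (addrI _)); case: eqP => [e|_]; last by rewrite scale0r.
  by move/eqP: ne => []; apply: (rf_odd_inj rf (s1 _ c's) c1 e).
have -> : eta c *: rho (X c) =
    \sum_(mu <- ws) eta c *: bc (lattice_mx b (act V (X c) \o wp mu)).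
  rewrite -scaler_sumr -basechange_sum -(lattice_mx_sum hK b_basis); last first.
    by move=> mu; apply: lat_op_comp (wp_op _) (Xop _ cs).
  congr (_ *: bc _); apply: eq_lattice_mx => v /=.
  by rewrite -(lin_sum (act_linr (X c))) -wsum.
rewrite big_seq; apply: (big_ind (fun M => mxin M)) => [i j|M N|mu /key //].
  by rewrite mxE.
exact: mxinD.
Qed.

Lemma coroot_mul p (z : g) mu (n : int) : gZ p z -> is_weight V mu ->
  z \in h -> pairing mu z = n%:~R ->
  lattice_mx b (wp mu) *m lattice_mx b (act V z) = n *: lattice_mx b (wp mu).
Proof.
move=> zg muw zh ez; have oz := lat_op_gZ zg.
rewrite -(lattice_mx_comp hK b_basis (wp_op mu) oz) -(lattice_mxMz hK b_basis n (wp_op mu)).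
have mui := weight_intweight V_rat muw.
apply: eq_lattice_mx; apply: (weight_ext V_rat) => [||nu v nv].
- by case: (lat_op_comp (wp_op mu) oz).
- by case: (lat_opMz n (wp_op mu)).
rewrite /= (wprojE hK H_basis V_rat b_basis bin_stable mui nv) (linZ (act_linr z)) (nv z zh).
have [->|_] := eqVneq nu mu; last by rewrite !scale0r mul0rz.
by rewrite !scale1r ez scaler_int.
Qed.

Lemma pairing_coroot_int mu c : Delta R c -> Delta R (- c) -> is_weight V mu ->
  exists n : int, pairing mu (rd_coroot c) = n%:~R.
Proof.
move=> cD ncD muw; apply: (pairing_zspan_int hX); last by apply: (coroot_zspan hX).
exact: (weight_intweight V_rat muw).
Qed.

Lemma wproj_neq0 mu : is_weight V mu -> lattice_mx b (wp mu) != 0.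
Proof.
move=> muw; have [v v0 mv] := muw; have mui := weight_intweight V_rat muw.
apply: contra v0 => /eqP M0.
have wp0 w : lattice b w -> wp mu w = 0.
  move=> bw; apply: (lattice_coord_inj hK b_basis (proj2 (wp_op mu) w bw) (zspan0 _)).
  by rewrite (lattice_coord_op hK b_basis (wp_op mu) bw) M0 mulmx0 (lattice_coord0 hK b_basis).
have -> : v = wp mu v.
  by rewrite (wprojE hK H_basis V_rat b_basis bin_stable mui mv) eqxx scale1r.
rewrite (coord_sum b_basis v) (lin_sum (wp_op mu).1) big1 // => i _.
by rewrite (linZ (wp_op mu).1) wp0 ?scaler0 //; apply: lattice_tnth.
Qed.

(** With E the projector at [mu], E times the matrix of H_c is n E. So [eta *~ n] times each entry
    of an idempotent integer matrix lies in [J], and [idempotent_content] applies. *)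
Lemma weight_coroot_in c eta mu (n : int) : Delta R c -> Delta R (- c) ->
  mxin (eta *: rho (rd_coroot c)) -> is_weight V mu ->
  pairing mu (rd_coroot c) = n%:~R -> J (eta *~ n).
Proof.
move=> cD ncD Jeta muw en; have mui := weight_intweight V_rat muw.
have zg := gZ_H (coroot_zspan hX cD ncD).
apply: (idempotent_content J0 J_sub (E := lattice_mx b (wp mu))).
- rewrite -(lattice_mx_comp hK b_basis (wp_op mu) (wp_op mu)).
  apply: eq_lattice_mx; apply: (weight_ext V_rat) => [||nu v nv].
  + by case: (lat_op_comp (wp_op mu) (wp_op mu)).
  + by case: (wp_op mu).
  rewrite /= (wprojE hK H_basis V_rat b_basis bin_stable mui nv) (linZ (wp_op mu).1).
  rewrite (wprojE hK H_basis V_rat b_basis bin_stable mui nv) scalerA.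
  by case: (_ == _); rewrite ?mul1r ?mul0r.
- exact: wproj_neq0.
have := mxin_mull (lattice_mx b (wp mu)) Jeta.
rewrite basechange_scale -basechangeM.
rewrite (coroot_mul zg muw (coroot_h hX cD ncD) en) => JE i j.
have := JE i j; rewrite !mxE mulrzr mulrzA.
by rewrite -mulrzA mulrC mulrzA.
Qed.

(** Bracketing with X_{-c} turns eta X_c into eta H_c up to sign. Then eta times each weight value
    at H_c is in [J], hence eta times each root value, as a difference of two of these; the given
    combination of root values is 1 or 2. *)
Lemma primitive_in c eta : primitive_root c -> mxin (eta *: rho (X c)) -> J eta.
Proof.
move=> [c1 ncD [m [mD mE]]] Jeta; have cD := part_Delta c1.
have nc1 : rd_part R true (- c).
  case: (Delta_part ncD) => -[] // nc0; case: (rf_even_opp rf nc0).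
  by rewrite opprK.
have Jcor : mxin (eta *: rho (rd_coroot c)).
  have e : rho (rd_coroot c) = rho (br (X c) (X (- c))) \/
      rho (rd_coroot c) = - rho (br (X c) (X (- c))).
    rewrite (chevalley_opp hX cD ncD) /chevalley_sign; case: asboolP => _; [right|left].
      rewrite scaleN1r -[- rd_coroot c]mulrN1z (rhoMz _ (gZ_H (coroot_zspan hX cD ncD))).
      by rewrite rmorphN1 scaleN1r opprK.
    by rewrite scale1r.
  have Jbr : mxin (eta *: rho (br (X c) (X (- c)))).
    rewrite (rho_br (root_gZ c1) (root_gZ nc1)) /psign expr1.
    rewrite scaleN1r opprK scalerDr; apply: mxinD.
      by rewrite -basechange_scale; apply: mxin_mull.
    by rewrite scalemxAl; apply: mxin_mulr.
  by case: e => ->; rewrite ?scalerN //; apply: mxinN.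
have Jroot c' : Delta R c' -> exists2 n : int, rpair c' (rd_coroot c) = n%:~R & J (eta *~ n).
  move=> c'D; have [mu [v [v0 mv nz]]] := root_act_neq0 hX V_faithful V_rat c'D.
  have muw : is_weight V mu by exists v.
  have nuw : is_weight V (mu + rd_ev c').
    by exists (act V (X c') v) => //; exact: (root_shift h_even hX c'D mv).
  have [n en] := pairing_coroot_int cD ncD muw.
  have [n' en'] := pairing_coroot_int cD ncD nuw.
  exists (n' - n).
    by rewrite rmorphB /= -en -en' {1}/pairing lfunE /= addrC addKr.
  rewrite mulrzBr; apply: J_sub; first exact: (weight_coroot_in cD ncD Jcor nuw en').
  exact: (weight_coroot_in cD ncD Jcor muw en).
have [z ez Jz] : exists2 z : int, combination m (rd_coroot c) = z%:~R & J (eta *~ z).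
  rewrite /combination; elim: m mD {mE} => [|q m IH] mD.
    by exists 0; rewrite ?big_nil ?mulr0z.
  have [z ez Jz] : exists2 z : int, \sum_(p <- m) rpair p.1 (rd_coroot c) *~ p.2 = z%:~R & J (eta *~ z).
    by apply: IH => q' q'm; apply: mD; rewrite in_cons q'm orbT.
  have [n en Jn] := Jroot q.1 (mD q (mem_head _ _)).
  exists (n * q.2 + z); first by rewrite big_cons ez en rmorphD /= rmorphM /= mulrzr.
  by rewrite mulrzDr mulrzA; apply: subgroupD => //; apply: subgroupMz.
case: mE => e.
  by move: Jz; have -> : z = 1 by apply: (intK_inj hK); rewrite /= -ez e.
apply: J_sat; move: Jz.
by have -> : z = 2 by apply: (intK_inj hK); rewrite /= -ez e.
Qed.

(** A root that is not primitive is first moved by an even root vector to a primitive one, at the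
    cost of a sign only. *)
Lemma independence (s : seq (rd_lat R)) (eta : rd_lat R -> A) :
  uniq s -> (forall c, c \in s -> rd_part R true c) ->
  mxin (\sum_(c <- s) eta c *: rho (X c)) -> forall c, c \in s -> J (eta c).
Proof.
move=> us s1 JS c cs; have Jc := independence_root us s1 cs JS.
have c1 := s1 c cs.
case: (rf_primitive rf c1) => [pc|[a [c' [a0 pc' e]]]]; first exact: primitive_in pc Jc.
apply: (primitive_in pc'); have [c'1 _ _] := pc'.
have Jbr : mxin (eta c *: rho (br (X a) (X c))).
  rewrite (rho_br (root_gZ a0) (root_gZ c1)) /psign expr0.
  rewrite scale1r scalerBr; apply: mxinD; last apply: mxinN.
    by rewrite scalemxAl; apply: mxin_mulr.
  by rewrite -basechange_scale; apply: mxin_mull.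
case: e Jbr => -> //; rewrite -mulrN1z (rhoMz _ (root_gZ c'1)).
by rewrite rmorphN1 scaleN1r scalerN => /mxinN; rewrite opprK.
Qed.

End Independence.

(** * Elementary factors and their commutators *)

Definition letter ze z : 'M[A]_d := 1%:M + ze *: rho z.

Lemma letter0 ze : letter ze 0 = 1%:M.
Proof. by rewrite /letter (rho0) scaler0 addr0. Qed.

Lemma letter0l z : letter 0 z = 1%:M.
Proof. by rewrite /letter scale0r addr0. Qed.

Lemma letterMz p ze z (n : int) : gZ p z -> letter ze (z *~ n) = letter (ze *~ n) z.
Proof. by move=> zg; rewrite /letter (rhoMz n zg) scalerA mulrzr. Qed.

Lemma letter_mul ze ze' z z' : letter ze z *m letter ze' z' =
  1%:M + ze *: rho z + ze' *: rho z' + (ze * ze') *: (rho z *m rho z').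
Proof.
rewrite /letter mulmxDl !mulmxDr !mul1mx mulmx1 -scalemxAl basechange_scale scalerA.
by rewrite -!addrA; congr (_ + _); rewrite addrCA.
Qed.

Lemma letterD p ze z z' : gZ p z -> gZ p z' -> ze * ze = 0 ->
  letter ze (z + z') = letter ze z *m letter ze z'.
Proof.
move=> zg zg' e; rewrite letter_mul e scale0r addr0 -addrA -scalerDr.
by rewrite /letter (rhoD zg zg').
Qed.

(** As [ze] squares to zero, sums in [z] become products, so a letter factors into letters of
    generators of the integral form. *)
Lemma letter_gen p ze z (Q : 'M[A]_d -> Prop) : ze * ze = 0 -> gZ p z -> Q 1%:M ->
  (forall F F', Q F -> Q F' -> Q (F *m F')) ->
  (forall x (n : int), gZ_gen p x -> Q (letter (ze *~ n) x)) -> Q (letter ze z).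
Proof.
move=> ze2 zg Q1 QM Qx; suff [] : gZ p z /\ Q (letter ze z) by [].
move: z zg; apply: zspan_ind.
- by split; [apply: zspan0|rewrite letter0].
- move=> x y [xg Qz] [yg Qy]; split; first exact: zspanD.
  by rewrite (letterD xg yg ze2); apply: QM.
move=> x n xg; have xg' : gZ p x by apply: zspan_mem.
by split; [apply: zspanMz|rewrite (letterMz _ _ xg'); apply: Qx].
Qed.

Lemma letterDl ze ze' z : ze * ze' = 0 ->
  letter (ze + ze') z = letter ze z *m letter ze' z.
Proof. by move=> e; rewrite letter_mul e scale0r addr0 -addrA -scalerDl. Qed.

Lemma letter_inv ze z : ze * ze = 0 ->
  letter ze z *m letter (- ze) z = 1%:M /\ letter (- ze) z *m letter ze z = 1%:M.
Proof.
move=> e; rewrite -!letterDl ?mulrN ?mulNr ?e ?oppr0 //.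
by rewrite subrr addNr letter0l.
Qed.

(** Exchanging the two parameters costs the sign that the superbracket carries, so the matrix
    commutator is [th * ze] times a superbracket. The vanishing products needed for
    [square_zero_swap] each contain one of the parameters twice. *)
Lemma letter_swap c th p ze z : rd_part R true c -> sa_part A true th ->
  sa_part A p ze -> ze * ze = 0 -> gZ p z ->
  letter th (X c) *m letter ze z =
  letter (th * ze) (br z (X c)) *m (letter ze z *m letter th (X c)).
Proof.
move=> c1 th1 zep ze2 zg; have th2 := odd_sqr0 th1.
have cg := root_gZ c1.
have comm : ze * th = psign A p true * (th * ze) := sa_comm zep th1.
have sgn (y : A) : psign A p true * y = y * psign A p true.
  by rewrite /psign; case: (_ && _); rewrite ?expr0 ?expr1 ?mul1r ?mulr1 ?mulN1r ?mulrN1.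
set u := th *: rho (X c); set v := ze *: rho z.
have uv : u *m v = (th * ze) *: (rho (X c) *m rho z) by rewrite -scalemxAl basechange_scale scalerA.
have vu : v *m u = (ze * th) *: (rho z *m rho (X c)) by rewrite -scalemxAl basechange_scale scalerA.
have e : (th * ze) *: rho (br z (X c)) = u *m v - v *m u.
  rewrite (rho_br zg cg) scalerBr uv vu scalerA comm.
  by rewrite sgn.
rewrite /letter e -/u -/v.
apply: (@square_zero_swap ('M[A]_d : pzRingType)).
- by rewrite -[u * u]/(u *m u) -scalemxAl basechange_scale scalerA th2 scale0r.
- by rewrite -[v * v]/(v *m v) -scalemxAl basechange_scale scalerA ze2 scale0r.
- rewrite -[u * v * u]/(u *m v *m u) uv -scalemxAl -mulmxA !basechange_scale scalerA.
  by rewrite -mulrA comm !mulrA -sgn -!mulrA (mulrA th) th2 mul0r mulr0 scale0r.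
- rewrite -[v * u * v]/(v *m u *m v) vu -scalemxAl -mulmxA !basechange_scale scalerA.
  by rewrite comm -!mulrA ze2 !mulr0 scale0r.
Qed.

Lemma mul_square0 th p ze : sa_part A true th -> sa_part A p ze -> ze * ze = 0 ->
  (th * ze) * (th * ze) = 0.
Proof.
move=> th1 zep ze2; rewrite mulrA -(mulrA th) (sa_comm zep th1) /psign.
case: (p && true); rewrite ?expr0 ?expr1 ?mul1r ?mulN1r ?mulrN ?mulNr -!mulrA ze2 ?mulr0 ?oppr0 //.
Qed.

Definition prodw (w : seq (rd_lat R * A)) : 'M[A]_d :=
  foldr (fun q F => letter q.2 (X q.1) *m F) 1%:M w.

Definition odd_word (w : seq (rd_lat R * A)) : Prop :=
  forall q, q \in w -> rd_part R true q.1 /\ sa_part A true q.2.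

Lemma prodw_cat w w' : prodw (w ++ w') = prodw w *m prodw w'.
Proof. by elim: w => [|q w IH] /=; rewrite ?mul1mx // IH mulmxA. Qed.

Lemma odd_word_cons q w : odd_word (q :: w) ->
  (rd_part R true q.1 /\ sa_part A true q.2) /\ odd_word w.
Proof.
move=> ow; split; first by apply: ow; rewrite mem_head.
by move=> r rw; apply: ow; rewrite in_cons rw orbT.
Qed.

Lemma odd_word_cat w w' : odd_word w -> odd_word w' -> odd_word (w ++ w').
Proof. by move=> ow ow' q; rewrite mem_cat => /orP[/ow|/ow']. Qed.

Lemma prodw_inv w : odd_word w -> exists w', [/\ odd_word w',
  prodw w *m prodw w' = 1%:M & prodw w' *m prodw w = 1%:M].
Proof.
elim: w => [|q w IH] ow; first by exists [::]; rewrite /= !mulmx1.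
have [[q1 q2] /IH[w' [ow' e e']]] := odd_word_cons ow.
have [f f'] := letter_inv (X q.1) (odd_sqr0 q2).
exists (w' ++ [:: (q.1, - q.2)]); split.
- by apply: odd_word_cat => // r; rewrite inE => /eqP ->; split=> //; apply: partN.
- by rewrite prodw_cat /= mulmx1 mulmxA -(mulmxA (letter _ _)) e mulmx1.
- by rewrite prodw_cat /= mulmx1 mulmxA -(mulmxA (prodw w')) f' mulmx1.
Qed.

Definition ordered (s : seq (rd_lat R)) tau : 'M[A]_d :=
  prodw [seq (c, tau c) | c <- s].

(** The reversal reconciles [compmx], used by [odd_product], with the matrix product used by
    [prodw]. *)
Lemma odd_productE s tau : odd_product X b s tau = ordered (rev s) tau.
Proof.
elim: s => [|c s IH] //=.
by rewrite IH /ordered rev_cons -cats1 map_cat prodw_cat /= mulmx1.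
Qed.

Lemma eq_ordered s tau tau' : {in s, tau =1 tau'} -> ordered s tau = ordered s tau'.
Proof.
move=> e; rewrite /ordered; congr prodw; apply/eq_in_map => c cs.
by rewrite e.
Qed.

Lemma ordered_word s tau : (forall c, c \in s -> rd_part R true c) ->
  (forall c, sa_part A true (tau c)) -> odd_word [seq (c, tau c) | c <- s].
Proof. by move=> s1 tau1 q /mapP[c cs ->]; split; [apply: s1|apply: tau1]. Qed.

(** * Sorting the odd factors *)

Section Sorting.
Variables (J : nat -> set A) (J_fil : filtration J).
Variables (s : seq (rd_lat R)) (s_uniq : uniq s).
Hypothesis s_odd : forall c, c \in s <-> rd_part R true c.
Variable G0 : 'M[A]_d -> Prop.
Hypotheses (G0_1 : G0 1%:M) (G0_mul : forall F F', G0 F -> G0 F' -> G0 (F *m F')).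
Hypothesis G0_letter : forall ze z, sa_part A false ze -> ze * ze = 0 -> gZ false z ->
  G0 (letter ze z).

Lemma fil_le p q ze : (p <= q)%N -> J q ze -> J p ze.
Proof. by move=> /subnK <-; elim: (q - p)%N => // n IH /(filW J_fil)/IH. Qed.

Lemma fil_Mz q ze (n : int) : J q ze -> J q (ze *~ n).
Proof.
exact: subgroupMz (fil_zero J_fil q) (fil_sub J_fil (q := q)) ze n.
Qed.

Lemma fil_mul1 q th ze : J 1 th -> J q ze -> J q.+1 (th * ze).
Proof. by move=> h1 h2; have := filM J_fil h1 h2. Qed.

Inductive congruence_mod (q : nat) : 'M[A]_d -> Prop :=
| congruence_one : congruence_mod q 1%:M
| congruence_mul p ze z F : J q ze -> sa_part A p ze -> ze * ze = 0 -> gZ p z ->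
    congruence_mod q F -> congruence_mod q (letter ze z *m F).

Lemma congruenceM q F F' :
  congruence_mod q F -> congruence_mod q F' -> congruence_mod q (F *m F').
Proof.
move=> cF cF'; elim: cF => [|p ze z F1 h1 h2 h3 h4 _ IH]; first by rewrite mul1mx.
by rewrite -mulmxA; apply: (congruence_mul h1 h2 h3 h4).
Qed.

Lemma congruence_letter q p ze z : J q ze -> sa_part A p ze -> ze * ze = 0 -> gZ p z ->
  congruence_mod q (letter ze z).
Proof.
move=> h1 h2 h3 h4; rewrite -[letter ze z]mulmx1.
exact: congruence_mul h1 h2 h3 h4 (congruence_one q).
Qed.

Lemma congruence_le p q F : (p <= q)%N -> congruence_mod q F -> congruence_mod p F.
Proof.
move=> pq; elim=> [|r ze z F1 h1 h2 h3 h4 _ IH]; first exact: congruence_one.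
exact: congruence_mul (fil_le pq h1) h2 h3 h4 IH.
Qed.

Lemma swap_letter q c th p ze z : rd_part R true c -> sa_part A true th -> J 1 th ->
  J q ze -> sa_part A p ze -> ze * ze = 0 -> gZ p z ->
  exists F, [/\ congruence_mod q.+1 F,
    letter th (X c) *m letter ze z = F *m (letter ze z *m letter th (X c)) &
    exists2 F', congruence_mod q.+1 F' &
      letter ze z *m letter th (X c) = F' *m (letter th (X c) *m letter ze z)].
Proof.
move=> c1 th1 thJ zeJ zep ze2 zg; have e := letter_swap c1 th1 zep ze2 zg.
have sq := mul_square0 th1 zep ze2.
have bg := br_gZ_odd c1 zg.
have tzp : sa_part A (~~ p) (th * ze) by have := partM th1 zep.
have tzJ := fil_mul1 thJ zeJ.
exists (letter (th * ze) (br z (X c))); split=> //.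
  exact: congruence_letter tzJ tzp sq bg.
exists (letter (- (th * ze)) (br z (X c))).
  apply: congruence_letter bg; [|exact: partN|by rewrite mulrNN].
  by apply: (subgroupN (fil_zero J_fil _) (fil_sub J_fil (q := q.+1))).
by rewrite e mulmxA (letter_inv _ sq).2 mul1mx.
Qed.

(** Crossing a letter with parameter in [J 1] produces only corrections of higher level, so the
    level [q] is not lost. *)
Lemma congruence_conj q c th F : rd_part R true c -> sa_part A true th -> J 1 th ->
  congruence_mod q F -> exists2 F', congruence_mod q F' &
    letter th (X c) *m F = F' *m letter th (X c).
Proof.
move=> c1 th1 thJ; elim=> [|p ze z F1 h1 h2 h3 h4 _ [F2 cF2 e]].
  by exists 1%:M; [apply: congruence_one|rewrite mulmx1 mul1mx].
have [C [cC e' _]] := swap_letter c1 th1 thJ h1 h2 h3 h4.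
exists (C *m (letter ze z *m F2)).
  apply: congruenceM; first exact: congruence_le (leqnSn q) cC.
  exact: congruence_mul h1 h2 h3 h4 cF2.
by rewrite mulmxA e' -!mulmxA e.
Qed.

Definition small_word w : Prop := odd_word w /\ forall q, q \in w -> J 1 q.2.

Lemma small_word_cons q w : small_word (q :: w) ->
  [/\ rd_part R true q.1, sa_part A true q.2, J 1 q.2 & small_word w].
Proof.
move=> [ow sw]; have [[q1 q2] ow'] := odd_word_cons ow; split=> //.
  by apply: sw; rewrite mem_head.
by split=> // r rw; apply: sw; rewrite in_cons rw orbT.
Qed.

(** Serves to carry an even letter through the whole ordered product, to be absorbed in [G0] on its
    right. *)
Lemma letter_word q p ze z w : small_word w -> J q ze -> sa_part A p ze ->
  ze * ze = 0 -> gZ p z -> exists2 F, congruence_mod q.+1 F &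
    letter ze z *m prodw w = F *m (prodw w *m letter ze z).
Proof.
move=> + h1 h2 h3 h4; elim: w => [|r w IH] sw /=.
  by exists 1%:M; [apply: congruence_one|rewrite !mul1mx mulmx1].
have [r1 r2 r3 sw'] := small_word_cons sw.
have [F cF e] := IH sw'.
have [_ [_ _ [C cC eC]]] := swap_letter r1 r2 r3 h1 h2 h3 h4.
have [F2 cF2 e2] := congruence_conj r1 r2 r3 cF.
exists (C *m F2); first exact: congruenceM.
by rewrite mulmxA eC -!mulmxA e (mulmxA (letter _ _) F) e2 -!mulmxA.
Qed.

(** The excess term is [ze * th] times the square of X_c, which by [odd_square] is an even element
    of the integral form; it becomes a letter of level [q.+1]. *)
Lemma merge_letters q c ze th : rd_part R true c -> sa_part A true ze -> sa_part A true th ->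
  J q ze -> J 1 th -> exists2 F, congruence_mod q.+1 F &
    letter ze (X c) *m letter th (X c) = F *m letter (ze + th) (X c).
Proof.
move=> c1 ze1 th1 zeJ thJ.
have ztp : sa_part A false (ze * th) by exact: (partM ze1 th1).
have ztJ : J q.+1 (ze * th) by have := filM J_fil zeJ thJ; rewrite addn1.
have zt2 : ze * th * (ze * th) = 0 := mul_square0 ze1 th1 (odd_sqr0 th1).
have [z zg zE] : exists2 z, gZ false z & rho (X c) *m rho (X c) = rho z.
  rewrite (rho_mul (root_gZ c1) (root_gZ c1)).
  have [c' [m [c'0 _ e]]] := odd_square c1.
  exists (X c' *~ m).
    have [->|/c'0] := eqVneq m 0; first by rewrite mulr0z; apply: zspan0.
    exact: gZ_X.
  by congr bc; apply: eq_lattice_mx => v; rewrite e actMz.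
exists (letter (ze * th) z); first exact: congruence_letter ztJ ztp zt2 zg.
rewrite !letter_mul zE; have -> : ze * th * (ze + th) = 0.
  rewrite mulrDr -!mulrA (odd_sqr0 th1) mulr0 addr0 (odd_anticomm th1 ze1).
  by rewrite mulrN mulrA (odd_sqr0 ze1) mul0r oppr0.
by rewrite scale0r addr0 scalerDl addrA [LHS]addrAC [X in X + _ = _]addrAC.
Qed.

Definition small_fun tau := forall c, sa_part A true (tau c) /\ J 1 (tau c).

Lemma small_ordered t tau : {subset t <= s} -> small_fun tau ->
  small_word [seq (c, tau c) | c <- t].
Proof.
move=> ts st; split=> q /mapP[c ct ->] /=; last by case: (st c).
by split; [apply/s_odd/ts|case: (st c)].
Qed.

(** The letter travels to the slot of [c], where [merge_letters] adds its parameter. Each crossing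
    leaves a correction of level [q.+1], and those arising further inside are brought to the front
    by [congruence_conj]. Positivity of [q] keeps the new parameter in [J 1]. *)
Lemma insert_letter q c ze tau t : (0 < q)%N -> {subset t <= s} -> uniq t -> c \in t ->
  rd_part R true c -> sa_part A true ze -> J q ze -> small_fun tau ->
  exists F tau', [/\ congruence_mod q.+1 F, small_fun tau',
    forall c', c' != c -> tau' c' = tau c' &
    letter ze (X c) *m ordered t tau = F *m ordered t tau'].
Proof.
move=> q0 + + + c1 ze1 zeJ st; elim: t => // c' t IH ts /= /andP[c't ut].
have ts' : {subset t <= s} by move=> x xt; apply: ts; rewrite in_cons xt orbT.
have c'1 : rd_part R true c' by apply/s_odd/ts/mem_head.
have [tau1 tauJ] := st c'.
rewrite in_cons; case: eqVneq => [ec _|cc' /= ct]; first subst c'.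
  have [F cF e] := merge_letters c1 ze1 (st c).1 zeJ (st c).2.
  exists F, (fun x : rd_lat R => if x == c then ze + tau c else tau x); split=> //.
  - move=> x; case: eqP => // _; split; first by apply: partD => //; exact: (st c).1.
    apply: (subgroupD (fil_zero J_fil 1) (fil_sub J_fil (q := 1))); last exact: (st c).2.
    exact: fil_le zeJ.
  - by move=> x /negPf ->.
  rewrite /ordered /= eqxx mulmxA e -mulmxA; congr (_ *m (_ *m _)).
  apply: eq_ordered => x xt; case: eqP => // xc.
  by case/negP: c't; rewrite -xc.
have [F [tau' [cF st' tauE e]]] := IH ts' ut ct.
have ze2 := odd_sqr0 ze1; have cg := root_gZ c1.
have [_ [_ _ [C cC eC]]] := swap_letter c'1 tau1 tauJ zeJ ze1 ze2 cg.
have [F2 cF2 e2] := congruence_conj c'1 tau1 tauJ cF.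
exists (C *m F2), tau'; split=> //; first exact: congruenceM.
rewrite /ordered /= -/(ordered t tau) -/(ordered t tau') mulmxA eC -!mulmxA e.
by rewrite (mulmxA (letter _ _) F) e2 -!mulmxA tauE // eq_sym.
Qed.

Definition decomposed F := exists tau g0, [/\ small_fun tau, G0 g0 & F = ordered s tau *m g0].

(* Downward induction on q: moving a factor of level q to its place in the
   ordered product only creates factors of level q + 1.                       *)
Lemma congruence_decomposed q F F' : (0 < q)%N ->
  congruence_mod q F -> decomposed F' -> decomposed (F *m F').
Proof.
have [m Jm] := fil_nil J_fil.
(* [n] bounds the number of levels left before [J] vanishes; at 0 all letters are trivial. *)
have [n qn] : exists n, (m <= q + n)%N by exists m; apply: leq_addl.
elim: n q qn F F' => [|n IH] q qn F F' q0 cF dF'.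
  suff -> : F = 1%:M by rewrite mul1mx.
  elim: cF => // p ze z F1 zeJ _ _ _ _ ->; rewrite addn0 in qn.
  by rewrite (Jm ze (fil_le qn zeJ)) letter0l mul1mx.
elim: cF => [|p ze z F1 zeJ zep ze2 zg _ IHF]; first by rewrite mul1mx.
have qn' : (m <= q.+1 + n)%N by rewrite addSnnS.
rewrite -mulmxA; move: (F1 *m F') IHF => D.
(* A general element of the integral form is split into generators, so that only an [H_i] or a root
   vector has to be sorted. *)
move: D; apply: (letter_gen (Q := fun E => forall D, decomposed D -> decomposed (E *m D)) ze2 zg).
- by move=> D dD; rewrite mul1mx.
- by move=> E E' hE hE' D dD; rewrite -mulmxA; apply/hE/hE'.
move=> x N xg D [tau [g0 [st hg ->]]].
have zNJ := fil_Mz N zeJ; have zNp := part_mulrz N zep.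
have zN2 : ze *~ N * (ze *~ N) = 0 by rewrite mulrzAl mulrzAr ze2 !mul0rz.
have xgZ : gZ p x by apply: zspan_mem.
have sw := small_ordered (fun c cs => cs) st.
have IHs C F2 : congruence_mod q.+1 C -> decomposed F2 -> decomposed (C *m F2).
  by apply: IH.
case: p zep zg zNp xgZ xg => zep zg zNp xgZ xg.
  case: xg => [[//]|[c c1 xc]]; rewrite xc.
  have cs : c \in s by apply/s_odd.
  have [C [tau' [cC st' _ e]]] :=
    insert_letter q0 (fun c cs => cs) s_uniq cs c1 zNp zNJ st.
  rewrite mulmxA e -mulmxA; apply: IHs cC _.
  by exists tau', g0.
have [C cC e] := letter_word sw zNJ zNp zN2 xgZ.
rewrite mulmxA e -!mulmxA; apply: IHs cC _.
exists tau, (letter (ze *~ N) x *m g0); split=> //.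
by apply: G0_mul hg; apply: G0_letter.
Qed.

End Sorting.

Lemma word_decomposed (s : seq (rd_lat R)) (G0 : 'M[A]_d -> Prop) w :
  uniq s -> (forall c, c \in s <-> rd_part R true c) ->
  G0 1%:M -> (forall F F', G0 F -> G0 F' -> G0 (F *m F')) ->
  (forall ze z, sa_part A false ze -> ze * ze = 0 -> gZ false z -> G0 (letter ze z)) ->
  odd_word w -> exists tau g0, [/\ forall c, sa_part A true (tau c), G0 g0
    & prodw w = ordered s tau *m g0].
Proof.
move=> us s1 G1 GM GL ow.
have [J Jf JL] : exists2 J, filtration J & {in [seq q.2 | q <- w], forall th, J 1%N th}.
  by apply: odd_filtration => th /mapP[q /ow[_ q2] ->].
have cw : congruence_mod J 1 (prodw w).
  elim: w ow JL => [|q w IH] ow JL; first exact: congruence_one.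
  have [[q1 q2] ow'] := odd_word_cons ow.
  apply: (@congruence_mul _ _ true).
  - by apply: JL; rewrite mem_head.
  - exact: q2.
  - exact: odd_sqr0.
  - exact: root_gZ.
  by apply: IH => // th thw; apply: JL; rewrite in_cons thw orbT.
have [|tau [g0 [st hg e]]] := congruence_decomposed Jf us s1 GM GL (ltn0Sn 0) cw (F' := 1%:M).
  exists (fun=> 0), 1%:M; split=> //.
    by move=> c; split; [apply: part0|apply: fil_zero].
  rewrite mulmx1 /ordered; elim: s {us s1} => //= c s <-.
  by rewrite letter0l mul1mx.
by exists tau, g0; split=> // [c|]; [case: (st c)|rewrite -e mulmx1].
Qed.

Let wl := weight_list hK H_basis V_rat b_basis bin_stable.
Let ws := sval (cid wl).

Let wsw mu : mu \in ws -> is_weight V mu.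
Proof. by move: mu; have [_ ] := svalP (cid wl). Qed.
Let wsum v : v = \sum_(mu <- ws) wp mu v.
Proof. by move: v; have [_ _] := svalP (cid wl). Qed.

Lemma wproj_weight mu v : is_weight V mu -> weight_vector mu (wp mu v).
Proof.
move=> muw y yh; move: v.
have lf : linear (fun v => pairing mu y *: wp mu v).
  by move=> t u v; rewrite (wp_op mu).1 scalerDr !scalerA mulrC.
have lf' : linear (act V y \o wp mu).
  by move=> t u v; rewrite /= (wp_op mu).1 act_linr.
apply: (weight_ext V_rat lf' lf) => nu v nv /=.
rewrite (wprojE hK H_basis V_rat b_basis bin_stable (weight_intweight V_rat muw) nv).
by case: eqP => [<-|_]; rewrite ?scale1r ?(nv y yh) // !scale0r (lin0 (act_linr y)) scaler0.
Qed.

(** The integral projectors add up to 1, and the rows of their matrices are coordinates of lattice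
    weight vectors; so these vectors detect a matrix over any [A]. *)
Lemma weight_mx_ext (Q Q' : 'M[A]_d) :
  (forall mu v, v != 0 -> lattice b v -> weight_vector (h := h) mu v ->
     bc (lattice_coord b v) *m Q = bc (lattice_coord b v) *m Q') -> Q = Q'.
Proof.
move=> e; have one : 1%:M = \sum_(mu <- ws) bc (lattice_mx b (wp mu)).
  rewrite -basechange_sum -(lattice_mx_sum hK b_basis); last by move=> mu; apply: wp_op.
  rewrite -(basechange1 A) -(lattice_mx_id hK b_basis); congr bc.
  by apply: eq_lattice_mx => v; rewrite -wsum.
rewrite -[Q]mul1mx -[Q']mul1mx one !mulmx_suml big_seq [RHS]big_seq.
apply: eq_bigr => mu /wsw muw; apply/row_matrixP => j; rewrite !row_mul.
have -> : row j (bc (lattice_mx b (wp mu))) = bc (lattice_coord b (wp mu (tnth b j))).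
  by rewrite -row_lattice_mx; apply/rowP => i; rewrite !mxE.
have [->|nz] := eqVneq (wp mu (tnth b j)) 0.
  by rewrite (lattice_coord0 hK b_basis) basechange0 !mul0mx.
apply: e nz _ (wproj_weight _ muw).
by apply: (wp_op mu).2; apply: lattice_tnth.
Qed.

Lemma basechange_coord_op f v : lat_op b f -> lattice b v ->
  bc (lattice_coord b v) *m bc (lattice_mx b f) = bc (lattice_coord b (f v)).
Proof. by move=> fo bv; rewrite -basechangeM (lattice_coord_op hK b_basis fo bv). Qed.

Definition even_mx F := forall i j, sa_part A false (F i j).

(** * The torus elements h_i(t) *)

Section Torus.
Variable i : 'I_l.

Lemma is_h_uniq t t' F F' : is_h h H b i t t' F -> is_h h H b i t t' F' -> F = F'.
Proof.
move=> hF hF'; apply: weight_mx_ext => mu v v0 bv mv.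
have [z ez] := V_rat.2 _ _ v0 mv i.
by rewrite (hF mu v z bv mv ez) (hF' mu v z bv mv ez).
Qed.

Variables t t' : A.
Hypotheses (t_even : sa_part A false t) (t'_even : sa_part A false t') (tt' : t * t' = 1).

(** The witness is the sum over the weights of [t] to the power mu(H_i) times the projector at mu;
    integrality of the projectors makes its entries even elements of [A]. *)
Lemma is_h_exists : exists2 F, is_h h H b i t t' F & even_mx F.
Proof.
pose n mu := integer_of (pairing mu (tnth H i)).
exists (\sum_(mu <- ws) unit_power t t' (n mu) *: bc (lattice_mx b (wp mu))).
  move=> nu v z bv nv ez.
  rewrite {2}(wsum v).
  have -> : lattice_coord b (\sum_(mu <- ws) wp mu v) = \sum_(mu <- ws) lattice_coord b (wp mu v).
    elim: (ws) => [|mu s IH]; first by rewrite !big_nil (lattice_coord0 hK b_basis).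
    rewrite !big_cons (lattice_coordD hK b_basis) ?IH //; first exact: (wp_op mu).2.
    by apply: zspan_sum => nu' _; apply: (wp_op nu').2.
  rewrite basechange_sum scaler_sumr mulmx_sumr big_seq [RHS]big_seq.
  apply: eq_bigr => mu /wsw muw.
  rewrite basechange_scale (basechange_coord_op (wp_op mu) bv).
  rewrite (wprojE hK H_basis V_rat b_basis bin_stable (weight_intweight V_rat muw) nv).
  case: eqP => [e|_]; last first.
    by rewrite scale0r (lattice_coord0 hK b_basis) basechange0 !scaler0.
  by rewrite /n -e ez (integer_ofK hK).
move=> r s; rewrite summxE; apply: part_sum => mu _; rewrite !mxE.
exact: (partM (unit_power_even t_even t'_even _) (part_int _ _)).
Qed.

Lemma is_h_even F : is_h h H b i t t' F -> even_mx F.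
Proof. by move=> hF; have [F' hF' eF'] := is_h_exists; rewrite (is_h_uniq hF hF'). Qed.

Lemma is_h_inv F F' : is_h h H b i t t' F -> is_h h H b i t' t F' -> F *m F' = 1%:M.
Proof.
move=> hF hF'; apply: weight_mx_ext => mu v v0 bv mv.
have [z ez] := V_rat.2 _ _ v0 mv i.
rewrite mulmxA (hF mu v z bv mv ez) -scalemxAl (hF' mu v z bv mv ez) scalerA.
by rewrite (unit_power_inv t'_even tt') scale1r mulmx1.
Qed.

Lemma is_h_root F c (n : int) : is_h h H b i t t' F -> rd_part R true c ->
  rpair c (tnth H i) = n%:~R -> rho (X c) *m F = unit_power t t' n *: (F *m rho (X c)).
Proof.
move=> hF c1 en; have Xop := lat_op_gZ (root_gZ c1).
apply: weight_mx_ext => mu v v0 bv mv; have [z ez] := V_rat.2 _ _ v0 mv i.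
rewrite mulmxA (basechange_coord_op Xop bv) basechange_scale mulmxA (hF mu v z bv mv ez).
rewrite -scalemxAl (basechange_coord_op Xop bv) scalerA -(unit_powerD t'_even tt').
apply: hF; [exact: Xop.2|exact: (root_shift h_even hX (part_Delta c1) mv)|].
by rewrite rmorphD /= addrC -ez -en /pairing lfunE.
Qed.

End Torus.

(** As [ze] squares to zero, (1 + ze)^n = 1 + n ze for every integer n, so this letter is h_i(1 +
    ze). *)
Lemma G0_letter_H i ze : sa_part A false ze -> ze * ze = 0 -> G0_set (letter ze (tnth H i)).
Proof.
move=> ze0 ze2; apply: generated_gen.
have Hg : gZ false (tnth H i) by apply: zspan_mem; left; split; rewrite ?mem_tnth.
apply: (@G0_gen_h _ _ _ _ _ _ _ _ _ _ _ _ i (1 + ze) (1 - ze)).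
- by apply: partD => //; apply: part1.
- by apply: sa_sub => //; apply: part1.
- by rewrite mulrDl mul1r mulrBr mulr1 ze2 subr0 subrK.
move=> mu v z bv mv ez; rewrite mulmxDr mulmx1 basechange_scale.
rewrite (basechange_coord_op (lat_op_gZ Hg) bv) (mv _ (tnth_h H_basis i)) ez.
rewrite scaler_int (lattice_coordMz hK b_basis) // basechangeZ scalerA -{1}[bc _]scale1r -scalerDl.
congr (_ *: _); have pw (y : A) n : y * y = 0 -> (1 + y) ^+ n = 1 + y *+ n.
  move=> y2; elim: n => [|n IH]; first by rewrite mulr0n addr0.
  rewrite exprS IH mulrDl mul1r mulrDr mulr1 mulrnAr y2 mul0rn addr0 mulrS -addrA.
  by rewrite [y *+ n + y]addrC.
case: z {ez} => n /=; first by rewrite pw // mulr_natr.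
by rewrite pw ?mulrNN // NegzE rmorphN /= mulrN mulr_natr mulNrn.
Qed.

Lemma G0_mul F F' : G0_set F -> G0_set F' -> G0_set (F *m F').
Proof. by move=> hF hF'; apply: (generated_mul hF' hF). Qed.

Lemma G0_letter ze z : sa_part A false ze -> ze * ze = 0 -> gZ false z -> G0_set (letter ze z).
Proof.
move=> ze0 ze2 zg; apply: (letter_gen ze2 zg).
- exact: generated_one.
- exact: G0_mul.
move=> x n; have zn0 := part_mulrz n ze0.
have zn2 : ze *~ n * (ze *~ n) = 0 by rewrite mulrzAl mulrzAr ze2 !mul0rz.
case=> [[_ /tnthP[i ->]]|[c c0 ->]]; first exact: G0_letter_H.
rewrite /letter -(x_even_square0 c0 zn2).
by apply: generated_gen; apply: G0_gen_x.
Qed.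

Definition inverse_mx F F' := F *m F' = 1%:M /\ F' *m F = 1%:M.

Lemma inverse_uniq F F1 F2 : inverse_mx F F1 -> inverse_mx F F2 -> F1 = F2.
Proof. by move=> [_ e1] [e2 _]; rewrite -[F1]mulmx1 -e2 mulmxA e1 mul1mx. Qed.

Lemma G0_inv F : G0_set F -> exists2 F', G0_set F' & inverse_mx F F'.
Proof.
elim=> {F} [F [i t t' {}F t0 t'0 tt' hF|c t c0 t0]||F1 F2 h1 [F1' h1' [e1 e1']] h2 [F2' h2' [e2 e2']]|F F' hF _ e e'].
- have t't : t' * t = 1 by rewrite -tt' (even_central t t'0).
  have [F' hF' _] := is_h_exists i t'0 t0.
  exists F'.
    by apply: generated_gen; apply: (@G0_gen_h _ _ _ _ _ _ _ _ _ _ _ _ i t' t).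
  by split; [apply: is_h_inv hF hF'|apply: is_h_inv hF' hF].
- exists (x_even X b c (- t)); first by apply: generated_gen; apply: G0_gen_x => //; apply: partN.
  have e := x_even_inv c0.
  by split; rewrite ?e // -{2}[t]opprK e.
- by exists 1%:M; [apply: generated_one|split; rewrite mulmx1].
- exists (F1' *m F2'); first exact: G0_mul.
  rewrite /compmx; split; first by rewrite mulmxA -(mulmxA F2) e1 mulmx1.
  by rewrite mulmxA -(mulmxA F1') e2' mulmx1.
by exists F.
Qed.

Lemma even_mxM F F' : even_mx F -> even_mx F' -> even_mx (F *m F').
Proof.
move=> eF eF' i j; rewrite mxE; apply: part_sum => n _.
exact: (partM (eF i n) (eF' n j)).
Qed.

Lemma even_mx1 : even_mx 1%:M.
Proof. by move=> i j; rewrite mxE; apply/part_mulrn/part1. Qed.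

(** Comparing even parts in F F' = 1, the even part of F' is already a right inverse of F, hence
    equal to F'. *)
Lemma even_mx_inv F F' : even_mx F -> inverse_mx F F' -> even_mx F'.
Proof.
move=> eF [e e'].
have [P0 [P1 [h0 h1 eP]]] : exists P0 P1 : 'M[A]_d, [/\ even_mx P0,
    (forall i j, sa_part A true (P1 i j)) & F' = P0 + P1].
  pose dec i j := cid (sa_sum (F' i j)).
  exists (\matrix_(i, j) sval (dec i j)), (\matrix_(i, j) sval (cid (svalP (dec i j)))).
  split=> [i j|i j|].
  - by rewrite mxE; have [] := svalP (cid (svalP (dec i j))).
  - by rewrite mxE; have [] := svalP (cid (svalP (dec i j))).
  by apply/matrixP => i j; rewrite !mxE; have [] := svalP (cid (svalP (dec i j))).
suff e0 : F *m P0 = 1%:M by rewrite (_ : F' = P0) // -[F']mulmx1 -e0 mulmxA e' mul1mx.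
apply/matrixP => i j; rewrite eP mulmxDr in e.
have [|||||e0 _] := @part_uniq _ A ((F *m P0) i j) ((F *m P1) i j) ((1%:M : 'M[A]_d) i j) 0.
- exact: even_mxM.
- by rewrite mxE; apply: part_sum => n _; apply: (partM (eF i n) (h1 n j)).
- exact: even_mx1.
- exact: part0.
- by rewrite addr0 -e [RHS]mxE.
exact: e0.
Qed.

Lemma G0_even F : G0_set F -> even_mx F.
Proof.
elim=> {F} [F [i t t' {}F t0 t'0 tt' hF|c t c0 t0]||F1 F2 _ e1 _ e2|F F' hF IH e e'].
- exact: is_h_even hF.
- by move=> i j; apply: x_even_even.
- exact: even_mx1.
- exact: even_mxM.
by apply: even_mx_inv IH _; split.
Qed.

Definition is_word F := exists2 w, odd_word w & F = prodw w.

Lemma is_wordM F F' : is_word F -> is_word F' -> is_word (F *m F').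
Proof.
move=> [w ow ->] [w' ow' ->]; exists (w ++ w'); first exact: odd_word_cat.
by rewrite prodw_cat.
Qed.

Lemma is_word1 : is_word 1%:M.
Proof. by exists [::]. Qed.

Lemma is_word_root c th : rd_part R true c -> sa_part A true th -> is_word (letter th (X c)).
Proof.
move=> c1 th1; exists [:: (c, th)]; last by rewrite /= mulmx1.
by move=> q; rewrite inE => /eqP ->.
Qed.

Lemma is_word_letter th z : sa_part A true th -> gZ true z -> is_word (letter th z).
Proof.
move=> th1 zg; apply: (letter_gen (odd_sqr0 th1) zg is_word1 is_wordM).
move=> x n [[//]|[c c1 ->]]; apply: is_word_root => //; exact: part_mulrz.
Qed.

(** All the letters have parameters divisible by [th], so the cross terms of their product
    vanish. *)
Lemma is_word_sum th (u : nat -> A) (y : nat -> g) n : sa_part A true th ->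
  (forall i, sa_part A false (u i)) -> (forall i, gZ true (y i)) ->
  is_word (1%:M + th *: \sum_(i < n) u i *: rho (y i)).
Proof.
move=> th1 u0 yg; elim: n => [|n IH].
  by rewrite big_ord0 scaler0 addr0; apply: is_word1.
suff -> : 1%:M + th *: \sum_(i < n.+1) u i *: rho (y i) =
    (1%:M + th *: \sum_(i < n) u i *: rho (y i)) *m letter (th * u n) (y n).
  apply: is_wordM IH _; apply: is_word_letter (yg n).
  exact: (partM th1 (u0 n)).
have cross : (th *: \sum_(i < n) u i *: rho (y i)) *m ((th * u n) *: rho (y n)) = 0.
  rewrite -scalemxAl mulmx_suml scaler_sumr big1 // => i _.
  rewrite -scalemxAl basechange_scale !scalerA.
  by rewrite -(even_central th (u0 i)) -!mulrA (mulrA th th) (odd_sqr0 th1) mul0r mulr0 scale0r.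
by rewrite big_ord_recr /= scalerDr /letter mulmxDr mulmx1 mulmxDl mul1mx scalerA cross addr0 addrA.
Qed.

(** Asked on both sides so that the property passes to inverses. *)
Definition normalizes F := forall c th, rd_part R true c -> sa_part A true th ->
  (exists2 F', is_word F' & F *m letter th (X c) = F' *m F) /\
  (exists2 F', is_word F' & letter th (X c) *m F = F *m F').

Lemma normalizes_word F W : normalizes F -> is_word W ->
  (exists2 F', is_word F' & F *m W = F' *m F) /\
  (exists2 F', is_word F' & W *m F = F *m F').
Proof.
move=> nF [w ow ->]; elim: w ow => [|q w IH] ow.
  by split; exists 1%:M; rewrite ?mulmx1 ?mul1mx //; apply: is_word1.
have [[q1 q2] /IH[[F1 w1 e1] [F2 w2 e2]]] := odd_word_cons ow.
have [[F3 w3 e3] [F4 w4 e4]] := nF _ _ q1 q2; split.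
  by exists (F3 *m F1); [apply: is_wordM|rewrite /= mulmxA e3 -!mulmxA e1].
by exists (F4 *m F2); [apply: is_wordM|rewrite /= -mulmxA e2 !mulmxA e4].
Qed.

Lemma normalizesM F F' : normalizes F -> normalizes F' -> normalizes (F *m F').
Proof.
move=> nF nF' c th c1 th1.
have [[F1 w1 e1] _] := nF' c th c1 th1; have [_ [F2 w2 e2]] := nF c th c1 th1.
have [[F3 w3 e3] _] := normalizes_word nF w1.
have [_ [F4 w4 e4]] := normalizes_word nF' w2.
split; first by exists F3 => //; rewrite -mulmxA e1 mulmxA e3 -mulmxA.
by exists F4 => //; rewrite mulmxA e2 -mulmxA e4 mulmxA.
Qed.

Lemma normalizes_inv F F' : normalizes F -> inverse_mx F F' -> normalizes F'.
Proof.
move=> nF [e e'] c th c1 th1; have [[F1 w1 e1] [F2 w2 e2]] := nF c th c1 th1; split.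
  by exists F2 => //; rewrite -[LHS]mulmx1 -e mulmxA -(mulmxA F') e2 !mulmxA e' mul1mx.
by exists F1 => //; rewrite -[LHS]mul1mx -e' -!mulmxA (mulmxA F) e1 -!mulmxA e mulmx1.
Qed.

(** [A] is not commutative: the scalar crosses F because even entries are central. *)
Lemma even_mx_scale F th M : even_mx F -> F *m (th *: M) = th *: (F *m M).
Proof.
move=> eF; apply/matrixP => i j; rewrite !mxE mulr_sumr; apply: eq_bigr => n _.
by rewrite mxE !mulrA (even_central th (eF i n)).
Qed.

(** Conjugation replaces X_c by the finite sum exp(- t ad X_a) X_c, and [is_word_sum] splits the
    result into letters. The other side follows by conjugating with x_a(- t). *)
Lemma normalizes_x_even a t : rd_part R false a -> sa_part A false t ->
  normalizes (x_even X b a t).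
Proof.
have half a' u c th : rd_part R false a' -> sa_part A false u -> rd_part R true c ->
    sa_part A true th -> exists2 F', is_word F' &
      x_even X b a' u *m letter th (X c) = F' *m x_even X b a' u.
  move=> a0 u0 c1 th1; have [n e] := ad_exp_conj a0 c1.
  exists (1%:M + th *: \sum_(i < n) (- u) ^+ i *: rho (ad_power a' c i)).
    apply: is_word_sum => // i; last exact: (ad_power_gZ a0 c1 i).
    exact/part_evenX/partN.
  rewrite mulmxDr mulmx1 mulmxDl mul1mx even_mx_scale; last first.
    by move=> i j; apply: x_even_even.
  by rewrite e scalemxAl.
move=> a0 t0 c th c1 th1; split; first exact: half.
have [F wF e] := half a (- t) c th a0 (partN t0) c1 th1.
have ee := x_even_inv a0.
exists F => //.
have e' : x_even X b a t *m x_even X b a (- t) = 1%:M by exact: ee.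
have e'' : x_even X b a (- t) *m x_even X b a t = 1%:M by rewrite -{2}[t]opprK ee.
by rewrite -[LHS]mul1mx -e' -!mulmxA (mulmxA (x_even X b a (- t))) e -!mulmxA e'' mulmx1.
Qed.

Lemma normalizes_is_h i t t' F : sa_part A false t -> sa_part A false t' -> t * t' = 1 ->
  is_h h H b i t t' F -> normalizes F.
Proof.
move=> t0 t'0 tt' hF c th c1 th1.
have [n en] := root_int h_even hX V_faithful V_rat i (part_Delta c1).
have eF := is_h_even t0 t'0 hF.
have e := is_h_root t'0 tt' hF c1 en.
have u0 := unit_power_even t0 t'0 n; have u0' := unit_power_even t'0 t0 n.
have uu : unit_power t' t n * unit_power t t' n = 1.
  by rewrite -(even_central _ u0) (unit_power_inv t'0 tt').
split.
  exists (letter (th * unit_power t' t n) (X c)).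
    by apply: is_word_root => //; apply: (partM th1 u0').
  rewrite /letter mulmxDr mulmx1 mulmxDl mul1mx (even_mx_scale _ _ eF) -scalemxAl e.
  by rewrite scalerA -mulrA uu mulr1.
exists (letter (th * unit_power t t' n) (X c)).
  by apply: is_word_root => //; apply: (partM th1 u0).
by rewrite /letter mulmxDr mulmx1 mulmxDl mul1mx (even_mx_scale _ _ eF) -scalemxAl e scalerA.
Qed.

Lemma G0_normalizes F : G0_set F -> normalizes F.
Proof.
elim=> {F} [F [i t t' {}F t0 t'0 tt' hF|c t c0 t0]||F1 F2 _ e1 _ e2|F F' hF IH e e'].
- exact: normalizes_is_h hF.
- exact: normalizes_x_even.
- move=> c th c1 th1; split; exists (letter th (X c)); rewrite ?mulmx1 ?mul1mx //; exact: is_word_root.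
- exact: normalizesM.
by apply: normalizes_inv IH _; split.
Qed.

(** If the square of X_c is m X_{c'}, its n-th divided power is m^n times that of X_{c'}, so the
    exponential at [t] is x_{c'}(m t). *)
Lemma exp_square c t : rd_part R true c -> sa_part A false t ->
  G0_set (exp_mx b (fun v => act V (X c) (act V (X c) v)) t).
Proof.
move=> c1 t0; have [c' [m [c'0 _ e]]] := odd_square c1.
have le : linear (act V (X c')) := act_linr (X c').
have it n v : divided_power (fun v => act V (X c) (act V (X c) v)) n v =
    divided_power (act V (X c')) n v *~ m ^+ n.
  rewrite /divided_power scalerMzr; congr (_ *: _).
  elim: n => [|n IH]; first by rewrite expr0 mulr1z.
  by rewrite !iterS e IH (linMz le) exprSr mulrzA.
have [m0|/c'0 c'0'] := eqVneq m 0.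
  suff -> : exp_mx b (fun v => act V (X c) (act V (X c) v)) t = 1%:M by apply: generated_one.
  (* For [d = 0] the truncated sum has no degree 0 term, but all matrices of size 0 agree. *)
  rewrite /exp_mx; case: d b b_adm b_basis => [|n] b' b'_adm b'_basis.
    by apply/matrixP => -[].
  rewrite big_ord_recl big1 => [|i _]; last first.
    have -> : lattice_mx b' (divided_power (fun v => act V (X c) (act V (X c) v)) (bump 0 i)) = 0.
      rewrite -(lattice_mx0 hK b'_basis); apply: eq_lattice_mx => v.
      by rewrite it m0 /bump /= add1n expr0n mulr0z.
    by rewrite basechange0 scaler0.
  rewrite addr0 expr0 scale1r -(basechange1 A) -(lattice_mx_id hK b'_basis); congr bc.
  by apply: eq_lattice_mx => v; rewrite /divided_power /= invr1 scale1r.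
suff -> : exp_mx b (fun v => act V (X c) (act V (X c) v)) t = x_even X b c' (t *~ m).
  by apply: generated_gen; apply: G0_gen_x => //; apply: part_mulrz.
apply: eq_bigr => n _; rewrite (eq_lattice_mx _ (it n)).
rewrite (lattice_mxMz hK b_basis); last exact: (lat_op_divided n c'0').
rewrite basechangeZ scalerA; congr (_ *: _).
rewrite -[t *~ m]mulrzr exprMn_comm ?rmorphXn //.
by rewrite /GRing.comm intr_comm.
Qed.

(** Products of a word and an element of G_0 form a group, because G_0 normalizes the words and
    words are inverted by words; this group contains all generators. *)
Lemma G_factor F : G_set F -> exists w F0, [/\ odd_word w, G0_set F0 & F = prodw w *m F0].
Proof.
have mulWG F1 F2 : (exists w F0, [/\ odd_word w, G0_set F0 & F1 = prodw w *m F0]) ->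
    (exists w F0, [/\ odd_word w, G0_set F0 & F2 = prodw w *m F0]) ->
    exists w F0, [/\ odd_word w, G0_set F0 & F1 *m F2 = prodw w *m F0].
  move=> [w1 [g1 [o1 h1 ->]]] [w2 [g2 [o2 h2 ->]]].
  have [|[_ [w3 o3 ->] e] _] := @normalizes_word g1 (prodw w2) (G0_normalizes h1).
    by exists w2.
  exists (w1 ++ w3), (g1 *m g2); split; [exact: odd_word_cat|exact: G0_mul|].
  by rewrite prodw_cat -!mulmxA (mulmxA g1) e -!mulmxA.
have ofG F0 : G0_set F0 -> exists w F1, [/\ odd_word w, G0_set F1 & F0 = prodw w *m F1].
  by move=> h0; exists [::], F0; split=> //; rewrite mul1mx.
have ofW c th : rd_part R true c -> sa_part A true th ->
    exists w F0, [/\ odd_word w, G0_set F0 & x_odd X b c th = prodw w *m F0].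
  move=> c1 th1; exists [:: (c, th)], 1%:M; split=> //; last by rewrite /= !mulmx1.
    by move=> q; rewrite inE => /eqP ->.
  exact: generated_one.
elim=> {F} [F [{}F /ofG //|c th c1 th1|c t th c1 c2 t0 th1]||F1 F2 _ e1 _ e2|F F' hF IH e e'].
- exact: ofW.
- by apply: mulWG (ofW _ _ c1 th1); apply: ofG; apply: exp_square.
- by apply: ofG; apply: generated_one.
- exact: mulWG.
have [w [F0 [ow h0 eF]]] := IH; have [w' [ow' f f']] := prodw_inv ow.
have [F0' h0' [f0 f0']] := G0_inv h0.
have -> : F' = F0' *m prodw w'.
  apply: (@inverse_uniq F); split=> //; rewrite eF.
    by rewrite mulmxA -(mulmxA (prodw w)) f0 mulmx1.
  by rewrite mulmxA -(mulmxA F0') f' mulmx1.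
by apply: mulWG; [apply: ofG|exists w', 1%:M; split=> //; [apply: generated_one|rewrite mulmx1]].
Qed.

(** * Existence and uniqueness with G_0 on one side *)

Section Unique.
Variable s : seq (rd_lat R).
Hypotheses (s_uniq : uniq s) (s_odd : forall c, c \in s <-> rd_part R true c).

Lemma G_decomposed F : G_set F -> exists tau F0,
  [/\ forall c, sa_part A true (tau c), G0_set F0 & F = ordered s tau *m F0].
Proof.
move=> /G_factor[w [F0 [ow h0 ->]]].
have gm F1 F2 : G0_set F1 -> G0_set F2 -> G0_set (F1 *m F2) by exact: G0_mul.
have g1 : G0_set 1%:M by exact: generated_one.
have gl ze z : sa_part A false ze -> ze * ze = 0 -> gZ false z -> G0_set (letter ze z).
  exact: (G0_letter).
have [tau [F1 [otau h1 ->]]] := word_decomposed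
  s_uniq s_odd g1 gm gl ow.
exists tau, (F1 *m F0); split=> //; last by rewrite mulmxA.
exact: G0_mul.
Qed.

Section FirstOrder.
Variables (J : nat -> set A) (J_fil : filtration J).
Notation mxJ q := (mxin (J q)).

Lemma mxJM p q m n r (M : 'M[A]_(m, n)) (N : 'M_(n, r)) : mxJ p M -> mxJ q N -> mxJ (p + q)%N (M *m N).
Proof.
move=> hM hN i j; rewrite mxE.
apply: (subgroup_sum (fil_zero J_fil _) (fil_sub J_fil (q := (p + q)%N))) => e _.
exact: (filM J_fil (hM i e) (hN e j)).
Qed.

Lemma mxJD q m n (M N : 'M[A]_(m, n)) : mxJ q M -> mxJ q N -> mxJ q (M + N).
Proof. exact: (mxinD (fil_zero J_fil q) (fil_sub J_fil (q := q))). Qed.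

Lemma mxJN q m n (M : 'M[A]_(m, n)) : mxJ q M -> mxJ q (- M).
Proof. exact: (mxinN (fil_zero J_fil q) (fil_sub J_fil (q := q))). Qed.

Lemma mxJ_scale q th (M : 'M[A]_d) : J q th -> mxJ q (th *: M).
Proof.
move=> hth i j; rewrite mxE -(addn0 q).
exact: (filM J_fil hth (fil0 J_fil _)).
Qed.

Lemma mxJ0 m n (M : 'M[A]_(m, n)) : mxJ 0 M.
Proof. by move=> i j; apply: fil0. Qed.

Lemma ordered_mod1 t tau : (forall c, c \in t -> J 1 (tau c)) -> mxJ 1 (ordered t tau - 1%:M).
Proof.
elim: t => [|c t IH] ht /=.
  by rewrite subrr => i j; rewrite mxE; apply: fil_zero.
rewrite /ordered /= -/(ordered t tau) /letter mulmxDl mul1mx addrAC.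
apply: mxJD; first by apply: IH => c' c't; apply: ht; rewrite in_cons c't orbT.
by rewrite -scalemxAl; apply/mxJ_scale/ht/mem_head.
Qed.

Lemma ordered_first_order q t tau tau' :
  (forall c, c \in t -> J 1 (tau c) /\ J 1 (tau' c)) ->
  (forall c, c \in t -> J q (tau c - tau' c)) ->
  mxJ q.+1 (ordered t tau - ordered t tau' - \sum_(c <- t) (tau c - tau' c) *: rho (X c)).
Proof.
elim: t => [|c t IH] h1 hq /=.
  by rewrite big_nil !subr0 subrr => i j; rewrite mxE; apply: fil_zero.
have h1' c' : c' \in t -> J 1 (tau c') /\ J 1 (tau' c').
  by move=> c't; apply: h1; rewrite in_cons c't orbT.
have hq' c' : c' \in t -> J q (tau c' - tau' c').
  by move=> c't; apply: hq; rewrite in_cons c't orbT.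
have hqc := hq c (mem_head _ _); have [h1c h1c'] := h1 c (mem_head _ _).
rewrite big_cons /ordered /= -/(ordered t tau) -/(ordered t tau').
set P := ordered t tau; set P' := ordered t tau'; set S := \sum_(_ <- t) _.
have hS : mxJ q S.
  rewrite /S big_seq; apply: (big_ind (fun M => mxJ q M)) => [i j|M N|c' c't].
  - by rewrite mxE; apply: fil_zero.
  - exact: mxJD.
  - exact/mxJ_scale/hq'.
(* Product rule: the three summands are products of levels q and 1, 0 and q + 1, 1 and q, hence all
   of level q + 1. *)
have -> : letter (tau c) (X c) *m P - letter (tau' c) (X c) *m P' -
    ((tau c - tau' c) *: rho (X c) + S) =
  (tau c - tau' c) *: rho (X c) *m (P - 1%:M) + (letter (tau' c) (X c) *m (P - P' - S) +
    tau' c *: rho (X c) *m S).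
  rewrite /letter !scalerBl; set a := tau c *: _; set a' := tau' c *: _.
  rewrite mulmxBl !mulmxDl !mulmxBr !mul1mx !mulmx1.
  exact: telescope_letters.
apply: mxJD.
  by rewrite -addn1; apply: mxJM; [apply: mxJ_scale|apply: ordered_mod1 => c' /h1'[]].
apply: mxJD; first by rewrite -(add0n q.+1); apply: mxJM; [apply: mxJ0|apply: IH].
by rewrite -add1n; apply: mxJM => //; apply: mxJ_scale.
Qed.

End FirstOrder.

Lemma G_unique tau tau' F F' :
  (forall c, sa_part A true (tau c)) -> (forall c, sa_part A true (tau' c)) ->
  G0_set F -> G0_set F' -> ordered s tau *m F = ordered s tau' *m F' ->
  {in s, tau =1 tau'} /\ F = F'.
Proof.
move=> ot ot' hF hF' e.
have s1 c : c \in s -> rd_part R true c by move/s_odd.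
have [w [ow f f']] := prodw_inv (ordered_word s1 ot').
rewrite -/(ordered s tau') in f f'; set P := ordered s tau in e; set P' := ordered s tau' in e f f'.
set Q := prodw w in f f'.
suff tt : {in s, tau =1 tau'}.
  split=> //; have eP : P = P' by apply: eq_ordered.
  by rewrite -[F]mul1mx -[F']mul1mx -f' -!mulmxA -e eP.
have [I0 hI0 [i0 _]] := G0_inv hF.
(* As [Q] is inverse to P', this product lies in G_0, whose matrices are even. *)
have eE : Q *m P = F' *m I0.
  by rewrite -[P]mulmx1 -i0 (mulmxA P) e !mulmxA f' mul1mx.
have evE : even_mx (Q *m P).
  by rewrite eE; apply: even_mxM; apply: (G0_even).
have [J Jf JL] : exists2 J, filtration J &
    {in [seq tau c | c <- s] ++ [seq tau' c | c <- s], forall th, J 1%N th}.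
  by apply: odd_filtration => th; rewrite mem_cat => /orP[] /mapP[c _ ->].
have J1 c : c \in s -> J 1%N (tau c) /\ J 1%N (tau' c).
  by move=> cs; split; apply: JL; rewrite mem_cat map_f ?orbT.
have J0q q := fil_zero Jf q.
have Jsq q := fil_sub Jf (q := q).
(* At level 1 the parameters agree because all of them are generators of the ideal; nilpotency turns
   agreement at every level into equality. *)
suff key q c : c \in s -> J q.+1 (tau c - tau' c).
  have [m Jm] := fil_nil Jf; move=> c /(key m)/(filW Jf)/Jm/eqP.
  by rewrite subr_eq0 => /eqP.
elim: q c => [|q IH] c cs.
  by have [h1 h2] := J1 c cs; apply: Jsq.
set S := \sum_(c <- s) (tau c - tau' c) *: rho (X c).
have hS : mxin (J q.+1) S.
  rewrite /S big_seq; apply: (big_ind (fun M => mxin (J q.+1) M)) => [i j|M N|c' c's].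
  - by rewrite mxE.
  - exact: (mxJD Jf).
  - exact/(mxJ_scale Jf)/IH.
have hQ : mxin (J 1%N) (Q - 1%:M).
  have -> : Q - 1%:M = Q *m - (P' - 1%:M) by rewrite mulmxN mulmxBr f' mulmx1 opprB.
  rewrite -[1%N]/(0 + 1)%N; apply: (mxJM Jf); first exact: (mxJ0 Jf).
  by apply: (mxJN Jf); apply: (ordered_mod1 Jf) => c' /J1[].
(* QP - 1 is Q (P - P'); since [Q] is 1 modulo [J 1] and [S] lies in [J q.+1], replacing Q S by S
   costs a term in [J q.+2] only. *)
have hD : mxin (J q.+2) (Q *m P - 1%:M - S).
  have -> : Q *m P - 1%:M - S = Q *m (P - P' - S) + (Q - 1%:M) *m S.
    by rewrite !mulmxBr f' mulmxBl mul1mx addrA subrK.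
  apply: (mxJD Jf); last by rewrite -add1n; apply: (mxJM Jf).
  rewrite -[q.+2]add0n; apply: (mxJM Jf); first exact: (mxJ0 Jf).
  exact: (ordered_first_order Jf).
have oS i j : sa_part A true (S i j).
  rewrite summxE; apply: part_sum => c' _; rewrite !mxE.
  exact: (partM (sa_sub (ot c') (ot' c')) (part_int _ _)).
(* QP - 1 is even and [S] is odd, so - S is the odd part of a matrix with entries in [J q.+2], and
   homogeneity keeps it there. *)
have JS : mxin (J q.+2) S.
  move=> i j; have [x0 [x1 [p0 p1 ex _ Jx1]]] := fil_homog Jf (hD i j).
  have ev : sa_part A false ((Q *m P - 1%:M) i j).
    rewrite [_ i j]mxE [X in _ + X]mxE; apply: sa_sub; first exact: evE.
    exact: even_mx1.
  have [_ e1] : x0 = (Q *m P - 1%:M) i j /\ x1 = - S i j.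
    by apply: part_uniq => //; [apply: partN|rewrite -ex [LHS]mxE [X in _ + X = _]mxE].
  by rewrite -[S i j]opprK -e1; apply: (subgroupN (J0q _) (@Jsq _)).
have Jsat (x : A) : J q.+2 (x *+ 2) -> J q.+2 x by move=> hx; apply: (fil_sat Jf); left.
exact: (independence (J0q _) (@Jsq _) Jsat s_uniq s1 JS cs).
Qed.

End Unique.

(** * Passage to the other side of G_0 and to the signed factors *)

Notation O := (odd_product X b).

Lemma eq_odd_product s tau tau' : {in s, tau =1 tau'} -> O s tau = O s tau'.
Proof.
by move=> e; rewrite !odd_productE; apply: eq_ordered => c; rewrite mem_rev; apply: e.
Qed.

Lemma odd_product_cat s s' tau : O (s ++ s') tau = O s' tau *m O s tau.
Proof. by rewrite !odd_productE rev_cat /ordered map_cat prodw_cat. Qed.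

Lemma odd_product_rev s tau : (forall c, sa_part A true (tau c)) ->
  O (rev s) (fun c => - tau c) *m O s tau = 1%:M.
Proof.
move=> ot; elim: s => [|c s IH] /=; first by rewrite mulmx1.
rewrite rev_cons -cats1 odd_product_cat /compmx /= /compmx mul1mx -mulmxA (mulmxA (O (rev s) _)) IH mul1mx.
exact: (letter_inv (X c) (odd_sqr0 (ot c))).2.
Qed.

Lemma odd_product_inv s tau : (forall c, sa_part A true (tau c)) ->
  inverse_mx (O s tau) (O (rev s) (fun c => - tau c)).
Proof.
move=> ot; split; last exact: odd_product_rev.
have ot' c : sa_part A true (- tau c) by apply: partN.
have := odd_product_rev (rev s) ot'; rewrite revK.
by rewrite (@eq_odd_product s (fun c => - - tau c) tau) // => c _; rewrite opprK.
Qed.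

Definition odd_enum s := uniq s /\ forall c, c \in s <-> rd_part R true c.

Lemma odd_enum_rev s : odd_enum s -> odd_enum (rev s).
Proof. by move=> [us sE]; split=> [|c]; rewrite ?rev_uniq ?mem_rev. Qed.

Lemma odd_enum_catC s s' : odd_enum (s ++ s') -> odd_enum (s' ++ s).
Proof.
move=> [us sE]; split=> [|c]; first by rewrite uniq_catC.
by rewrite mem_cat orbC -mem_cat.
Qed.

Lemma G_left s F : odd_enum s -> G_set F -> exists tau F0,
  [/\ forall c, sa_part A true (tau c), G0_set F0 & F = O s tau *m F0].
Proof.
move=> /odd_enum_rev[us sE] /(G_decomposed us sE).
by move=> [tau [F0 [ot h0 ->]]]; exists tau, F0; rewrite odd_productE.
Qed.

Lemma G_left_uniq s tau tau' F F' : odd_enum s ->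
  (forall c, sa_part A true (tau c)) -> (forall c, sa_part A true (tau' c)) ->
  G0_set F -> G0_set F' -> O s tau *m F = O s tau' *m F' ->
  {in s, tau =1 tau'} /\ F = F'.
Proof.
move=> /odd_enum_rev[us sE] ot ot' hF hF'; rewrite !odd_productE => e.
have [tt ->] := G_unique us sE ot ot' hF hF' e.
by split=> // c cs; apply: tt; rewrite mem_rev.
Qed.

Lemma G_inv F : G_set F -> exists2 F', G_set F' & inverse_mx F F'.
Proof.
move=> hF; have [w [F0 [ow h0 eF]]] := G_factor hF.
have [w' [_ f f']] := prodw_inv ow.
have [F0' _ [f0 f0']] := G0_inv h0.
have e : inverse_mx F (F0' *m prodw w').
  rewrite eF; split; first by rewrite mulmxA -(mulmxA (prodw w)) f0 mulmx1.
  by rewrite mulmxA -(mulmxA F0') f' mulmx1.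
by exists (F0' *m prodw w') => //; apply: generated_inv hF e.2 e.1.
Qed.

Lemma inverse_mxM F1 F2 F1' F2' : inverse_mx F1 F1' -> inverse_mx F2 F2' ->
  inverse_mx (F1 *m F2) (F2' *m F1').
Proof.
move=> [e1 e1'] [e2 e2']; split; first by rewrite mulmxA -(mulmxA F1) e2 mulmx1.
by rewrite mulmxA -(mulmxA F2') e1' mulmx1.
Qed.

Lemma inverse_mx_sym F F' : inverse_mx F F' -> inverse_mx F' F.
Proof. by case. Qed.

(** [G_left] is applied to the inverse of [F] and the result inverted: the odd factors return in
    reverse order with opposite parameters. *)
Lemma G_right s F : odd_enum s -> G_set F -> exists tau F0,
  [/\ forall c, sa_part A true (tau c), G0_set F0 & F = F0 *m O s tau].
Proof.
move=> sE /G_inv[F' hF' FF']; have [tau [F0 [ot h0 e]]] := G_left (odd_enum_rev sE) hF'.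
have [F0' h0' i0] := G0_inv h0.
exists (fun c => - tau c), F0'; split=> // [c|]; first exact/partN.
apply: (inverse_uniq (inverse_mx_sym FF')); rewrite e.
have := odd_product_inv (rev s) ot; rewrite revK => io.
exact: inverse_mxM io i0.
Qed.

Lemma G_right_uniq s tau tau' F F' : odd_enum s ->
  (forall c, sa_part A true (tau c)) -> (forall c, sa_part A true (tau' c)) ->
  G0_set F -> G0_set F' -> F *m O s tau = F' *m O s tau' ->
  {in s, tau =1 tau'} /\ F = F'.
Proof.
move=> sE ot ot' hF hF' e.
have [I0 hI0 i0] := G0_inv hF.
have [I0' hI0' i0'] := G0_inv hF'.
have io := odd_product_inv s ot; have io' := odd_product_inv s ot'.
have e' := inverse_uniq (inverse_mxM i0 io); rewrite e in e'.
have {}e' := e' _ (inverse_mxM i0' io').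
have otN c : sa_part A true (- tau c) by apply: partN.
have otN' c : sa_part A true (- tau' c) by apply: partN.
have [tt eI] := G_left_uniq (odd_enum_rev sE) otN otN' hI0 hI0' e'.
split; last by apply: (inverse_uniq (inverse_mx_sym i0)); rewrite eI; apply: inverse_mx_sym.
by move=> c cs; apply: oppr_inj; apply: tt; rewrite mem_rev.
Qed.

(** The negative and the positive factor come with separate parameter functions; the lists being
    disjoint, one function serves the concatenation. *)
Lemma glue_odd s s' tau tau' : odd_enum (s ++ s') ->
  (forall c, sa_part A true (tau c)) -> (forall c, sa_part A true (tau' c)) ->
  exists sigma, [/\ forall c, sa_part A true (sigma c), {in s, sigma =1 tau} & {in s', sigma =1 tau'}].
Proof.
move=> [us _] ot ot'; exists (fun c => if c \in s then tau c else tau' c); split.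
- by move=> c; case: ifP.
- by move=> c ->.
move=> c cs'; case: ifP => // cs.
by move: us; rewrite cat_uniq => /and3P[_ /hasPn/(_ c cs')]; rewrite /= cs.
Qed.

Lemma G1_glue s s' F F' : odd_enum (s ++ s') -> G1_set s F -> G1_set s' F' ->
  exists sigma, [/\ forall c, sa_part A true (sigma c), F = O s sigma & F' = O s' sigma].
Proof.
move=> sE [tau ot ->] [tau' ot' ->]; have [sigma [os e e']] := glue_odd sE ot ot'.
exists sigma; split=> //; apply: eq_odd_product => c cs; apply/esym; [exact: e|exact: e'].
Qed.

(* [compmx] reverses [*m]: this is uniqueness in G0 x G1(s) x G1(s'). *)
Lemma left_product s s' F0 F1 F2 F0' F1' F2' : odd_enum (s ++ s') ->
  G0_set F0 -> G1_set s F1 -> G1_set s' F2 -> G0_set F0' -> G1_set s F1' -> G1_set s' F2' ->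
  compmx (compmx F0 F1) F2 = compmx (compmx F0' F1') F2' -> [/\ F0 = F0', F1 = F1' & F2 = F2'].
Proof.
move=> sE h0 h1 h2 h0' h1' h2'; rewrite /compmx !mulmxA.
have [sg [os -> ->]] := G1_glue sE h1 h2; have [sg' [os' -> ->]] := G1_glue sE h1' h2'.
rewrite -!odd_product_cat => /(G_left_uniq sE os os' h0 h0')[e ->].
by split=> //; apply: eq_odd_product => c cs; apply: e; rewrite mem_cat cs ?orbT.
Qed.

Lemma right_product s s' F0 F1 F2 F0' F1' F2' : odd_enum (s ++ s') ->
  G0_set F0 -> G1_set s F1 -> G1_set s' F2 -> G0_set F0' -> G1_set s F1' -> G1_set s' F2' ->
  compmx (compmx F1 F2) F0 = compmx (compmx F1' F2') F0' -> [/\ F0 = F0', F1 = F1' & F2 = F2'].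
Proof.
move=> sE h0 h1 h2 h0' h1' h2'; rewrite /compmx.
have [sg [os -> ->]] := G1_glue sE h1 h2; have [sg' [os' -> ->]] := G1_glue sE h1' h2'.
rewrite -!odd_product_cat => /(G_right_uniq sE os os' h0 h0')[e ->].
by split=> //; apply: eq_odd_product => c cs; apply: e; rewrite mem_cat cs ?orbT.
Qed.

End Points.

Variable k : comNzRingType.
Variables (sm sp : seq (rd_lat R)).
Hypotheses (hm : enumerates sm (odd_signed R false)) (hp : enumerates sp (odd_signed R true)).
Notation mul := (G_mul k H X b).
Notation j0 := (G0_incl k H X b).

(** A product that begins with [G0] in [compmx] order ends with it as a matrix product, which is the
    shape given by [G_left]; there the lists enter as the single enumeration [s ++ s']. *)
Lemma left_iso (p p' : bool) s s' (hs : enumerates s (odd_signed R p)) (hs' : enumerates s' (odd_signed R p')) :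
  odd_enum (s ++ s') ->
  nat_iso (triple_product mul j0 (G1_incl k H X b hs) (G1_incl k H X b hs')).
Proof.
move=> sE; apply: nat_iso_bij => A.
  move=> [[[F0 h0] [F1 h1]] [F2 h2]] [[[F0' h0'] [F1' h1']] [F2' h2']] /(congr1 sval) /= e.
  have [e0 e1 e2] := left_product sE h0 h1 h2 h0' h1' h2' e.
  by congr (_, _, _); apply: eq_exist.
move=> [F hF]; have [tau [F0 [ot h0 e]]] := G_left sE hF.
unshelve eexists ((exist _ F0 h0, exist _ (odd_product X b s tau) _), exist _ (odd_product X b s' tau) _).
- by exists tau.
- by exists tau.
by apply: eq_exist; rewrite /= /compmx mulmxA -odd_product_cat.
Qed.

Lemma right_iso (p p' : bool) s s' (hs : enumerates s (odd_signed R p)) (hs' : enumerates s' (odd_signed R p')) :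
  odd_enum (s ++ s') ->
  nat_iso (triple_product mul (G1_incl k H X b hs) (G1_incl k H X b hs') j0).
Proof.
move=> sE; apply: nat_iso_bij => A.
  move=> [[[F1 h1] [F2 h2]] [F0 h0]] [[[F1' h1'] [F2' h2']] [F0' h0']] /(congr1 sval) /= e.
  have [e0 e1 e2] := right_product sE h0 h1 h2 h0' h1' h2' e.
  by congr (_, _, _); apply: eq_exist.
move=> [F hF]; have [tau [F0 [ot h0 e]]] := G_right sE hF.
unshelve eexists ((exist _ (odd_product X b s tau) _, exist _ (odd_product X b s' tau) _), exist _ F0 h0).
- by exists tau.
- by exists tau.
by apply: eq_exist; rewrite /= /compmx -odd_product_cat.
Qed.

Lemma signed_odd_enum : odd_enum (sm ++ sp).
Proof.
have [um mE] := hm; have [up pE] := hp; have [_ pn excl _ _] := R_dist.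
split=> [|c].
  rewrite cat_uniq um up andbT /=; apply/hasPn => c /pE[_ cp]; apply/negP => /mE[_ cn].
  exact: (excl c).
rewrite mem_cat; split=> [/orP[/mE[]|/pE[]] //|c1].
have [cp|cn] := pn c (or_intror c1); apply/orP; [right; apply/pE|left; apply/mE]; by split.
Qed.

End ChevalleyGroups.

Theorem corollary5p3p10
  (K : closedFieldType) (hK : [pchar K] =i pred0)
  (g : lieSuperalg K) (hg : classical g) (hg' : standing_type g)
  (h : {vspace g}) (hh : cartan_subalgebra h)
  (R : rootDatum h) (hR : standard_rootDatum R) (hPi : distinguished R)
  (l : nat) (H : l.-tuple g) (X : rd_lat R -> g) (hX : chevalley_basis H X)
  (V : superModule g) (hV : faithful V) (hV' : rational h V H)
  (d : nat) (b : d.-tuple V) (hb : admissible_lattice H X b)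
  (k : comNzRingType) (hk2 : 2%:R != 0 :> k) (hk3 : 3%:R != 0 :> k)
  (hk : no23torsion k)
  (* the total orders on the negative and on the positive odd roots *)
  (sm sp : seq (rd_lat R))
  (hm : enumerates sm (odd_signed R false))
  (hp : enumerates sp (odd_signed R true)) :
  let G := G_functor k H X b in
  let G0 := G0_functor k H X b in
  let Gm := G1_functor k X b sm in
  let Gp := G1_functor k X b sp in
  product_decompositions (G_mul k H X b) (G0_incl k H X b)
    (G1_incl k H X b hm) (G1_incl k H X b hp) /\
  forall (bG bG0 bGm bGp : presheaf k)
    (u : nat_trans G bG) (u0 : nat_trans G0 bG0)
    (um : nat_trans Gm bGm) (up : nat_trans Gp bGp),
  is_sheafification u -> is_sheafification u0 ->
  is_sheafification um -> is_sheafification up ->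
  let induced (mul : nat_trans (prod2 bG bG) bG) (j0 : nat_trans bG0 bG)
      (jm : nat_trans bGm bG) (jp : nat_trans bGp bG) :=
    [/\ extends_along (nat_prod2 u u) u (G_mul k H X b) mul,
        extends_along u0 u (G0_incl k H X b) j0,
        extends_along um u (G1_incl k H X b hm) jm
      & extends_along up u (G1_incl k H X b hp) jp] in
  (exists mul j0 jm jp, induced mul j0 jm jp) /\
  forall mul j0 jm jp, induced mul j0 jm jp ->
    product_decompositions mul j0 jm jp.
Proof.
move=> G G0 Gm Gp.
have h_even : (h <= lie_part g false)%VS by case: hh.
have b_basis : basis_of fullv b by case: hb.
have rf := standard_root_facts hK hg' h_even hR hPi hX hV hV' b_basis.
have sE := signed_odd_enum hPi hm hp; have sE' := odd_enum_catC sE.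
have i1 := left_iso hK h_even hPi hX rf hV hV' hb k hm hp sE.
have i2 := left_iso hK h_even hPi hX rf hV hV' hb k hp hm sE'.
have i3 := right_iso hK h_even hPi hX rf hV hV' hb k hm hp sE.
have i4 := right_iso hK h_even hPi hX rf hV hV' hb k hp hm sE'.
split; first by split; apply: iso_all_orders.
move=> bG bG0 bGm bGp u u0 um up uS u0S umS upS induced.
exact: (sheafified_decompositions i1 i2 i3 i4 uS u0S umS upS).
Qed.
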